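(* Let $k\ge1$ be a fixed integer, let $\mu$ be the law of a real random variable $\xi$ with $\mathbb E\xi=0$, $\mathbb E\xi^2=1$ and $\mathbb E\exp(t_0\xi^2)<\infty$ for some $t_0>0$, and suppose $p=p_n$ satisfies $p/\log n\to\beta\in(0,\infty)$ as $n\to\infty$. Then $$\frac{T_{n,k}}{p}\longrightarrow\sup_{Q\in\Gamma_{k,\beta,\mu}}\lambda_{\max}(Q)\qquad\text{in probability as }n\to\infty.$$
   Context: $X=X_n=(\xi_{ij})_{1\le i\le p,\,1\le j\le n}\in\mathbb R^{p\times n}$ has i.i.d. entries that are copies of $\xi$. For $S\subset[n]=\{1,\dots,n\}$, $X_{[S]}$ is the submatrix formed by the columns indexed by $S$, and $$T_{n,k}:=\max_{S\subset[n],\,|S|=k}\lambda_{\max}\big(X_{[S]}^\top X_{[S]}\big).$$ $\mathcal P_2(\mathbb R^k)$ is the set of Borel probability measures on $\mathbb R^k$ with finite second moment. For probability measures, $D(\nu\|\rho):=\int\log\frac{d\nu}{d\rho}\,d\nu$ if $\nu\ll\rho$ and $+\infty$ otherwise (KL divergence). For $\varnothing\ne U\subset[k]$, $\nu_U$ is the marginal of $\nu$ on the coordinates in $U$. Define $$\mathcal M_{k,\beta,\mu}:=\Big\{\nu\in\mathcal P_2(\mathbb R^k):\ D\big(\nu_U\,\big\|\,\mu^{\otimes|U|}\big)\le\frac{|U|}{\beta}\text{ for all }\varnothing\ne U\subset[k]\Big\},$$ $$\Gamma_{k,\beta,\mu}:=\Big\{\int xx^\top\,d\nu(x):\ \nu\in\mathcal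 M_{k,\beta,\mu}\Big\}.$$ *)

(* Defs.v *)
(* MathComp / MathComp-Analysis *)
From HB Require Import structures.
From mathcomp Require Import all_boot all_order all_algebra.
From mathcomp Require Import all_classical all_reals all_analysis.

Set Implicit Arguments.
Unset Strict Implicit.
Unset Printing Implicit Defensive.

Import Order.TTheory GRing.Theory Num.Theory.
Import numFieldNormedType.Exports.

Local Open Scope classical_set_scope.
Local Open Scope ring_scope.

Section Matrices.
Context {R : realType}.

(* For a real symmetric matrix of positive size, the set of eigenvalues is
   finite and nonempty, so this is the largest eigenvalue. *)
Definition lambda_max (m : nat) (A : 'M[R]_m) : R :=
  sup [set a | eigenvalue A a].

(* X_[S] *)
Definition columns (p n : nat) (S : {set 'I_n}) (X : 'M[R]_(p, n)) :
    'M[R]_(p, #|S|) :=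
  colsub (fun j : 'I_#|S| => enum_val j) X.

(* The index set is finite, and nonempty as soon as k <= n: the supremum is
   then a maximum. *)
Definition T_nk (p n k : nat) (X : 'M[R]_(p, n)) : R :=
  sup [set lambda_max ((columns S X)^T *m columns S X)
      | S in [set S : {set 'I_n} | #|S| = k]].

End Matrices.

Section Probability.
Context {R : realType}.

Definition mutually_independent d (T : measurableType d)
    (P : probability T R) (I : finType) (X : I -> {RV P >-> R}) : Prop :=
  forall (J : {set I}) (A : I -> set R),
    (forall i, i \in J -> measurable (A i)) ->
    P (\bigcap_(i in [set` J]) (X i @^-1` A i)) =
      (\prod_(i in J) P (X i @^-1` A i))%E.

Definition iid_with_law d (T : measurableType d)
    (P : probability T R) (I : finType) (X : I -> {RV P >-> R})
    (mu : probability R R) : Prop :=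
  mutually_independent X /\
  forall i A, measurable A -> distribution P (X i) A = mu A.

(* Since the limit is a constant, each Y n may live on its own probability
   space. *)
Definition converges_in_probability (d : nat -> measure_display)
    (T : forall n, measurableType (d n)) (P : forall n, probability (T n) R)
    (Y : forall n, T n -> R) (l : R) : Prop :=
  forall eps : R, 0 < eps ->
    (fun n => P n [set w | eps < `|Y n w - l|]) @ \oo --> 0%E.

(* D(nu || rho); the density may be nonpositive, where lne is -oo, only on a
   nu-null set. *)
Definition KL d (T : measurableType d) (nu rho : probability T R) : \bar R :=
  if `[< nu `<< rho >] then
    (\int[nu]_x lne (Radon_Nikodym (charge_of_finite_measure nu) rho x))%E
  else +oo%E.

End Probability.

(* R^m is represented by m.-tuple R, whose sigma-algebra (generated by the
   coordinate maps) is the Borel sigma-algebra. *)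
Section ProductMeasure.
Context {R : realType}.

Definition cons_pair (m : nat) (x : R * m.-tuple R) : m.+1.-tuple R :=
  [tuple of x.1 :: x.2].

Lemma measurable_cons_pair (m : nat) :
  measurable_fun [set: R * m.-tuple R] (@cons_pair m).
Proof.
exact: (measurable_cons measurable_fst measurable_snd).
Qed.

HB.instance Definition _ (m : nat) :=
  isMeasurableFun.Build _ _ _ _ (@cons_pair m) (@measurable_cons_pair m).

(* The product measure mu^{\otimes m}, whose values on boxes are given by
   product_prob_box. *)
Fixpoint product_prob (mu : probability R R) (m : nat) :
    probability (m.-tuple R) R :=
  match m with
  | 0 => dirac ([tuple] : 0.-tuple R)
  | m'.+1 => distribution (mu \x product_prob mu m')%E (@cons_pair m')
  end.

Lemma product_prob_box (mu : probability R R) (m : nat) (A : 'I_m -> set R) :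
  (forall i, measurable (A i)) ->
  product_prob mu m [set x | forall i, A i (tnth x i)] =
    (\prod_(i < m) mu (A i))%E.
Proof.
elim: m A => [|m IHm] A mA.
  rewrite big_ord0 /= diracE mem_set//.
  by case.
rewrite big_ord_recl -IHm => [|i]; last exact: mA.
rewrite /= /distribution /pushforward -product_measure1E//; last first.
  rewrite (_ : mkset _ =
      \bigcap_(i in [set: 'I_m]) ((@tnth m R)^~ i @^-1` A (lift ord0 i))).
    apply: fin_bigcap_measurable => [|i _]; first exact: finite_finset.
    by rewrite -[X in measurable X]setTI; exact: measurable_tnth.
  by apply/seteqP; split=> x /= h i => [_|]; exact: h.
congr (_ _); apply/seteqP; split=> -[a x] /= h.
  split; first exact: (h ord0).
  by move=> i; have := h (lift ord0 i); rewrite tnthS.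
move=> i; case: (unliftP ord0 i) => [j ->|->]; last exact: h.1.
by rewrite tnthS; exact: h.2.
Qed.

Definition proj (k : nat) (U : {set 'I_k}) (x : k.-tuple R) : #|U|.-tuple R :=
  [tuple tnth x (enum_val j) | j < #|U|].

Lemma measurable_proj (k : nat) (U : {set 'I_k}) :
  measurable_fun [set: k.-tuple R] (proj U).
Proof.
apply/measurable_fun_tnthP => j.
rewrite (_ : _ \o _ = (@tnth k R)^~ (enum_val j)); first exact: measurable_tnth.
by apply/funext => x; rewrite /= tnth_mktuple.
Qed.

HB.instance Definition _ (k : nat) (U : {set 'I_k}) :=
  isMeasurableFun.Build _ _ _ _ (proj U) (@measurable_proj k U).

(* nu_U *)
Definition marginal (k : nat) (U : {set 'I_k})
    (nu : probability (k.-tuple R) R) : probability (#|U|.-tuple R) R :=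
  distribution nu (proj U).

End ProductMeasure.

Section VariationalProblem.
Context {R : realType}.

Definition P2 (k : nat) : set (probability (k.-tuple R) R) :=
  [set nu : probability (k.-tuple R) R |
    (\int[nu]_x (\sum_(i < k) tnth x i ^+ 2)%:E < +oo)%E].

Definition M_set (k : nat) (beta : R) (mu : probability R R) :
    set (probability (k.-tuple R) R) :=
  [set nu : probability (k.-tuple R) R | P2 nu /\
    forall U : {set 'I_k}, U != finset.set0 ->
      (KL (marginal U nu) (product_prob mu #|U|) <= (#|U|%:R / beta)%:E)%E].

Arguments M_set k beta mu : clear implicits.

Definition second_moment (k : nat) (nu : probability (k.-tuple R) R) : 'M[R]_k :=
  \matrix_(i, j) \int[nu]_x (tnth x i * tnth x j).

Definition Gamma_set (k : nat) (beta : R) (mu : probability R R) :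
    set 'M[R]_k :=
  [set second_moment nu | nu in M_set k beta mu].

End VariationalProblem.

Arguments M_set {R} k beta mu.
Arguments Gamma_set {R} k beta mu.

(* Main.v *)
Require Import Defs.
From HB Require Import structures.
From mathcomp Require Import all_boot all_order all_algebra.
From mathcomp Require Import all_classical all_reals all_analysis.
From mathcomp Require Import measurable_realfun.
From mathcomp Require Import ring lra.

(** The limit comes from a large deviation heuristic for the joint empirical law
of the [p] rows of [k] columns. That this law is close to [nu] has probability
about [exp (- p D(nu || mu^k))], and there are [n^k = exp (k log n)] choices of
columns, with [log n] close to [p / beta]. Seen on the coordinates in [U], only
[n^#|U|] choices of columns compete, so every marginal has to be affordable:
[D(nu_U || mu^U) <= #|U| / beta]. These are the laws in [M_set], and a [k]-tuple
of columns whose empirical law is [nu] has normalised Gram matrix equal to the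
second moment matrix of [nu].

Everything is reduced to rows with values in a finite alphabet. The line is cut
into geometric cells, by sign and by the power of [1 + h] just below [1 + |x|],
with one outer cell of either sign. Two points [x], [y] of the same inner cell
differ by at most [h (1 + |y|)], so that a quadratic form [(v.x)^2] changes by a
factor [1 + h] and an error [O(h (k + |x|^2))] ([mesh_quadratic]). Relative
entropy decreases when a law is replaced by its cell law ([data_processing],
from Gibbs' inequality), and conversely a law on tuples of cells that satisfies
the entropy constraints is the cell law of an element of [M_set] whose density
is constant on cells ([M_set_cells]). Cell laws are mixed with a small amount of
the product law in both halves; by convexity ([rel_entropy_mix]) this gains a
factor in all the constraints at once, which absorbs the errors in the exponential
rates.

Upper bound. With [O(log p)] cells it is unlikely that an entry falls in an outer cell. The method of
types bounds the probability that the empirical law of [m] given columns has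
relative entropy above [b / p] by [(p + 1)^(number of tuples of cells) exp (- b)]
([types_bound]), and a union bound over all subtuples of columns leaves a
probability tending to [0] ([atypical_matrix_prob]). Otherwise the empirical law
of any [k] columns, mixed as above, is the cell law of some [nu] in [M_set], and
the Rayleigh quotients of the Gram matrix are at most those of the second moment
of [nu], up to the mesh error ([typical_T_nk_le]).

Lower bound. A near-optimal [nu] is discretised with finitely many cells, which
lose little of the second moment ([inner_moment_near], [cell_inf_mean]). The
columns are split into [k] blocks, and the second moment method is applied to
the number of [k]-tuples, one column per block, whose rows are typical for the
cell law ([second_moment_method]). A pair of tuples sharing exactly the columns
in [U] contributes [n^(-#|U|) exp (p (D_U + o(1)))], where [D_U] is the relative
entropy of the marginal on [U]: this is where the constraint for [U] is used.

[T_nk] is handled through Rayleigh quotients ([T_nk_le], [le_T_nk]), which also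
give its measurability, with integer vectors as a countable test family. *)

Set Implicit Arguments.
Unset Strict Implicit.
Unset Printing Implicit Defensive.

Import Order.TTheory GRing.Theory Num.Theory.
Import numFieldNormedType.Exports.

Local Open Scope ring_scope.

(** * Laws on finite sets and relative entropy *)

Section FiniteProbability.
Context {R : realType}.

Definition image_law (D E : finType) (w : D -> R) (G : D -> E) (e : E) : R :=
  \sum_(d | G d == e) w d.

Definition prod_law (K C : finType) (pi : C -> R) (d : {ffun K -> C}) : R :=
  \prod_a pi (d a).

Definition pointwise (I C D : finType) (G : C -> D) (z : {ffun I -> C}) :
  {ffun I -> D} := [ffun i => G (z i)].

(** The uniform weight on the positions [I], transported by [y]. *)
Definition emp_law (I D : finType) (y : {ffun I -> D}) : D -> R :=
  image_law (fun _ => #|I|%:R^-1) y.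

Definition rel_entropy (D : finType) (w rho : D -> R) : R :=
  \sum_d w d * ln (w d / rho d).

Lemma sum_image_law (D E : finType) (w : D -> R) (G : D -> E) (h : E -> R) :
  \sum_e image_law w G e * h e = \sum_d w d * h (G d).
Proof.
rewrite [RHS](partition_big G xpredT)//=; apply: eq_bigr => e _.
by rewrite /image_law mulr_suml; apply: eq_bigr => d /eqP ->.
Qed.

Lemma sum_image_law1 (D E : finType) (w : D -> R) (G : D -> E) :
  \sum_e image_law w G e = \sum_d w d.
Proof.
have := sum_image_law w G (fun=> 1).
by under eq_bigr do rewrite mulr1; under [in RHS]eq_bigr do rewrite mulr1.
Qed.

Lemma image_law_ge0 (D E : finType) (w : D -> R) (G : D -> E) e :
  (forall d, 0 <= w d) -> 0 <= image_law w G e.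
Proof. by move=> w0; apply: sumr_ge0. Qed.

Lemma le_image_law (D E : finType) (w : D -> R) (G : D -> E) d :
  (forall d, 0 <= w d) -> w d <= image_law w G (G d).
Proof.
move=> w0; rewrite /image_law (bigD1 d)//= lerDl; exact: sumr_ge0.
Qed.

Lemma image_law_comp (D E F : finType) (w : D -> R) (G : D -> E) (H : E -> F) f :
  image_law (image_law w G) H f = image_law w (H \o G) f.
Proof.
rewrite /image_law (partition_big G (fun e => H e == f))//=.
apply: eq_bigr => e /eqP He; apply: eq_bigl => d.
by have [->|] := eqVneq (G d) e; rewrite ?He ?eqxx ?andbF.
Qed.

Lemma eq_image_law (D E : finType) (w1 w2 : D -> R) (G1 G2 : D -> E) e :
  w1 =1 w2 -> G1 =1 G2 -> image_law w1 G1 e = image_law w2 G2 e.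
Proof.
by move=> h1 h2; apply: eq_big => [d|d _]; rewrite ?h1 ?h2.
Qed.

Lemma prod_law_ge0 (K C : finType) (pi : C -> R) (d : {ffun K -> C}) :
  (forall c, 0 <= pi c) -> 0 <= prod_law pi d.
Proof. by move=> h; apply: prodr_ge0. Qed.

Lemma sum_prod_law (K C : finType) (pi : C -> R) :
  \sum_(d : {ffun K -> C}) prod_law pi d = (\sum_c pi c) ^+ #|K|.
Proof.
rewrite /prod_law -(bigA_distr_bigA (fun (_ : K) c => pi c)) /=.
by rewrite big_const iter_mulr_1.
Qed.

Lemma sum_prod_law1 (K C : finType) (pi : C -> R) : \sum_c pi c = 1 ->
  \sum_(d : {ffun K -> C}) prod_law pi d = 1.
Proof. by rewrite sum_prod_law => ->; rewrite expr1n. Qed.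

(** Independent letters stay independent under a letterwise map. *)
Lemma image_prod_law (I C D : finType) (rho : C -> R) (G : C -> D)
    (y : {ffun I -> D}) :
  image_law (prod_law rho) (pointwise G) y = prod_law (image_law rho G) y.
Proof.
rewrite /prod_law /image_law (bigA_distr_big_dep (fun i j => G j == y i) (fun _ c => rho c)) /=.
apply: eq_bigl => z; apply/eqP/familyP => /= [<- i|h].
  by rewrite unfold_in /= ffunE.
by apply/ffunP => i; rewrite ffunE; apply/eqP/(h i).
Qed.

(** The marginal of a product law on the coordinates selected by an injection:
the other coordinates sum to one. *)
Lemma image_prod_law_inj (K J C : finType) (pi : C -> R) (s : K -> J)
    (d : {ffun K -> C}) :
  \sum_c pi c = 1 -> injective s ->
  image_law (prod_law pi) (fun r : {ffun J -> C} => [ffun a => r (s a)]) d = prod_law pi d.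
Proof.
move=> pi1 sI; pose Q (j : J) (c : C) := [forall a, (s a == j) ==> (c == d a)].
(* The fibre is a box: the coordinates [s a] are pinned and the others free. *)
transitivity (\prod_j \sum_(c | Q j c) pi c).
  rewrite (bigA_distr_big_dep Q (fun _ c => pi c)) /=; apply: eq_bigl => r.
  apply/eqP/familyP => [e j|h].
    rewrite unfold_in; apply/forallP => a; apply/implyP => /eqP <-.
    by rewrite -e ffunE.
  apply/ffunP => a; rewrite ffunE; have := h (s a); rewrite unfold_in.
  by move=> /forallP/(_ a); rewrite eqxx => /eqP.
rewrite (bigID (mem (s @: finset.setT))) /= [X in _ * X]big1 ?mulr1.
  rewrite big_imset /=; last by move=> ? ? _ _; exact: sI.
  rewrite big_mkcond /prod_law; apply: eq_bigr => a _; rewrite finset.inE.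
  rewrite (big_pred1 (d a))// => c; apply/forallP/eqP => [/(_ a)|-> b].
    by rewrite eqxx => /eqP.
  by apply/implyP => /eqP/sI ->.
move=> j js; rewrite -[RHS]pi1; apply: eq_bigl => c.
apply/forallP => a; apply/implyP => /eqP sa.
by move: js; rewrite -sa imset_f ?finset.inE.
Qed.

(** The tangent at [m] to the convex function [x * ln x], extended by [0] at [0]. It
serves for the convexity of relative entropy and, at [x = 1], as [ln y <= y - 1]. *)
Lemma xlnx_tangent (x m : R) : 0 <= x -> 0 < m ->
  x * ln m + x - m <= x * ln x.
Proof.
rewrite le_eqVlt => /predU1P[<- m0|x0 m0].
  by rewrite !mul0r !add0r oppr_le0 ltW.
have mx : 0 < m / x by rewrite divr_gt0.
have : ln (m / x) <= m / x - 1.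
  by rewrite -[leLHS]/(ln (m / x)); have := @le_ln1Dx R (m / x - 1);
     rewrite addrCA subrr addr0; apply; lra.
rewrite ln_div ?posrE// -(ler_pM2l x0) => h.
have e : x * (m / x - 1) = m - x by field; rewrite gt_eqF.
by rewrite e in h; lra.
Qed.

(** Convexity of relative entropy in its first argument, the second law having
relative entropy [0] with respect to itself. Mixing thus divides all the
constraints of the problem by the same factor. *)
Lemma rel_entropy_mix (D : finType) (w rho : D -> R) (t : R) :
  (forall d, 0 <= w d) -> (forall d, 0 <= rho d) ->
  (forall d, rho d = 0 -> w d = 0) -> 0 < t -> t < 1 ->
  rel_entropy (fun d => (1 - t) * w d + t * rho d) rho <= (1 - t) * rel_entropy w rho.
Proof.
move=> w0 rho0 wrho t0 t1; rewrite /rel_entropy mulr_sumr; apply: ler_sum => d _.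
have [rd|rd] := eqVneq (rho d) 0.
  by rewrite wrho// rd !mulr0 addr0 !mul0r mulr0.
have rdp : 0 < rho d by rewrite lt_neqAle eq_sym rd rho0.
set x := w d / rho d.
have wE : w d = x * rho d by rewrite /x divfK.
have x0 : 0 <= x by rewrite divr_ge0.
have -> : ((1 - t) * w d + t * rho d) / rho d = (1 - t) * x + t.
  by rewrite wE; field.
rewrite wE; set m := (1 - t) * x + t.
have m0 : 0 < m by apply: ltr_wpDl => //; apply: mulr_ge0 => //; lra.
have h1 := xlnx_tangent x0 m0; have := xlnx_tangent (@ler01 R) m0.
rewrite ln1 mulr0 mul1r => h2.
have -> : (1 - t) * (x * rho d) + t * rho d = m * rho d by rewrite /m; ring.
have -> : (1 - t) * (x * rho d * ln x) = ((1 - t) * (x * ln x)) * rho d by ring.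
rewrite mulrAC ler_pM2r//.
have : (1 - t) * (x * ln m + x - m) <= (1 - t) * (x * ln x).
  by rewrite ler_pM2l// subr_gt0.
have : t * (ln m + 1 - m) <= 0 by rewrite pmulr_rle0.
have -> : m * ln m = (1 - t) * (x * ln m + x - m) + t * (ln m + 1 - m).
  by move: (ln m) => l; rewrite /m; ring.
lra.
Qed.

End FiniteProbability.

(** * Method of types and typical sequences *)

Section Types.
Context {R : realType}.

Lemma emp_law_gt0 (I D : finType) (y : {ffun I -> D}) i : 0 < @emp_law R I D y (y i).
Proof.
have c0 : 0 < #|I|%:R^-1 :> R.
  by rewrite invr_gt0 ltr0n; apply/card_gt0P; exists i.
apply: lt_le_trans c0 _; apply: (le_image_law y i (w := fun=> #|I|%:R^-1)) => _.
by rewrite invr_ge0.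
Qed.

Lemma emp_law_ge0 (I D : finType) (y : {ffun I -> D}) d : 0 <= @emp_law R I D y d.
Proof. by apply: image_law_ge0 => _; rewrite invr_ge0. Qed.

Lemma sum_emp_law (I D : finType) (y : {ffun I -> D}) : (0 < #|I|)%N ->
  \sum_d @emp_law R I D y d = 1.
Proof.
move=> I0; rewrite sum_image_law1 sumr_const -[LHS]mulr_natr mulVf// pnatr_eq0.
by rewrite -lt0n.
Qed.

(** Method of types in terms of likelihoods. A sequence of type [t] that enters
the sum has probability less than [expR (- b)] times its probability under [t]; for each [t] the latter
sum to at most one, and there are at most [#|I|.+1 ^ #|D|] types. *)
Lemma types_bound (I D : finType) (rho : D -> R) (b : R) :
  (forall d, 0 <= rho d) ->
  \sum_(y : {ffun I -> D} | expR b * prod_law rho y < prod_law (emp_law y) y) prod_law rho y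
    <= (#|I|.+1 ^ #|D|)%:R * expR (- b).
Proof.
move=> rho0.
(* [ty] counts the occurrences of each letter, [em] turns counts into a law. *)
pose ty (y : {ffun I -> D}) : {ffun D -> 'I_(#|I|.+1)} :=
  [ffun d => inord #|[set i | y i == d]|].
pose em (t : {ffun D -> 'I_(#|I|.+1)}) (d : D) : R := (t d)%:R / #|I|%:R.
have tyE y d : em (ty y) d = emp_law y d.
  rewrite /em ffunE inordK ?ltnS ?max_card// /emp_law /image_law sumr_const.
  rewrite -[RHS]mulr_natl; congr (_%:R * _).
  by apply: eq_card => i; rewrite !finset.inE.
apply: (@le_trans _ _ (\sum_(y : {ffun I -> D}) expR (- b) * prod_law (em (ty y)) y)).
  rewrite big_mkcond; apply: ler_sum => y _.
  have -> : prod_law (em (ty y)) y = prod_law (emp_law y) y.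
    by apply: eq_bigr => i _; rewrite tyE.
  case: ifPn => [/ltW h|_].
    by rewrite -(ler_pM2l (expR_gt0 b)) mulrA -expRD subrr expR0 mul1r.
  by rewrite mulr_ge0 ?expR_ge0// prod_law_ge0// => d; exact: emp_law_ge0.
rewrite -mulr_sumr mulrC ler_pM2r ?expR_gt0//.
rewrite (partition_big ty xpredT)//=.
apply: (@le_trans _ _ (\sum_(t : {ffun D -> 'I_(#|I|.+1)}) 1)); last first.
  by rewrite sumr_const card_ffun card_ord.
apply: ler_sum => t _.
have [[y0 y0t]|no] := pselect (exists y, ty y = t); last first.
  by rewrite big_pred0// => y; apply/eqP => h; apply: no; exists y.
apply: (@le_trans _ _ (\sum_(y : {ffun I -> D}) prod_law (em t) y)).
  rewrite big_mkcond; apply: ler_sum => y _; case: eqP => [->//|_].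
  by apply: prod_law_ge0 => d; rewrite /em divr_ge0.
rewrite sum_prod_law -y0t.
under eq_bigr do rewrite tyE.
have [I0|I0] := posnP #|I|; first by rewrite I0 expr0.
by rewrite sum_emp_law// expr1n.
Qed.

(** The logarithm of the likelihood ratio of [y] between its empirical law and [rho]
is [#|I|] times a relative entropy. The second conclusion holds because a letter
of null weight would make the likelihood under [rho] vanish. *)
Lemma rel_entropy_emp_le (I D : finType) (rho : D -> R) (b : R) (y : {ffun I -> D}) :
  (forall d, 0 <= rho d) -> (0 < #|I|)%N ->
  prod_law (emp_law y) y <= expR b * prod_law rho y ->
  rel_entropy (emp_law y) rho <= b / #|I|%:R /\ forall d, rho d = 0 -> @emp_law R I D y d = 0.
Proof.
move=> rho0 I0 h.
have p0 : 0 < #|I|%:R :> R by rewrite ltr0n.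
have e0 : 0 < prod_law (@emp_law R I D y) y by apply: prodr_gt0 => i _; exact: emp_law_gt0.
have t0 : 0 < prod_law rho y.
  by rewrite -(pmulr_rgt0 _ (expR_gt0 b)); exact: lt_le_trans h.
have ry i : 0 < rho (y i).
  rewrite lt_neqAle rho0 eq_sym andbT; apply/eqP => r0.
  by move: t0; rewrite /prod_law (bigD1 i)//= r0 mul0r ltxx.
split; last first.
  move=> d d0; rewrite /emp_law /image_law big_pred0// => i; apply/eqP => yd.
  by have := ry i; rewrite yd d0 ltxx.
rewrite /rel_entropy sum_image_law -mulr_sumr mulrC ler_pM2r ?invr_gt0//.
rewrite -(@ler_expR R) expR_sum.
rewrite (eq_bigr (fun i => emp_law y (y i) * (rho (y i))^-1)); last first.
  by move=> i _; rewrite lnK// posrE divr_gt0 ?emp_law_gt0.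
by rewrite big_split /= prodfV ler_pdivrMr.
Qed.

End Types.

Section Typical.
Context {R : realType}.

(** The variance of a sum of independent centred variables: the cross terms vanish. *)
Lemma sum_prod_law_sq (I D : finType) (w psi : D -> R) :
  \sum_d w d = 1 -> \sum_d w d * psi d = 0 ->
  \sum_(y : {ffun I -> D}) prod_law w y * (\sum_i psi (y i)) ^+ 2 =
  #|I|%:R * \sum_d w d * psi d ^+ 2.
Proof.
move=> w1 wpsi.
have E i j : \sum_(y : {ffun I -> D}) prod_law w y * (psi (y i) * psi (y j)) =
    if i == j then \sum_d w d * psi d ^+ 2 else 0.
  pose F (l : I) d := w d * ((if l == i then psi d else 1) *
                             (if l == j then psi d else 1)).
  transitivity (\prod_l \sum_d F l d).
    rewrite (bigA_distr_bigA F); apply: eq_bigr => y _.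
    rewrite /prod_law /F !big_split /=; congr (_ * (_ * _)).
      by rewrite (bigD1 i)//= eqxx big1 ?mulr1// => l /negbTE ->.
    by rewrite (bigD1 j)//= eqxx big1 ?mulr1// => l /negbTE ->.
  rewrite (bigD1 i)//= /F eqxx; case: eqVneq => [<-|ij].
    rewrite [X in _ * X]big1 ?mulr1 => [|l /negbTE li].
      by under eq_bigr do rewrite -expr2.
    by rewrite -[RHS]w1; apply: eq_bigr => d _; rewrite li !mulr1.
  by under eq_bigr do rewrite mulr1; rewrite wpsi mul0r.
under eq_bigr do rewrite expr2 big_distrlr /= mulr_sumr.
rewrite exchange_big /= -sum1_card natr_sum mulr_suml; apply: eq_bigr => i _.
under eq_bigr do rewrite mulr_sumr.
rewrite exchange_big /= (bigD1 i)//= E eqxx [X in _ + X]big1 ?addr0 ?mul1r// => j ji.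
by rewrite E eq_sym (negbTE ji).
Qed.

Definition mean (D : finType) (w phi : D -> R) : R := \sum_d w d * phi d.

(** Positive weight is part of the definition so that the logarithms of likelihood
ratios are meaningful along a typical sequence. *)
Definition typical (F D I : finType) (w : D -> R) (phi : F -> D -> R) (e : R) :
    pred {ffun I -> D} := fun y =>
  (0 < prod_law w y) &&
  [forall m, `|\sum_i phi m (y i) - #|I|%:R * mean w (phi m)| <= #|I|%:R * e].

Definition variance_sum (F D : finType) (w : D -> R) (phi : F -> D -> R) : R :=
  \sum_m \sum_d w d * (phi m d - mean w (phi m)) ^+ 2.

(** Chebyshev, with the statistics treated together by summing their variances. *)
Lemma typical_weight (F D I : finType) (w : D -> R) (phi : F -> D -> R) (e : R) :
  (forall d, 0 <= w d) -> \sum_d w d = 1 -> 0 < e -> (0 < #|I|)%N ->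
  1 - variance_sum w phi / (#|I|%:R * e ^+ 2) <=
    \sum_(y : {ffun I -> D} | typical w phi e y) prod_law w y.
Proof.
move=> w0 w1 e0 I0; have p0 : 0 < #|I|%:R :> R by rewrite ltr0n.
have pe0 : 0 < #|I|%:R * e by rewrite mulr_gt0.
rewrite lerBlDr -[leLHS](sum_prod_law1 I w1) (bigID (typical w phi e))/= lerD2l.
have -> : variance_sum w phi / (#|I|%:R * e ^+ 2) = \sum_(y : {ffun I -> D})
    prod_law w y * \sum_m ((\sum_i phi m (y i) - #|I|%:R * mean w (phi m)) /
                       (#|I|%:R * e)) ^+ 2.
  under [RHS]eq_bigr do rewrite mulr_sumr.
  rewrite exchange_big /= /variance_sum mulr_suml; apply: eq_bigr => m _.
  under [RHS]eq_bigr do rewrite expr_div_n mulrA.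
  rewrite -mulr_suml.
  under [X in _ = X * _]eq_bigr => y _.
    rewrite (_ : _ - _ = \sum_i (phi m (y i) - mean w (phi m))); last first.
      by rewrite sumrB sumr_const -[X in _ = _ - X]mulr_natl.
    over.
  rewrite (sum_prod_law_sq I (psi := fun d => phi m d - mean w (phi m)))//; last first.
    under eq_bigr do rewrite mulrBr; rewrite sumrB -mulr_suml w1 mul1r.
    by rewrite subrr.
  by field; rewrite !gt_eqF.
rewrite big_mkcond /=; apply: ler_sum => y _.
have t0 : 0 <= prod_law w y by apply: prod_law_ge0.
have s0 : 0 <= \sum_m ((\sum_i phi m (y i) - #|I|%:R * mean w (phi m)) /
                       (#|I|%:R * e)) ^+ 2.
  by apply: sumr_ge0 => m _; exact: sqr_ge0.
case: ifPn => [|_]; last by rewrite mulr_ge0.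
rewrite negb_and -leNgt => /orP[tl0|/forallPn[m]].
  by rewrite (le_trans tl0)// mulr_ge0.
rewrite -ltNge => h; rewrite ler_peMr// (bigD1 m)//=.
rewrite -[leLHS]addr0 lerD//; last by apply: sumr_ge0 => ? _; exact: sqr_ge0.
rewrite -[leRHS]real_normK ?num_real// expr_ge1//.
by rewrite normf_div (gtr0_norm pe0) ler_pdivlMr// mul1r ltW.
Qed.

(** Chebyshev at distance equal to the mean; the mean may vanish, hence the product form. *)
Lemma second_moment_zero (Z : finType) (Pr N : Z -> R) :
  (forall z, 0 <= Pr z) -> \sum_z Pr z = 1 ->
  (\sum_(z | N z == 0) Pr z) * (\sum_z Pr z * N z) ^+ 2 <=
  \sum_z Pr z * N z ^+ 2 - (\sum_z Pr z * N z) ^+ 2.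
Proof.
move=> P0 P1; set m := \sum_z Pr z * N z.
apply: (@le_trans _ _ (\sum_z Pr z * (N z - m) ^+ 2)).
  rewrite mulr_suml big_mkcond; apply: ler_sum => z _; case: ifPn => [/eqP->|_].
    by rewrite sub0r sqrrN.
  by rewrite mulr_ge0// sqr_ge0.
have -> : \sum_z Pr z * (N z - m) ^+ 2 =
  \sum_z (Pr z * N z ^+ 2 - 2 * m * (Pr z * N z) + m ^+ 2 * Pr z).
  by apply: eq_bigr => z _; ring.
rewrite big_split sumrB -!mulr_sumr P1 -/m /=.
by rewrite le_eqVlt; apply/orP; left; apply/eqP; ring.
Qed.

End Typical.

(** * Second moment method for tuples of columns *)

Section SecondMoment.
Context {R : realType}.
Variables (k : nat) (C : finType).

Definition restr (U : {set 'I_k}) (d : {ffun 'I_k -> C}) : {ffun 'I_#|U| -> C} :=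
  [ffun j => d (enum_val j)].

Definition marg_law (U : {set 'I_k}) (w : {ffun 'I_k -> C} -> R) := image_law w (restr U).
Arguments marg_law U w _ : clear implicits.

Lemma restrP (U : {set 'I_k}) (d d' : {ffun 'I_k -> C}) :
  reflect (forall a, a \in U -> d a = d' a) (restr U d == restr U d').
Proof.
apply: (iffP eqP) => [h a aU|h]; last first.
  by apply/ffunP => j; rewrite !ffunE h// enum_valP.
have /ffunP/(_ (enum_rank_in aU a)) := h.
by rewrite !ffunE enum_rankK_in.
Qed.

Lemma marg_prod_law (U : {set 'I_k}) (pi : C -> R) : \sum_c pi c = 1 ->
  marg_law U (prod_law pi) =1 prod_law pi.
Proof.
by move=> pi1 d; rewrite /marg_law image_prod_law_inj//; exact: enum_val_inj.
Qed.

Lemma prod_law_restr (U : {set 'I_k}) (pi : C -> R) (d : {ffun 'I_k -> C}) :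
  prod_law pi (restr U d) = \prod_(a in U) pi (d a).
Proof.
by rewrite [RHS]big_enum_val; apply: eq_bigr => j _; rewrite ffunE.
Qed.

Variables (n : nat).

(** One column [s a] is read in each block [a] of [n] columns, so that distinct tuples
interact only through the blocks where they coincide. *)
Definition pick_cols (s : {ffun 'I_k -> 'I_n}) (r : {ffun 'I_k * 'I_n -> C}) :
  {ffun 'I_k -> C} := [ffun a => r (a, s a)].

Definition agreement (s s' : {ffun 'I_k -> 'I_n}) := [set a | s a == s' a].

Variable pi : C -> R.
Hypotheses (pi0 : forall c, 0 <= pi c) (pi1 : \sum_c pi c = 1).

Lemma image_pick_cols s d : image_law (prod_law pi) (pick_cols s) d = prod_law pi d.
Proof.
have := image_prod_law_inj (s := fun a => (a, s a)) d pi1; apply.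
by move=> a b [].
Qed.

(** The conditional weight of [d'] given [d], when [d] and [d'] share their
coordinates in [U] and are otherwise independent. *)
Definition pair_factor (U : {set 'I_k}) (d d' : {ffun 'I_k -> C}) : R :=
  if restr U d == restr U d' then \prod_(a | a \notin U) pi (d' a) else 0.

(** Two tuples of columns have the same entries where they agree and independent
entries elsewhere. *)
Lemma image_pick_cols2 s s' dd :
  image_law (prod_law pi) (fun r => (pick_cols s r, pick_cols s' r)) dd =
  prod_law pi dd.1 * pair_factor (agreement s s') dd.1 dd.2.
Proof.
case: dd => d d' /=.
pose Q (j : 'I_k * 'I_n) (c : C) :=
  ((s j.1 == j.2) ==> (c == d j.1)) && ((s' j.1 == j.2) ==> (c == d' j.1)).
(* Again the fibre is a box, where a position may be pinned twice. *)
transitivity (\prod_j \sum_(c | Q j c) pi c).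
  rewrite (bigA_distr_big_dep Q (fun _ c => pi c)) /=; apply: eq_bigl => r.
  apply/eqP/familyP => [[e e'] j|h].
    rewrite unfold_in; apply/andP; case: j => a m /=.
    split; apply/implyP => /eqP <-.
      by rewrite -e ffunE.
    by rewrite -e' ffunE.
  congr pair; apply/ffunP => a; rewrite ffunE.
    have := h (a, s a); rewrite unfold_in => /andP[/implyP + _].
    by rewrite eqxx => /(_ isT)/eqP.
  have := h (a, s' a); rewrite unfold_in => /andP[_ /implyP].
  by rewrite eqxx => /(_ isT)/eqP.
rewrite -(pair_bigA _ (fun a m => \sum_(c | Q (a, m) c) pi c)) /=.
have Qa a : \prod_m \sum_(c | Q (a, m) c) pi c =
    pi (d a) * (if s a == s' a then (d a == d' a)%:R else pi (d' a)).
  rewrite (bigD1 (s a))//= /Q /= eqxx /=; case: eqVneq => [<-|ss'].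
    rewrite /= [X in _ * X]big1 ?mulr1 => [|m ms].
      case: eqVneq => [<-|dd'].
        by rewrite mulr1 (big_pred1 (d a))// => c; rewrite andbb.
      rewrite mulr0 big_pred0// => c; apply/negP => /andP[/eqP -> /eqP e].
      by rewrite e eqxx in dd'.
    by rewrite -[RHS]pi1; apply: eq_bigl => c; rewrite eq_sym (negbTE ms).
  have s's : (s' a == s a) = false by exact: negbTE.
  have ss's : (s a == s' a) = false by rewrite eq_sym.
  rewrite (big_pred1 (d a)); last first.
    by move=> c; rewrite andbT.
  congr (_ * _); rewrite (bigD1 (s' a))/=; last by rewrite ?s's ?ss's.
  rewrite eqxx ss's /= (big_pred1 (d' a))// big1 ?mulr1// => m /andP[ms ms'].
  rewrite -[RHS]pi1; apply: eq_bigl => c.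
  by rewrite ![_ == m]eq_sym (negbTE ms) (negbTE ms').
under eq_bigr do rewrite Qa.
rewrite big_split /=; congr (_ * _); rewrite /pair_factor.
case: restrP => [h|h].
  rewrite (bigID (mem (agreement s s'))) /= big1 ?mul1r => [|a aU].
    by apply: eq_bigr => a; rewrite finset.inE => /negbTE ->.
  by move: (aU); rewrite finset.inE h// => ->; rewrite eqxx.
have [a aU daa'] : exists2 a, a \in agreement s s' & d a != d' a.
  apply: contrapT => H; apply: h => a aU; apply/eqP/negPn/negP => ne.
  by apply: H; exists a.
rewrite (bigD1 a)//= (negbTE daa'); move: aU; rewrite finset.inE => ->.
by rewrite mul0r.
Qed.

(** Given [s] and [U], at most [n ^ (k - #|U|)] tuples [s'] agree with [s] on [U]. *)
Lemma sum_agreement (f : {set 'I_k} -> R) : (forall U, 0 <= f U) ->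
  \sum_s \sum_s' f (agreement s s') <=
  \sum_(U : {set 'I_k}) (n ^ k)%:R * (n ^ (k - #|U|))%:R * f U.
Proof.
move=> f0.
have -> : \sum_(U : {set 'I_k}) (n ^ k)%:R * (n ^ (k - #|U|))%:R * f U =
    \sum_(s : {ffun 'I_k -> 'I_n}) \sum_(U : {set 'I_k}) (n ^ (k - #|U|))%:R * f U.
  rewrite sumr_const card_ffun !card_ord -[RHS]mulr_natl mulr_sumr.
  by apply: eq_bigr => U _; rewrite mulrA.
apply: ler_sum => s _; rewrite (partition_big (agreement s) xpredT)//=.
apply: ler_sum => U _.
apply: (@le_trans _ _ (\sum_(s' | s' \in family (fun a : 'I_k =>
    [pred m | (a \in U) ==> (s a == m)])) f U)).
  rewrite big_mkcond [leRHS]big_mkcond; apply: ler_sum => s' _.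
  case: eqP => [<-|_]; last by case: ifP.
  rewrite ifT//; apply/familyP => a; rewrite !finset.inE.
  exact/implyP.
rewrite sumr_const card_family foldrE big_map big_enum /=.
rewrite (bigID (mem U)) /= big1 ?mul1n => [|a aU].
  rewrite (eq_bigr (fun=> n)) => [|a /negbTE aU].
    rewrite prod_nat_const -[leLHS]mulr_natl.
    have -> : #|[pred i | i \notin U]| = (k - #|U|)%N.
      by have := cardC (mem U); rewrite card_ord => /(congr1 (subn^~ #|U|)) /=;
        rewrite addnC addnK.
    by [].
  by rewrite -[RHS]card_ord; apply: eq_card => m; rewrite !finset.inE aU.
by rewrite -(card1 (s a)); apply: eq_card => m; rewrite !finset.inE aU eq_sym.
Qed.

End SecondMoment.
Arguments marg_law {R k C} U w _.

Section SecondMomentMethod.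
Context {R : realType}.
Variables (k n : nat) (C I : finType).
Variable pi : C -> R.
Hypotheses (pi0 : forall c, 0 <= pi c) (pi1 : \sum_c pi c = 1).
Local Notation D := {ffun 'I_k -> C}.
Local Notation rho := (prod_law pi : {ffun 'I_k * 'I_n -> C} -> R).

Lemma sum_prod_law_pointwise (E F : finType) (r : E -> R) (G : E -> F)
    (h : {ffun I -> F} -> R) :
  \sum_(z : {ffun I -> E}) prod_law r z * h (pointwise G z) =
  \sum_y prod_law (image_law r G) y * h y.
Proof.
rewrite -(sum_image_law (prod_law r) (pointwise G) h); apply: eq_bigr => y _.
by rewrite image_prod_law.
Qed.

Lemma sum_prod_law_indep (r : D -> R) (h1 h2 : {ffun I -> D} -> R) :
  \sum_(q : {ffun I -> D * D}) prod_law (fun dd => r dd.1 * r dd.2) q *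
     (h1 (pointwise fst q) * h2 (pointwise snd q)) =
  (\sum_y prod_law r y * h1 y) * (\sum_y prod_law r y * h2 y).
Proof.
rewrite big_distrlr /= pair_big /=.
pose f (u : {ffun I -> D} * {ffun I -> D}) : {ffun I -> D * D} :=
  [ffun i => (u.1 i, u.2 i)].
rewrite (reindex f) /=; last first.
  exists (fun q => (pointwise fst q, pointwise snd q)) => [[u v]|q] _ /=.
    by congr pair; apply/ffunP => i; rewrite !ffunE.
  by apply/ffunP => i; rewrite !ffunE -surjective_pairing.
apply: eq_bigr => -[u v] _ /=.
have -> : pointwise fst (f (u, v)) = u by apply/ffunP => i; rewrite !ffunE.
have -> : pointwise snd (f (u, v)) = v by apply/ffunP => i; rewrite !ffunE.
rewrite mulrACA; congr (_ * _); rewrite /prod_law -big_split /=.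
by apply: eq_bigr => i _; rewrite ffunE.
Qed.

Lemma pair_prob s s' (A : pred {ffun I -> D}) :
  \sum_z prod_law rho z * (A (pointwise (pick_cols s) z) && A (pointwise (pick_cols s') z))%:R =
  \sum_(q : {ffun I -> D * D})
    prod_law (fun dd => prod_law pi dd.1 * pair_factor pi (agreement s s') dd.1 dd.2) q *
     ((A (pointwise fst q))%:R * (A (pointwise snd q))%:R).
Proof.
pose G r := (pick_cols s r : D, pick_cols s' r : D).
transitivity (\sum_(z : {ffun I -> {ffun 'I_k * 'I_n -> C}}) prod_law rho z *
  (fun q => (A (pointwise fst q))%:R * (A (pointwise snd q))%:R) (pointwise G z)).
  apply: eq_bigr => z _ /=; rewrite -natrM mulnb.
  by congr (_ * (A _ && A _)%:R); apply/ffunP => i; rewrite !ffunE.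
rewrite (sum_prod_law_pointwise rho G
  (fun q => (A (pointwise fst q))%:R * (A (pointwise snd q))%:R)).
apply: eq_bigr => q _; congr (_ * _).
by apply: eq_bigr => i _; rewrite image_pick_cols2.
Qed.

Lemma tuple_prob s (A : pred {ffun I -> D}) :
  \sum_z prod_law rho z * (A (pointwise (pick_cols s) z))%:R =
  \sum_y prod_law (prod_law pi) y * (A y)%:R.
Proof.
rewrite (sum_prod_law_pointwise rho (pick_cols s) (fun y => (A y)%:R)).
apply: eq_bigr => y _; congr (_ * _).
by apply: eq_bigr => i _; rewrite image_pick_cols.
Qed.

Variable w : D -> R.
Hypotheses (w0 : forall d, 0 <= w d) (w1 : \sum_d w d = 1).
Hypothesis wpi : forall d, prod_law pi d = 0 -> w d = 0.

Lemma prod_law_gt0 d : 0 < w d -> 0 < prod_law pi d.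
Proof.
move=> wd; rewrite lt_neqAle prod_law_ge0// andbT eq_sym; apply/eqP => /wpi e.
by rewrite e ltxx in wd.
Qed.

(** The density on the coordinates in [U] of the target law against the product law,
as a function on full tuples. *)
Definition lik_ratio (U : {set 'I_k}) (d : D) : R :=
  marg_law U w (restr U d) / prod_law pi (restr U d).

Lemma lik_ratio_gt0 U d : 0 < w d -> 0 < lik_ratio U d.
Proof.
move=> wd; rewrite divr_gt0//; first by apply: lt_le_trans wd _; exact: le_image_law.
have := prod_law_gt0 wd; rewrite prod_law_restr => td; apply: prodr_gt0 => a _.
rewrite lt_neqAle pi0 andbT eq_sym; apply/eqP => e; move: td.
by rewrite /prod_law (bigD1 a)//= e mul0r ltxx.
Qed.

Lemma prod_law_coord_gt0 (y : {ffun I -> D}) i : 0 < prod_law w y -> 0 < w (y i).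
Proof.
move=> t0; rewrite lt_neqAle w0 andbT eq_sym; apply/eqP => e; move: t0.
by rewrite /prod_law (bigD1 i)//= e mul0r ltxx.
Qed.

(** Conditionally on the first tuple, the second one is resampled outside [U]. Its law
is compared with the conditional law [lam] under [w]: the likelihood ratio between
the two is the quotient of the full density by its marginal on [U], which is under
control along sequences in [A], and [lam] has total mass at most one. *)
Lemma pair_prob_le s s' (A : pred {ffun I -> D}) (B : R) : 0 <= B ->
  (forall y, A y -> 0 < prod_law w y) ->
  (forall y, A y ->
     \prod_i (lik_ratio (agreement s s') (y i) / (w (y i) / prod_law pi (y i))) <= B) ->
  \sum_z prod_law rho z * (A (pointwise (pick_cols s) z) && A (pointwise (pick_cols s') z))%:R <=
  B * \sum_y prod_law (prod_law pi) y * (A y)%:R.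
Proof.
set U := agreement s s' => B0 Aw AB; rewrite pair_prob -/U.
(* The conditional law under [w] of a tuple given its coordinates in [U]. *)
pose lam (d d' : D) : R :=
  if restr U d == restr U d' then w d' / marg_law U w (restr U d) else 0.
have lam0 d d' : 0 <= lam d d'.
  by rewrite /lam; case: ifP => // _; rewrite divr_ge0//; exact: image_law_ge0.
pose sig (dd : D * D) := prod_law pi dd.1 * lam dd.1 dd.2.
have sig0 dd : 0 <= sig dd by rewrite mulr_ge0// prod_law_ge0.
apply: (@le_trans _ _ (B * \sum_(q : {ffun I -> D * D})
    prod_law sig q * (fun y => (A y)%:R) (pointwise fst q))).
  rewrite mulr_sumr; apply: ler_sum => q _ /=.
  have [Aq|_] := boolP (A (pointwise fst q)); last by rewrite mul0r !mulr0.
  rewrite mul1r mulr1.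
  have [Aq'|_] := boolP (A (pointwise snd q)); last first.
    by rewrite mulr0 mulr_ge0// prod_law_ge0.
  rewrite mulr1 /prod_law !big_split /= mulrCA; apply: ler_wpM2l.
    by apply: prodr_ge0 => i _; exact: prod_law_ge0.
  have [h|] := boolP [forall i, restr U (q i).1 == restr U (q i).2]; last first.
    move=> /forallPn[i /negbTE hi].
    rewrite (bigD1 i)//= /pair_factor hi mul0r mulr_ge0//.
    by apply: prodr_ge0 => j _; exact: lam0.
  apply: le_trans (ler_wpM2r _ (AB _ Aq')); last first.
    by apply: prodr_ge0 => j _; exact: lam0.
  rewrite -big_split /= le_eqVlt; apply/orP; left; apply/eqP.
  apply: eq_bigr => i _; rewrite ffunE /pair_factor /lam (forallP h i) /lik_ratio.
  have wi : 0 < w (q i).2.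
    by have := prod_law_coord_gt0 i (Aw _ Aq'); rewrite ffunE.
  have ti := prod_law_gt0 wi.
  rewrite (eqP (forallP h i)).
  have mi : 0 < marg_law U w (restr U (q i).2).
    by apply: lt_le_trans wi _; exact: le_image_law.
  have ri : 0 < prod_law pi (restr U (q i).2).
    by have := lik_ratio_gt0 U wi; rewrite /lik_ratio pmulr_rgt0// invr_gt0.
  have -> : \prod_(a | a \notin U) pi ((q i).2 a) =
      prod_law pi (q i).2 / prod_law pi (restr U (q i).2).
    have rn := lt0r_neq0 ri; apply/(canRL (mulfK rn)).
    by rewrite prod_law_restr mulrC /prod_law [RHS](bigID (mem U)) /=.
  by field; rewrite !gt_eqF.
rewrite ler_wpM2l// (sum_prod_law_pointwise sig fst (fun y => (A y)%:R)); apply: ler_sum => y _.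
apply: ler_wpM2r => //; apply: ler_prod => i _; rewrite image_law_ge0//=.
have -> : image_law sig fst (y i) = \sum_d' sig (y i, d').
  transitivity (\sum_(p | (p.1 == y i) && true) (fun d d' => sig (d, d')) p.1 p.2).
    by apply: eq_big => [[? ?]|[? ?]] //=; rewrite andbT.
  by rewrite -(pair_big (fun d => d == y i) xpredT (fun d d' => sig (d, d')))
             /= big_pred1_eq.
rewrite /sig /= -mulr_sumr.
rewrite ler_piMr ?prod_law_ge0// -big_mkcond /= -mulr_suml.
rewrite (eq_bigl (fun d' => restr U d' == restr U (y i))); last first.
  by move=> d'; rewrite eq_sym.
rewrite -/(image_law w (restr U) (restr U (y i))) -/(marg_law U w _).
have [->|m0] := eqVneq (marg_law U w (restr U (y i))) 0; first by rewrite mul0r.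
by rewrite divff.
Qed.

Variables (g : D -> R) (e : R).

(** A typical sequence controls the payoff [g], the full log-likelihood ratio, and
the log-likelihood ratio of every marginal. *)
Definition typ_stat (m : option (option {set 'I_k})) : D -> R :=
  match m with
  | None => g
  | Some None => fun d => ln (w d / prod_law pi d)
  | Some (Some U) => fun d => ln (lik_ratio U d)
  end.

Local Notation A := (@typical R _ D I w typ_stat e).
Local Notation pp := (#|I|%:R : R).

Lemma mean_lik_ratio U : mean w (typ_stat (Some (Some U))) = rel_entropy (marg_law U w) (prod_law pi).
Proof. by rewrite /rel_entropy /marg_law sum_image_law. Qed.

Lemma typicalP y m : A y ->
  pp * (mean w (typ_stat m) - e) <= \sum_i typ_stat m (y i) <= pp * (mean w (typ_stat m) + e).
Proof.
move=> /andP[_ /forallP/(_ m)]; rewrite ler_norml lerBlDl lerBrDl => /andP[h1 h2].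
by rewrite mulrBr mulrDr; apply/andP; split; lra.
Qed.

(** The factor [3 * e] comes from one deviation in the lower bound on the probability
that a tuple is typical and two in the upper bound for a pair. Tuples that agree
nowhere are independent and their contribution is at most the square of the mean,
which is why the empty set does not appear on the right. *)
Theorem second_moment_method : (0 < n)%N ->
  (\sum_(z | [forall s, ~~ A (pointwise (pick_cols s) z)]) prod_law rho z) *
    (\sum_(y | A y) prod_law w y) <=
  \sum_(U : {set 'I_k} | U != finset.set0)
    expR (pp * (rel_entropy (marg_law U w) (prod_law pi) + 3 * e)) / (n ^ #|U|)%:R.
Proof.
move=> n0.
set P0 := \sum_(z | _) _; set W := \sum_(y | A y) _.
set Dw := rel_entropy w (prod_law pi).
have DwE : mean w (typ_stat (Some None)) = Dw by [].
pose q := \sum_y prod_law (prod_law pi) y * (A y)%:R.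
pose DU U := rel_entropy (marg_law U w) (prod_law pi).
pose B U := expR (- (pp * (Dw - DU U - 2 * e))).
have rho0 (z : {ffun I -> {ffun 'I_k * 'I_n -> C}}) : 0 <= prod_law rho z.
  by apply: prod_law_ge0 => r; exact: prod_law_ge0.
have P00 : 0 <= P0 by apply: sumr_ge0.
have W0 : 0 <= W by apply: sumr_ge0 => y _; exact: prod_law_ge0.
have Aw y : A y -> 0 < prod_law w y by move=> /andP[].
(* Change of measure: on typical sequences [w] is at most [expR (pp * (Dw + e))]
   times the product law. *)
have qW : W <= expR (pp * (Dw + e)) * q.
  rewrite /W big_mkcond mulr_sumr; apply: ler_sum => y _.
  case: ifPn => Ay; last by rewrite !mulr0.
  rewrite mulr1.
  have -> : prod_law w y = prod_law (prod_law pi) y * expR (\sum_i typ_stat (Some None) (y i)).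
    rewrite expR_sum /prod_law -big_split /=; apply: eq_bigr => i _.
    have wi := prod_law_coord_gt0 i (Aw _ Ay).
    have ti := prod_law_gt0 wi.
    by rewrite lnK ?posrE ?divr_gt0// mulrC divfK// gt_eqF.
  rewrite mulrC ler_wpM2r ?ler_expR//.
    by apply: prod_law_ge0 => d; exact: prod_law_ge0.
  by have /andP[] := typicalP (Some None) Ay.
have q0 : 0 <= q.
  by apply: sumr_ge0 => y _; rewrite mulr_ge0//; apply: prod_law_ge0 => d; exact: prod_law_ge0.
have [W00|Wn0] := eqVneq W 0.
  rewrite W00 mulr0; apply: sumr_ge0 => U _.
  by rewrite divr_ge0// expR_ge0.
have Wp : 0 < W by rewrite lt_neqAle eq_sym Wn0.
have qp : 0 < q by rewrite -(pmulr_rgt0 _ (expR_gt0 (pp * (Dw + e)))); exact: lt_le_trans qW.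
pose N (z : {ffun I -> {ffun 'I_k * 'I_n -> C}}) : R :=
  \sum_s (A (pointwise (pick_cols s) z))%:R.
have NE z : (N z == 0) = [forall s, ~~ A (pointwise (pick_cols s) z)].
  rewrite /N psumr_eq0; last by [].
  apply/allP/forallP => h s; first by have := h s (mem_index_enum _); case: (A _); rewrite //= oner_eq0.
  by move=> _ /=; have := h s; case: (typical _ _ _ _).
have := second_moment_zero N rho0 (sum_prod_law1 _ (sum_prod_law1 _ pi1)).
rewrite (eq_bigl _ _ NE) -/P0.
have -> : \sum_z prod_law rho z * N z = (n ^ k)%:R * q.
  under eq_bigr do rewrite mulr_sumr.
  rewrite exchange_big /=; under eq_bigr do rewrite tuple_prob.
  by rewrite sumr_const card_ffun !card_ord -[LHS]mulr_natl.
have EN2 : \sum_z prod_law rho z * N z ^+ 2 <=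
   \sum_(U : {set 'I_k}) (n ^ k)%:R * (n ^ (k - #|U|))%:R *
     (if U == finset.set0 then q ^+ 2 else B U * q).
  apply: le_trans (sum_agreement n _); last first.
    by move=> U; case: ifP => _; rewrite ?sqr_ge0// mulr_ge0// expR_ge0.
  under eq_bigr do rewrite expr2 big_distrlr /= mulr_sumr.
  rewrite exchange_big /=; apply: ler_sum => s _.
  under eq_bigr do rewrite mulr_sumr.
  rewrite exchange_big /=; apply: ler_sum => s' _.
  under eq_bigr do rewrite -natrM mulnb.
  case: eqP => [U0|_].
    rewrite pair_prob U0 expr2 -sum_prod_law_indep le_eqVlt; apply/orP; left.
    apply/eqP; apply: eq_bigr => z _; congr (_ * _); apply: eq_bigr => i _.
    congr (_ * _); rewrite /pair_factor; case: restrP => [_|h]; last first.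
      by exfalso; apply: h => a; rewrite finset.inE.
    by apply: eq_bigl => a; rewrite finset.inE.
  apply: pair_prob_le => //; first exact: expR_ge0.
  move=> y Ay; set U := agreement s s'.
  have -> : \prod_i (lik_ratio U (y i) / (w (y i) / prod_law pi (y i))) =
    expR (\sum_i typ_stat (Some (Some U)) (y i) - \sum_i typ_stat (Some None) (y i)).
    rewrite -sumrB expR_sum; apply: eq_bigr => i _.
    have wi := prod_law_coord_gt0 i (Aw _ Ay).
    have ti := prod_law_gt0 wi.
    have li := lik_ratio_gt0 U wi.
    by rewrite expRD expRN /= !lnK ?posrE//; exact: divr_gt0.
  rewrite ler_expR.
  have /andP[_] := typicalP (Some (Some U)) Ay; rewrite mean_lik_ratio -/(DU U).
  have /andP[+ _] := typicalP (Some None) Ay; rewrite DwE.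
  set x := \sum_i _; set x' := \sum_i _ => h1 h2.
  rewrite (_ : - (pp * (Dw - DU U - 2 * e)) =
    pp * (DU U + e) - pp * (Dw - e)); last by ring.
  exact: lerB.
move=> /le_trans/(_ (lerB EN2 (lexx _))).
rewrite (bigD1 finset.set0)//= eqxx cards0 subn0 -expr2 -exprMn addrAC subrr add0r.
rewrite (eq_bigr (fun U : {set 'I_k} =>
   ((n ^ k)%:R ^+ 2 * q) * (B U / (n ^ #|U|)%:R))); last first.
  move=> U /negbTE ->.
  have Uk : (#|U| <= k)%N by rewrite -[leqRHS]card_ord max_card.
  have -> : (n ^ k)%:R = (n ^ (k - #|U|))%:R * (n ^ #|U|)%:R :> R.
    by rewrite -natrM -expnD subnK.
  have nU : (n ^ #|U|)%:R != 0 :> R by rewrite pnatr_eq0 expn_eq0 negb_and -lt0n n0.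
  by field.
rewrite -mulr_sumr exprMn => h.
have nk : 0 < (n ^ k)%:R ^+ 2 * q :> R.
  by rewrite mulr_gt0// exprn_gt0// ltr0n expn_gt0 n0.
have h2 : P0 * q <= \sum_(U : {set 'I_k} | U != finset.set0) (B U / (n ^ #|U|)%:R).
  rewrite -(ler_pM2l nk); apply: le_trans h.
  by rewrite expr2 le_eqVlt; apply/orP; left; apply/eqP; ring.
apply: (@le_trans _ _ (expR (pp * (Dw + e)) * (P0 * q))).
  by rewrite mulrCA ler_wpM2l.
apply: (@le_trans _ _ (expR (pp * (Dw + e)) *
  \sum_(U : {set 'I_k} | U != finset.set0) (B U / (n ^ #|U|)%:R))).
  by rewrite ler_wpM2l// expR_ge0.
rewrite mulr_sumr; apply: ler_sum => U _.
rewrite mulrA ler_wpM2r ?invr_ge0// -expRD ler_expR /DU.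
by rewrite le_eqVlt; apply/orP; left; apply/eqP; ring.
Qed.

End SecondMomentMethod.

Local Open Scope classical_set_scope.
Local Open Scope ring_scope.

(** * Largest eigenvalue and Rayleigh quotients *)

Section LambdaMax.
Context {R : realType}.

Definition qform (m : nat) (A : 'M[R]_m) (v : 'I_m -> R) : R :=
  \sum_i \sum_j v i * A i j * v j.

Lemma cvg_sumr (I : Type) (r : seq I) (T : Type) (F : set_system T) {FF : Filter F}
    (f : I -> T -> R) (a : I -> R) :
  (forall i, f i x @[x --> F] --> a i) ->
  \sum_(i <- r) f i x @[x --> F] --> \sum_(i <- r) a i.
Proof. by move=> h; apply: cvg_big => //; exact: add_continuous. Qed.

Lemma qform_continuous m (A : 'M[R]_m) :
  continuous (fun u : 'rV[R]_m => qform A (u ord0)).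
Proof.
move=> u; apply: (cvg_sumr (F := nbhs u)) => i.
apply: (cvg_sumr (F := nbhs u)) => j.
apply: cvgM; last exact: coord_continuous.
by apply: cvgM; [exact: coord_continuous|exact: cvg_cst].
Qed.

(** Otherwise a small multiple of [b] as [t] makes the left-hand side positive. *)
Lemma parabola_vertex (a b : R) : (forall t, t ^+ 2 * a + 2 * t * b <= 0) -> b = 0.
Proof.
move=> h; apply/eqP/negPn/negP => b0.
have a1 : 0 < 1 + `|a| by rewrite ltr_wpDr.
have := h (b / (1 + `|a|)).
have -> : (b / (1 + `|a|)) ^+ 2 * a + 2 * (b / (1 + `|a|)) * b =
  b ^+ 2 / (1 + `|a|) ^+ 2 * (a + 2 * (1 + `|a|)) by field; rewrite gt_eqF.
rewrite leNgt => /negP; apply; apply: mulr_gt0.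
  by rewrite divr_gt0// exprn_even_gt0//= ?b0// gt_eqF.
by have := ler_norm (- a); rewrite normrN; lra.
Qed.

(** The unit sphere is compact; homogeneity extends the inequality to all vectors. *)
Lemma rayleigh_max m (A : 'M[R]_m) : (0 < m)%N -> A^T = A ->
  exists2 u : 'rV[R]_m, \sum_i u ord0 i ^+ 2 = 1 & forall v : 'I_m -> R,
    qform A v <= qform A (u ord0) * \sum_i v i ^+ 2.
Proof.
move=> m0 As; pose K : set 'rV[R]_m := [set u | \sum_i u ord0 i ^+ 2 = 1].
have Kc : compact K.
  apply: bounded_closed_compact.
    exists 1; split => // M M1 u Ku /=.
    rewrite [`|u|]mx_normrE; apply/bigmax_leP; split => [|[i j] _].
      by rewrite ltW// (lt_trans ltr01).
    rewrite ord1 /=; apply: le_trans (ltW M1).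
    rewrite -(@expr_le1 _ 2)// real_normK ?num_real// -Ku (bigD1 j)//= lerDl.
    by apply: sumr_ge0 => k _; exact: sqr_ge0.
  have -> : K = (fun u : 'rV[R]_m => \sum_i u ord0 i ^+ 2) @^-1` [set x | x = 1] by [].
  apply: closed_comp; last exact: closed_eq.
  move=> u _; apply: (cvg_sumr (F := nbhs u)) => i; under eq_fun do rewrite expr2.
  by apply: cvgM; exact: coord_continuous.
have K0 : K !=set0.
  exists (delta_mx ord0 (Ordinal m0)); rewrite /K /= (bigD1 (Ordinal m0))//=.
  rewrite mxE !eqxx expr1n big1 ?addr0// => i /negbTE i0.
  by rewrite mxE i0 andbF expr0n.
have [u Ku umax] := EVT_max_rV K0 Kc
  (continuous_subspaceT (@qform_continuous m A)).
rewrite inE in Ku; exists u => // v.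
set s := \sum_i v i ^+ 2.
have s0 : 0 <= s by apply: sumr_ge0 => i _; exact: sqr_ge0.
have [s00|sn0] := eqVneq s 0.
  have v0 i : v i = 0.
    apply/eqP; rewrite -sqrf_eq0; have /eqP := s00.
    rewrite /s psumr_eq0 => [/allP/(_ i (mem_index_enum _))//|j _].
    exact: sqr_ge0.
  rewrite s00 mulr0 /qform big1// => i _; rewrite big1// => j _.
  by rewrite v0 !mul0r.
have sp : 0 < s by rewrite lt_neqAle eq_sym sn0.
pose t := Num.sqrt s; have t0 : 0 < t by rewrite sqrtr_gt0.
have t2 : t ^+ 2 = s by rewrite sqr_sqrtr.
have Kw : K (\row_i (v i / t)).
  rewrite /K /=; under eq_bigr do rewrite mxE expr_div_n.
  by rewrite -mulr_suml t2 divff.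
have := umax _ (mem_set Kw).
have -> : qform A ((\row_i (v i / t)) ord0) = qform A v / s.
  rewrite -t2 /qform mulr_suml; apply: eq_bigr => i _.
  rewrite mulr_suml; apply: eq_bigr => j _; rewrite !mxE.
  by field; rewrite gt_eqF.
by rewrite ler_pdivrMr.
Qed.

(** The maximiser on the sphere is an eigenvector by the first-order condition, and its
value bounds every eigenvalue. *)
Lemma lambda_maxP m (A : 'M[R]_m) : (0 < m)%N -> A^T = A ->
  (forall v : 'I_m -> R, qform A v <= lambda_max A * \sum_i v i ^+ 2) /\
  exists2 v : 'I_m -> R, \sum_i v i ^+ 2 = 1 & qform A v = lambda_max A.
Proof.
move=> m0 As; have [u u1 umax] := rayleigh_max m0 As.
have Asym i j : A i j = A j i by rewrite -{1}As mxE.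
set l := qform A (u ord0) in umax.
have eigl : eigenvalue A l.
  apply/eigenvalueP; exists u; last first.
    apply/eqP => u0; move: u1; rewrite u0 big1 => [/eqP|i _].
      by rewrite eq_sym oner_eq0.
    by rewrite mxE expr0n.
  apply/rowP => j; rewrite !mxE.
  apply/eqP; rewrite -subr_eq0; apply/eqP.
  apply: (@parabola_vertex (A j j - l)) => t.
  have e (f : 'I_m -> R) : \sum_k f k * (k == j)%:R = f j.
    rewrite (bigD1 j)//= eqxx mulr1 big1 ?addr0// => k /negbTE ->.
    by rewrite mulr0.
  (* Perturbation of the maximiser along the [j]-th basis vector. *)
  have := umax (fun i => u ord0 i + t * (i == j)%:R).
  have -> : \sum_i (u ord0 i + t * (i == j)%:R) ^+ 2 =
            1 + 2 * t * u ord0 j + t ^+ 2.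
    rewrite (eq_bigr (fun i => u ord0 i ^+ 2 + 2 * t * (u ord0 i * (i == j)%:R) +
      t ^+ 2 * (1 * (i == j)%:R))); last by move=> i _; case: (i == j) => /=; ring.
    by rewrite !big_split /= -2!mulr_sumr (e (fun=> 1)) e u1 mulr1.
  have -> : qform A (fun i => u ord0 i + t * (i == j)%:R) =
      l + 2 * t * (\sum_i u ord0 i * A i j) + t ^+ 2 * A j j.
    pose S1 := \sum_i u ord0 i * A i j.
    have e1 i : \sum_k (u ord0 i + t * (i == j)%:R) * A i k *
          (u ord0 k + t * (k == j)%:R) =
        \sum_k u ord0 i * A i k * u ord0 k + t * (u ord0 i * A i j)
        + t * ((\sum_k u ord0 k * A i k) * (i == j)%:R)
        + t ^+ 2 * (A i j * (i == j)%:R).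
      rewrite (eq_bigr (fun k => u ord0 i * A i k * u ord0 k +
         t * (u ord0 i * A i k * (k == j)%:R) +
         t * (i == j)%:R * (u ord0 k * A i k) +
         t ^+ 2 * (i == j)%:R * (A i k * (k == j)%:R))); last first.
        by move=> k _; ring.
      rewrite !big_split /= -!mulr_sumr.
      by rewrite !e; ring.
    rewrite /qform (eq_bigr _ (fun i _ => e1 i)) !big_split /= -mulr_sumr.
    rewrite -/S1 -!mulr_sumr (e (fun i => \sum_k u ord0 k * A i k)).
    rewrite (e (fun i => A i j)).
    have -> : \sum_k u ord0 k * A j k = S1.
      by apply: eq_bigr => k _; rewrite Asym.
    by rewrite -/(qform A _) -/l; ring.
  by lra.
have eig_le a : eigenvalue A a -> a <= l.
  move=> /eigenvalueP[v vA v0].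
  have := umax (v ord0).
  have -> : qform A (v ord0) = a * \sum_i v ord0 i ^+ 2.
    rewrite /qform exchange_big /= mulr_sumr; apply: eq_bigr => j _.
    rewrite -mulr_suml expr2 mulrA; congr (_ * _).
    by have /rowP/(_ j) := vA; rewrite !mxE.
  have s0 : 0 < \sum_i v ord0 i ^+ 2.
    rewrite lt_neqAle eq_sym; apply/andP; split; last first.
      by apply: sumr_ge0 => i _; exact: sqr_ge0.
    apply: contra_neq v0 => s0; apply/rowP => i; rewrite mxE.
    apply/eqP; rewrite -sqrf_eq0; have /eqP := s0.
    rewrite psumr_eq0 => [/allP/(_ i (mem_index_enum _))//|j _].
    exact: sqr_ge0.
  by rewrite ler_pM2r.
have lE : lambda_max A = l.
  apply/eqP; rewrite eq_le /lambda_max; apply/andP; split.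
    by apply: ge_sup; [exists l|move=> a; exact: eig_le].
  by apply: ub_le_sup => //; exists l => a; exact: eig_le.
by rewrite lE; split => //; exists (u ord0).
Qed.

Lemma gram_sym p m (M : 'M[R]_(p, m)) : (M^T *m M)^T = M^T *m M.
Proof. by rewrite trmx_mul trmxK. Qed.

Lemma qform_gram p m (M : 'M[R]_(p, m)) (v : 'I_m -> R) :
  qform (M^T *m M) v = \sum_i (\sum_a v a * M i a) ^+ 2.
Proof.
under [RHS]eq_bigr do rewrite expr2 big_distrlr /=.
rewrite [RHS]exchange_big; apply: eq_bigr => a _ /=.
rewrite [RHS]exchange_big; apply: eq_bigr => b _ /=.
rewrite mxE mulr_sumr mulr_suml; apply: eq_bigr => i _.
by rewrite mxE; ring.
Qed.

Section Tnk.
Variables (p n k : nat) (X : 'M[R]_(p, n)).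
Hypothesis k0 : (0 < k)%N.

(** The inequality [k <= n] ensures that the supremum runs over a nonempty set. *)
Lemma T_nk_le (c : R) : (k <= n)%N ->
  (forall (s : 'I_k -> 'I_n) (v : 'I_k -> R), injective s ->
    \sum_a v a ^+ 2 = 1 -> \sum_i (\sum_a v a * X i (s a)) ^+ 2 <= c) ->
  T_nk k X <= c.
Proof.
move=> kn h; apply: ge_sup.
  pose S := [set widen_ord kn i | i : 'I_k]%SET.
  have Sk : #|S| = k.
    rewrite card_imset ?card_ord// => i j /(congr1 val) /= e.
    exact: val_inj.
  by eexists; exists S; [exact: Sk|reflexivity].
move=> _ [S /= Sk <-]; move: k0 h; rewrite -Sk => S0 h.
have [_ [v v1 <-]] := lambda_maxP S0 (gram_sym (columns S X)).
rewrite qform_gram; have := h enum_val v enum_val_inj v1.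
congr (_ <= _); apply: eq_bigr => i _; congr (_ ^+ 2); apply: eq_bigr => a _.
by rewrite mxE.
Qed.

(** An injective tuple of columns is an enumeration of its image; [u] carries the
weights [v] over to that image. *)
Lemma le_T_nk (s : 'I_k -> 'I_n) (v : 'I_k -> R) : injective s ->
  \sum_i (\sum_a v a * X i (s a)) ^+ 2 <= T_nk k X * \sum_a v a ^+ 2.
Proof.
move=> sI; pose S := [set s a | a : 'I_k]%SET.
have Sk : #|S| = k by rewrite card_imset ?card_ord.
pose u j := \sum_a v a * (s a == j)%:R.
have us a : u (s a) = v a.
  rewrite /u (bigD1 a)//= eqxx mulr1 big1 ?addr0// => b ba.
  by rewrite (inj_eq sI) (negbTE ba) mulr0.
have sumS (F : 'I_n -> R) : \sum_(b < #|S|) F (enum_val b) = \sum_a F (s a).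
  by rewrite -big_enum_val big_imset//= => a b _ _; exact: sI.
have S0 : (0 < #|S|)%N by rewrite Sk.
have [+ _] := lambda_maxP S0 (gram_sym (columns S X)).
move=> /(_ (fun b => u (enum_val b))).
rewrite qform_gram (sumS (fun j => u j ^+ 2)).
under [X in _ * X]eq_bigr do rewrite us.
have -> : \sum_i (\sum_(b < #|S|) u (enum_val b) * columns S X i b) ^+ 2 =
    \sum_i (\sum_a v a * X i (s a)) ^+ 2.
  apply: eq_bigr => i _; congr (_ ^+ 2).
  transitivity (\sum_(b < #|S|) (fun j => u j * X i j) (enum_val b)).
    by apply: eq_bigr => b _; rewrite mxE.
  by rewrite (sumS (fun j => u j * X i j)); apply: eq_bigr => a _; rewrite us.
move=> /le_trans; apply; apply: ler_wpM2r.
  by apply: sumr_ge0 => a _; exact: sqr_ge0.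
pose lam (S' : {set 'I_n}) := lambda_max ((columns S' X)^T *m columns S' X).
apply: ub_le_sup; last by exists S.
exists (\sum_(S' : {set 'I_n}) `|lam S'|) => _ [S' _ <-].
rewrite -/(lam S') (bigD1 S')//=; apply: le_trans (ler_norm _) _.
by rewrite lerDl sumr_ge0.
Qed.

End Tnk.

Lemma cvg_floor_div (x : R) :
  ((Num.floor (i.+1%:R * x))%:~R / i.+1%:R : R) @[i --> \oo] --> x.
Proof.
have h : (fun i => x - harmonic i : R) @ \oo --> x.
  rewrite -[X in _ --> X]subr0; apply: cvgB; first exact: cvg_cst.
  exact: cvg_harmonic.
apply: (squeeze_cvgr _ h (cvg_cst x)).
apply: nearW => i; have i0 : 0 < i.+1%:R :> R by rewrite ltr0n.
apply/andP; split.
  rewrite ler_pdivlMr// mulrBl /harmonic mulVf ?gt_eqF// lerBlDr mulrC.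
  by rewrite -[1]/(1%:~R) -intrD ltW// floorD1_gt.
by rewrite ler_pdivrMr// mulrC floor_le_tmp.
Qed.

(** By homogeneity the inequality holds for rational vectors, hence by density for all. *)
Lemma int_quadratic_dense (p k : nat) (Y : 'I_p -> 'I_k -> R) (c : R) :
  (forall z : {ffun 'I_k -> int},
    \sum_i (\sum_a (z a)%:~R * Y i a) ^+ 2 <= c * \sum_a (z a)%:~R ^+ 2) ->
  forall v : 'I_k -> R,
    \sum_i (\sum_a v a * Y i a) ^+ 2 <= c * \sum_a v a ^+ 2.
Proof.
move=> h v.
pose V (N : nat) (a : 'I_k) : R := (Num.floor (N.+1%:R * v a))%:~R / N.+1%:R.
have Vv a : V N a @[N --> \oo] --> v a by exact: cvg_floor_div.
apply: (@ler_cvg_to _ \oo _ _ (fun N => \sum_i (\sum_a V N a * Y i a) ^+ 2)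
  (fun N => c * \sum_a V N a ^+ 2)).
- apply: (cvg_sumr (F := \oo)) => i; under eq_fun do rewrite expr2.
  by apply: cvgM; apply: (cvg_sumr (F := \oo)) => a; apply: cvgM => //; exact: cvg_cst.
- apply: cvgM; first exact: cvg_cst.
  apply: (cvg_sumr (F := \oo)) => a; under eq_fun do rewrite expr2.
  by apply: cvgM.
apply: nearW => N; have N0 : 0 < N.+1%:R :> R by rewrite ltr0n.
have := h [ffun a => Num.floor (N.+1%:R * v a)].
rewrite -(ler_pM2r (x := (N.+1%:R ^- 2))) ?invr_gt0 ?exprn_gt0//.
rewrite -mulrA !mulr_suml.
congr (_ <= c * _); apply: eq_bigr => i _.
  rewrite -expr_div_n mulr_suml; congr (_ ^+ 2); apply: eq_bigr => a _.
  by rewrite ffunE mulrAC.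
by rewrite -expr_div_n ffunE.
Qed.

End LambdaMax.

(** * Densities and the Gibbs inequality *)

Section Densities.
Context d (T : measurableType d) {R : realType}.
Implicit Types (nu rho : probability T R) (f : T -> R).

(** Relates a measure to a real-valued density fixed everywhere, not only almost everywhere. *)
Definition has_density nu rho f := [/\ measurable_fun setT f,
  (forall x, 0 <= f x) &
  forall A, measurable A -> nu A = (\int[rho]_(x in A) (f x)%:E)%E].

Lemma density_dominates nu rho f : has_density nu rho f -> nu `<< rho.
Proof.
move=> [mf f0 fE]; apply/null_content_dominatesP => A mA rA.
rewrite fE//; apply: null_set_integral => //.
by apply/measurable_EFinP; exact: measurable_funTS.
Qed.

Lemma density_exists nu rho : nu `<< rho -> exists f, has_density nu rho f.
Proof.
move=> nr; pose F := Radon_Nikodym_SigmaFinite.f nu rho.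
have mF : measurable_fun setT F.
  exact/measurable_int/Radon_Nikodym_SigmaFinite.f_integrable.
exists (fine \o F); split => [|x|A mA].
- exact: measurableT_comp.
- by apply/fine_ge0/Radon_Nikodym_SigmaFinite.f_ge0.
- rewrite (Radon_Nikodym_SigmaFinite.f_integral nr mA).
  apply: eq_integral => x _ /=.
  by rewrite fineK//; exact: Radon_Nikodym_SigmaFinite.f_fin_num.
Qed.

Section density.
Variables (nu rho : probability T R) (f : T -> R).
Hypothesis nf : has_density nu rho f.

Let mf : measurable_fun setT (EFin \o f).
Proof. by case: nf => mf _ _; exact/measurable_EFinP. Qed.

Let f0 x : 0 <= f x. Proof. by case: nf. Qed.

Lemma density_integrable : rho.-integrable setT (EFin \o f).
Proof.
case: nf => _ _ fE; apply/integrableP; split => //.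
under eq_integral do rewrite /= ger0_norm//.
by rewrite -fE// probability_setT ltry.
Qed.

Lemma density_RN : ae_eq rho setT (EFin \o f)
  (Radon_Nikodym (charge_of_finite_measure nu) rho).
Proof.
have nr := density_dominates nf; case: nf => _ _ fE.
apply: integral_ae_eq => //.
- exact: density_integrable.
- by move=> A _ mA; rewrite -Radon_Nikodym_integral//= -fE.
Qed.

Lemma density_change (h : T -> \bar R) : (forall x, (0 <= h x)%E) ->
  measurable_fun setT h ->
  (\int[nu]_x h x = \int[rho]_x (h x * (f x)%:E))%E.
Proof.
move=> h0 mh; have nr := density_dominates nf.
rewrite -(Radon_Nikodym_SigmaFinite.change_of_variables nr)//.
apply: ae_eq_integral => //.
- apply: emeasurable_funM => //.
  exact/measurable_int/Radon_Nikodym_SigmaFinite.f_integrable.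
- exact: emeasurable_funM.
- apply: ae_eqe_mul2l; apply: ae_eq_trans.
    exact: (ae_eq_Radon_Nikodym_SigmaFinite nr measurableT).
  by apply: ae_eq_sym; exact: density_RN.
Qed.

Lemma density_gt0 : {ae nu, forall x, 0 < f x}.
Proof.
case: nf => mf' _ fE.
have mN : measurable [set x | f x <= 0].
  rewrite (_ : mkset _ = f @^-1` `]-oo, 0]); last first.
    by apply/seteqP; split => x /=; rewrite in_itv.
  by rewrite -[X in measurable X]setTI; exact: mf'.
exists [set x | f x <= 0]; split => //.
  rewrite fE//; apply: integral0_eq => x /= fx0; congr EFin.
  by apply/eqP; rewrite eq_le fx0 f0.
by move=> x /=; rewrite leNgt => /negP.
Qed.

(** The Radon-Nikodym derivative is almost everywhere equal to [f], and [f] is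
positive almost surely under [nu]. *)
Lemma KL_density : KL nu rho = (\int[nu]_x (ln (f x))%:E)%E.
Proof.
have nr := density_dominates nf; rewrite /KL asboolT//.
set F := Radon_Nikodym _ _.
have mF : measurable_fun setT F.
  by apply: measurable_int; exact: Radon_Nikodym_integrable.
have ffin x : F x \is a fin_num by apply: Radon_Nikodym_fin_num.
have lF x : lne (F x) = (if F x <= 0%E then -oo else (ln (fine (F x)))%:E)%E.
  by have := ffin x; case: (F x).
apply: ae_eq_integral => //.
- under eq_fun do rewrite lF.
  apply: measurable_fun_ifT => //.
    exact: measurable_fun_lee.
  apply/measurable_EFinP; apply: measurableT_comp; first exact: measurable_ln.
  exact: measurableT_comp.
- apply/measurable_EFinP; apply: measurableT_comp; first exact: measurable_ln.
  by case: nf.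
- have := null_dominates_ae_eq measurableT nr density_RN.
  apply: filterS2 density_gt0 => x fx /(_ I) /= e _.
  by rewrite /F -e /= leNgt fx.
Qed.

End density.

Lemma KL_le_dominates nu rho (a : R) : (KL nu rho <= a%:E)%E -> nu `<< rho.
Proof. by rewrite /KL; case: asboolP. Qed.

(** Only the negative part of [u] is controlled, by [l]; [u] may fail to be integrable.
It is replaced by the maximum of [u] and [l], which is almost everywhere the same. *)
Lemma le_integral_ae (m : {measure set T -> \bar R}) (l u : T -> \bar R) :
  m.-integrable setT l -> measurable_fun setT u ->
  {ae m, forall x, (l x <= u x)%E} ->
  (\int[m]_x l x <= \int[m]_x u x)%E.
Proof.
move=> il mu lu; have ml := measurable_int _ il.
pose v x := maxe (l x) (u x).
have mv : measurable_fun setT v by exact: measurable_maxe.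
have -> : (\int[m]_x u x = \int[m]_x v x)%E.
  apply: ae_eq_integral => //; apply: filterS lu => x lux _.
  by rewrite /v; apply/esym/max_idPr.
have lv x : (l x <= v x)%E by rewrite /v le_max lexx.
rewrite integralE [leRHS]integralE; apply: leeB.
  apply: ge0_le_integral => //.
  - exact: measurable_funepos.
  - exact: measurable_funepos.
  - by move=> x _; apply: (@funepos_le _ _ setT); rewrite ?in_setT//; move=> y _.
apply: ge0_le_integral => //.
- exact: measurable_funeneg.
- exact: measurable_funeneg.
- by move=> x _; apply: (@funeneg_le _ _ setT); rewrite ?in_setT//; move=> y _.
Qed.

Lemma integral_const nu (a : R) : (\int[nu]__ a%:E = a%:E)%E.
Proof.
rewrite (integral_cst _ measurableT a%:E) -[RHS]mule1; congr (_ * _)%E.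
exact: probability_setT.
Qed.

Lemma integral_one nu : (\int[nu]__ 1 = 1)%E.
Proof. exact: integral_const. Qed.

(** Gibbs variational inequality, linearised by [ln y <= y - 1] with [y = expR g / f]
and [f] the density. No logarithm of an integral appears, so that the right-hand
side may be infinite. *)
Lemma gibbs nu rho (g : T -> R) (a : R) :
  (KL nu rho <= a%:E)%E -> nu.-integrable setT (EFin \o g) ->
  measurable_fun setT g ->
  (\int[nu]_x (g x)%:E + 1 <= a%:E + \int[rho]_x (expR (g x))%:E)%E.
Proof.
move=> KLa ig mg.
have [f nf] := density_exists (KL_le_dominates KLa).
rewrite (KL_density nf) in KLa; have f0 x : 0 <= f x by case: nf.
have mf : measurable_fun setT f by case: nf.
have [ei|] := ltP (\int[rho]_x (expR (g x))%:E)%E +oo%E; last first.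
  rewrite leye_eq => /eqP ->; by rewrite addey// leey.
(* [h] is the quotient [expR g / f], set to [0] where [f] vanishes. *)
pose h x := if f x <= 0 then 0 else expR (g x - ln (f x)).
have mh : measurable_fun setT h.
  apply: measurable_fun_ifT => //; first exact: measurable_fun_ler.
  apply: measurableT_comp => //; apply: measurable_funB => //.
  by apply: measurableT_comp mf; exact: measurable_ln.
have hE x : 0 < f x -> h x = expR (g x) / f x.
  by move=> fx; rewrite /h leNgt fx expRB lnK.
have h0 x : 0 <= h x by rewrite /h; case: ifP => // _; exact: expR_ge0.
have hle : (\int[nu]_x (h x)%:E <= \int[rho]_x (expR (g x))%:E)%E.
  rewrite (density_change nf) => [|x|]; last 2 first.
    by rewrite lee_fin.
    exact/measurable_EFinP.
  apply: ge0_le_integral => //.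
  - by move=> x _; rewrite mule_ge0// lee_fin.
  - by apply: emeasurable_funM; exact/measurable_EFinP.
  - by apply/measurable_EFinP; exact: measurableT_comp.
  - move=> x _; rewrite -EFinM lee_fin.
    have [fx|fx] := leP (f x) 0; first by rewrite /h fx mul0r expR_ge0.
    by rewrite hE// divfK// gt_eqF.
have ih : nu.-integrable setT (EFin \o h).
  apply/integrableP; split; first exact/measurable_EFinP.
  under eq_integral do rewrite /= ger0_norm//.
  exact: le_lt_trans ei.
have i1 : nu.-integrable setT (EFin \o cst (1 : R)).
  exact: finite_measure_integrable_cst.
have igh : nu.-integrable setT (fun x => (g x)%:E + (1%:E - (h x)%:E))%E.
  apply: integrableD => //; exact: integrableB.
have := le_integral_ae (u := fun x => (ln (f x))%:E) igh.
have ml : measurable_fun setT (fun x => (ln (f x))%:E).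
  by apply/measurable_EFinP; apply: measurableT_comp mf; exact: measurable_ln.
move=> /(_ ml); have := density_gt0 nf => fgt.
have lepw : {ae nu, forall x, ((g x)%:E + (1%:E - (h x)%:E) <= (ln (f x))%:E)%E}.
  apply: filterS fgt => x fx; rewrite -EFinB -EFinD lee_fin hE//.
  have := xlnx_tangent ler01 (divr_gt0 (expR_gt0 (g x)) fx).
  rewrite ln1 mulr0 mul1r ln_div ?posrE ?expR_gt0// expRK.
  lra.
move=> /(_ lepw).
rewrite integralD//; last exact: integrableB.
rewrite integralB//=.
rewrite integral_one => lel.
have hfin : (\int[nu]_x (h x)%:E)%E \is a fin_num by apply: integrable_fin_num.
have gfin : (\int[nu]_x (g x)%:E)%E \is a fin_num by apply: integrable_fin_num.
have efin : (\int[rho]_x (expR (g x))%:E)%E \is a fin_num.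
  rewrite ge0_fin_numE//; apply: integral_ge0 => x _.
  by rewrite lee_fin expR_ge0.
move: (le_trans lel KLa) hle.
rewrite -(fineK hfin) -(fineK gfin) -(fineK efin).
move: (fine _) (fine _) (fine _) => x y z.
by rewrite -?EFinB -!EFinD !lee_fin; lra.
Qed.

End Densities.

(** * Finite measurable partitions *)

Section Cells.
Context d (T : measurableType d) {R : realType} (D : finType).
Variable c : T -> D.
Hypothesis mc : forall e, measurable (c @^-1` [set e]).
Implicit Types (nu rho : probability T R).

Definition cell_law (nu : probability T R) (e : D) : R := fine (nu (c @^-1` [set e])).

Lemma cell_lawE nu e : (nu (c @^-1` [set e]) = (cell_law nu e)%:E)%E.
Proof. by rewrite fineK// fin_num_measure. Qed.

Lemma cell_law_ge0 nu e : 0 <= cell_law nu e.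
Proof. exact: fine_ge0. Qed.

Lemma measurable_cell (A : set D) : measurable (c @^-1` A).
Proof.
have -> : c @^-1` A = \bigcup_(e in A) (c @^-1` [set e]).
  by apply/seteqP; split => [x Ax|x [e Ae /= ->]//]; exists (c x).
by apply: fin_bigcup_measurable => //; exact: finite_finset.
Qed.

Lemma measurable_fun_cell d' (T' : measurableType d') (h : D -> T') :
  measurable_fun setT (h \o c).
Proof. by move=> _ B mB; rewrite setTI; exact: (measurable_cell (h @^-1` B)). Qed.

(** A function of the cell is a simple function. *)
Lemma cell_indic (h : D -> R) x :
  h (c x) = \sum_e h e * \1_(c @^-1` [set e]) x.
Proof.
rewrite (bigD1 (c x))//= indicE mem_set// mulr1 big1 ?addr0// => e ec.
by rewrite indicE memNset ?mulr0// => /= ce; rewrite ce eqxx in ec.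
Qed.

Lemma integral_cell_in nu (B : set T) (h : D -> R) : measurable B ->
  (\int[nu]_(x in B) (h (c x))%:E =
   (\sum_e h e * fine (nu (c @^-1` [set e] `&` B)))%:E)%E.
Proof.
move=> mB; under eq_integral do rewrite cell_indic -sumEFin.
have ii e : nu.-integrable B (EFin \o \1_(c @^-1` [set e])).
  apply: measurable_bounded_integrable => //=.
  - by rewrite ltey_eq fin_num_measure.
  - by exists 1; split => // M M1 x _ /=; rewrite indicE; case: (_ \in _);
      rewrite ?normr1 ?normr0; lra.
rewrite integral_sum//.
  rewrite -sumEFin; apply: eq_bigr => e _.
  under eq_integral do rewrite EFinM.
  rewrite integralZl//; last exact: ii.
  rewrite integral_indic// EFinM; congr (_ * _)%E.
  by rewrite fineK// fin_num_measure//; exact: measurableI.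
move=> e; under eq_fun do rewrite EFinM; apply: integrableZl => //; exact: ii.
Qed.

Lemma integral_cell nu (h : D -> R) :
  (\int[nu]_x (h (c x))%:E = (\sum_e h e * cell_law nu e)%:E)%E.
Proof.
rewrite integral_cell_in//; congr EFin; apply: eq_bigr => e _.
by rewrite setIT.
Qed.

Lemma cell_law_image nu (E : finType) (G : D -> E) e :
  fine (nu ((G \o c) @^-1` [set e])) = image_law (cell_law nu) G e.
Proof.
have := integral_cell nu (fun d => (G d == e)%:R).
have -> : (\int[nu]_x ((G (c x) == e)%:R)%:E =
           \int[nu]_x (\1_((G \o c) @^-1` [set e]) x)%:E)%E.
  apply: eq_integral => x _; rewrite indicE; congr (_%:R%:E).
  by case: eqVneq => h; [rewrite mem_set|rewrite memNset// => /= /eqP; rewrite (negbTE h)].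
rewrite integral_indic//; last exact: (measurable_cell (G @^-1` [set e])).
rewrite setIT => -> /=; rewrite [RHS]big_mkcond; apply: eq_bigr => d0 _.
by case: eqP; rewrite ?mul1r ?mul0r.
Qed.

Lemma integrable_cell nu (h : D -> R) :
  nu.-integrable setT (EFin \o (h \o c)).
Proof.
apply: measurable_bounded_integrable => //=.
- by rewrite ltey_eq fin_num_measure.
- exact: measurable_fun_cell.
exists (\sum_e `|h e|); split; first exact: num_real.
move=> M hM x _ /=; apply: le_trans (ltW hM).
by rewrite (bigD1 (c x))//= lerDl; apply: sumr_ge0.
Qed.

Lemma sum_cell_law nu : \sum_e cell_law nu e = 1.
Proof.
have := integral_cell nu (fun=> 1).
rewrite integral_one => -[->].
by under eq_bigr do rewrite mul1r.
Qed.

Lemma cell_law_null nu rho e : nu `<< rho -> cell_law rho e = 0 -> cell_law nu e = 0.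
Proof.
move=> /null_content_dominatesP nr re; rewrite /cell_law nr//.
by apply: (etrans (cell_lawE rho e)); rewrite re.
Qed.

(** Gibbs' inequality with the log-likelihood ratio of the cell laws as test function. *)
Lemma data_processing nu rho (a : R) :
  (KL nu rho <= a%:E)%E -> rel_entropy (cell_law nu) (cell_law rho) <= a.
Proof.
move=> KLa; have nr := KL_le_dominates KLa.
rewrite leNgt; apply/negP => aD.
(* On cells that are null for [nu] the log-likelihood ratio is minus infinity; it is cut
   at a level [- N] so low that these cells contribute less than the assumed gap. *)
pose N := 1 - ln (rel_entropy (cell_law nu) (cell_law rho) - a).
pose h e := if cell_law nu e == 0 then - N else ln (cell_law nu e / cell_law rho e).
have := gibbs KLa (integrable_cell nu h) (measurable_fun_cell h).
have -> : (\int[rho]_x (expR ((h \o c) x))%:E =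
           (\sum_e expR (h e) * cell_law rho e)%:E)%E.
  exact: (integral_cell rho (expR \o h)).
rewrite (integral_cell nu h).
rewrite -EFinD -EFinD lee_fin => le1.
have eD : \sum_e h e * cell_law nu e = rel_entropy (cell_law nu) (cell_law rho).
  apply: eq_bigr => e _; rewrite /h mulrC.
  by case: eqP => [->|//]; rewrite !mul0r.
have : \sum_e expR (h e) * cell_law rho e <= 1 + expR (- N).
  rewrite -(sum_cell_law nu) -[X in _ + X]mulr1 -(sum_cell_law rho) mulr_sumr -big_split.
  apply: ler_sum => e _ /=; rewrite /h; case: eqVneq => [->|ne].
    by rewrite add0r.
  have re : cell_law rho e != 0.
    by apply: contra_neq ne => /(cell_law_null nr).
  have rp : 0 < cell_law rho e by rewrite lt_neqAle eq_sym re cell_law_ge0.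
  have np : 0 < cell_law nu e by rewrite lt_neqAle eq_sym ne cell_law_ge0.
  by rewrite lnK ?posrE ?divr_gt0// divfK// lerDl mulr_ge0 ?expR_ge0 ?cell_law_ge0.
have : expR (- N) < rel_entropy (cell_law nu) (cell_law rho) - a.
  rewrite /N opprB -[ltRHS]lnK ?posrE ?subr_gt0// ltr_expR.
  by rewrite ltrBlDr ltrDl.
rewrite eD in le1; lra.
Qed.

(** Equality in the data processing inequality for a density that is constant on cells. *)
Lemma KL_cell nu rho (f : D -> R) : has_density nu rho (f \o c) ->
  KL nu rho = (rel_entropy (cell_law nu) (cell_law rho))%:E.
Proof.
move=> nf; rewrite (KL_density nf) (integral_cell nu (fun e => ln (f e))) /rel_entropy.
congr EFin; apply: eq_bigr => e _ /=.
case: nf => _ f0 fE.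
have ne : cell_law nu e = f e * cell_law rho e.
  apply: EFin_inj; rewrite -cell_lawE fE//.
  rewrite (eq_integral (fun=> (f e)%:E)); last by move=> x; rewrite inE /= => ->.
  by rewrite integral_cst// EFinM; congr (_ * _)%E; exact: cell_lawE.
have [re|re] := eqVneq (cell_law rho e) 0; first by rewrite ne re !(mulr0, mul0r).
by rewrite ne mulfK// mulrC.
Qed.

End Cells.

Section DensityMeasure.
Context d (T : measurableType d) {R : realType} (rho : probability T R) (f : T -> R).
Hypothesis mf : measurable_fun setT f.
Hypothesis f0 : forall x, 0 <= f x.
Hypothesis f1 : (\int[rho]_x (f x)%:E = 1)%E.

(** Countable additivity comes from monotone convergence. *)
Lemma density_measure : exists nu : probability T R, has_density nu rho f.
Proof.
pose m := fun A : set T => (\int[rho]_(x in A) (f x)%:E)%E.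
have m0 : m set0 = 0%E by rewrite /m integral_set0.
have mge0 A : (0 <= m A)%E by apply: integral_ge0 => x _; rewrite lee_fin.
have msa : semi_sigma_additive m.
  apply: semi_sigma_additive_nng_induced; first exact/measurable_EFinP.
  by move=> x; rewrite lee_fin.
pose M := isMeasure.Build _ _ _ m m0 mge0 msa.
pose mM : {measure set T -> \bar R} := HB.pack m M.
have m1 : mM setT = 1%E by [].
pose Pm := Measure_isProbability.Build _ _ R mM m1.
pose P : probability T R := HB.pack m M Pm.
by exists P; split.
Qed.

End DensityMeasure.

(** * Geometric cells of the line *)

Section GeometricCells.
Context {R : realType}.
Variables (r : R) (J : nat).
Hypothesis r1 : 1 < r.

(** Finitely many threshold tests; the cell of a point is a function of the answers,
which makes its measurability immediate. *)
Definition flags (x : R) : {ffun option 'I_J.+1 -> bool} :=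
  [ffun o : option 'I_J.+1 => if o is Some l then r ^+ l <= 1 + `|x| else 0 <= x].

Definition cell_of_flags (b : {ffun option 'I_J.+1 -> bool}) : 'I_J.+1 * bool :=
  (inord (\max_(l < J.+1 | b (Some l)) l), b None).

(** The sign of [x] and the last power of [r] below [1 + |x|] among the exponents up to
[J]; the exponent [J] collects all larger points. *)
Definition geom_cell (x : R) : 'I_J.+1 * bool := cell_of_flags (flags x).

Definition outer (e : 'I_J.+1 * bool) : bool := e.1 == ord_max.

Lemma measurable_geom_cell e : measurable (geom_cell @^-1` [set e]).
Proof.
apply: (measurable_cell (c := flags) _ (cell_of_flags @^-1` [set e])) => b.
rewrite (_ : _ @^-1` _ = \bigcap_(o in [set: option 'I_J.+1])
  [set x | flags x o = b o]); last first.
  apply/seteqP; split => x /=; first by move=> <- o _.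
  by move=> h; apply/ffunP => o; exact: h.
apply: fin_bigcap_measurable => [|o _]; first exact: finite_finset.
have mf : measurable_fun setT (fun x => flags x o).
  under eq_fun do rewrite ffunE.
  case: o => [l|].
    apply: measurable_fun_ler => //; apply: measurable_funD => //.
  exact: measurable_fun_ler.
have := mf measurableT [set b o] I; rewrite setTI; exact.
Qed.

Lemma geom_cell_idx x : ((geom_cell x).1 : nat) = \max_(l < J.+1 | r ^+ l <= 1 + `|x|) l.
Proof.
rewrite /geom_cell /cell_of_flags /= inordK.
  by apply: eq_bigl => l; rewrite ffunE.
by rewrite ltnS; apply/bigmax_leqP => l _; rewrite -ltnS.
Qed.

Lemma geom_cell_lb x : r ^+ (geom_cell x).1 <= 1 + `|x|.
Proof.
rewrite geom_cell_idx.
have P0 : (fun l : 'I_J.+1 => r ^+ l <= 1 + `|x|) ord0.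
  by rewrite /= expr0 lerDl.
have n0 : (0 < #|[pred l : 'I_J.+1 | (r ^+ l <= 1 + `|x|)%R]|)%N.
  by apply/card_gt0P; exists ord0; rewrite inE.
have [l + ->] := eq_bigmax_cond (fun l : 'I_J.+1 => l : nat) n0.
by rewrite inE.
Qed.

Lemma geom_cell_ub x : ~~ outer (geom_cell x) -> 1 + `|x| < r ^+ (geom_cell x).1.+1.
Proof.
move=> ox; rewrite ltNge; apply/negP => h.
have lJ : ((geom_cell x).1.+1 < J.+1)%N.
  rewrite ltnS ltn_neqAle -ltnS ltn_ord andbT.
  by apply: contra ox => /eqP e; apply/eqP/val_inj.
have := @leq_bigmax_cond _ (fun l : 'I_J.+1 => r ^+ l <= 1 + `|x|) (fun l => l : nat)
  (Ordinal lJ) h.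
by rewrite -geom_cell_idx /= ltnn.
Qed.

Lemma outer_geom_cell x : outer (geom_cell x) = (r ^+ J <= 1 + `|x|).
Proof.
apply/idP/idP => [/eqP e|h]; first by have := geom_cell_lb x; rewrite e.
apply/negPn/negP => ox; have := geom_cell_ub ox.
rewrite ltNge => /negP; apply; apply: le_trans h; rewrite ler_weXn2l// 1?ltW//.
rewrite ltn_neqAle -ltnS ltn_ord andbT.
by apply: contra ox => /eqP e; apply/eqP/val_inj.
Qed.

(** Points of one cell have the same sign, and the ratio of [1 + |x|] and [1 + |y|] is
less than [r] either way. *)
Lemma geom_cell_mesh x y : geom_cell x = geom_cell y -> ~~ outer (geom_cell x) ->
  `|x - y| <= (r - 1) * (1 + `|y|).
Proof.
move=> e ox; have x1 := geom_cell_lb x; have x2 := geom_cell_ub ox.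
have y1 := geom_cell_lb y; have y2 : 1 + `|y| < r ^+ (geom_cell y).1.+1.
  by apply: geom_cell_ub; rewrite -e.
rewrite -e in y1 y2.
have sgn : (0 <= x) = (0 <= y).
  by have := congr1 snd e; rewrite /= !ffunE.
move: x1 x2 y1 y2; rewrite !exprS; set q := r ^+ _ => x1 x2 y1 y2.
have hx : 1 + `|x| < r * (1 + `|y|).
  by apply: lt_le_trans x2 _; rewrite ler_pM2l// (lt_trans ltr01).
have hy : 1 + `|y| < r * (1 + `|x|).
  by apply: lt_le_trans y2 _; rewrite ler_pM2l// (lt_trans ltr01).
have rx : (r - 1) * (1 + `|x|) = r * (1 + `|x|) - 1 - `|x| by ring.
have ry : (r - 1) * (1 + `|y|) = r * (1 + `|y|) - 1 - `|y| by ring.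
have key : `| `|x| - `|y| | <= (r - 1) * (1 + `|y|).
  rewrite ler_norml; have [xy|/ltW xy] := leP `|x| `|y|.
    have : (r - 1) * (1 + `|x|) <= (r - 1) * (1 + `|y|).
      by rewrite ler_pM2l ?subr_gt0// lerD2l.
    by rewrite rx ry => h; apply/andP; split; lra.
  have : 0 <= (r - 1) * (1 + `|y|).
    by rewrite mulr_ge0 ?subr_ge0 1?ltW// ltr_pwDl.
  by rewrite ry => h; apply/andP; split; lra.
move: key; move: sgn; have [x0|x0] := leP 0 x => /esym y0.
  by rewrite (ger0_norm x0) [`|y|]ger0_norm.
have {}y0 : y < 0 by rewrite ltNge y0.
rewrite (ltr0_norm x0) (ltr0_norm y0).
by rewrite -opprD normrN.
Qed.

End GeometricCells.

Section MeshQuadratic.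
Context {R : realType}.

Lemma unit_cauchy_schwarz k (v d : 'I_k -> R) : \sum_a v a ^+ 2 = 1 ->
  (\sum_a v a * d a) ^+ 2 <= \sum_a d a ^+ 2.
Proof.
move=> v1; set s := \sum_a v a * d a.
have : 0 <= \sum_a (d a - s * v a) ^+ 2 by apply: sumr_ge0 => a _; exact: sqr_ge0.
rewrite (eq_bigr (fun a => d a ^+ 2 - 2 * s * (v a * d a) + s ^+ 2 * v a ^+ 2)).
  rewrite big_split sumrB -!mulr_sumr v1 -/s /= mulr1 => h.
  have e : 2 * s * s = 2 * s ^+ 2 by ring.
  by rewrite e in h; lra.
by move=> a _; ring.
Qed.

(** The difference of the two sides is [h (p - s / h)^2]. *)
Lemma sq_perturb (p s h : R) : 0 < h ->
  (p + s) ^+ 2 <= (1 + h) * p ^+ 2 + (1 + h^-1) * s ^+ 2.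
Proof.
move=> h0; rewrite -subr_ge0.
have -> : (1 + h) * p ^+ 2 + (1 + h^-1) * s ^+ 2 - (p + s) ^+ 2 =
  h * (p - s / h) ^+ 2 by field; rewrite gt_eqF.
by rewrite mulr_ge0 ?sqr_ge0// ltW.
Qed.

(** The two bounds have the same error term, involving [y] only: in the applications
[y] is integrated while [x] is fixed. *)
Lemma mesh_quadratic k (v x y : 'I_k -> R) (h : R) : 0 < h ->
  \sum_a v a ^+ 2 = 1 -> (forall a, `|x a - y a| <= h * (1 + `|y a|)) ->
  (\sum_a v a * x a) ^+ 2 <= (1 + h) * (\sum_a v a * y a) ^+ 2 +
      2 * h * (1 + h) * (k%:R + \sum_a y a ^+ 2) /\
  (\sum_a v a * y a) ^+ 2 <= (1 + h) * (\sum_a v a * x a) ^+ 2 +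
      2 * h * (1 + h) * (k%:R + \sum_a y a ^+ 2).
Proof.
move=> h0 v1 xy.
have D : (\sum_a v a * (x a - y a)) ^+ 2 <= 2 * h ^+ 2 * (k%:R + \sum_a y a ^+ 2).
  apply: le_trans (unit_cauchy_schwarz _ v1) _.
  have -> : 2 * h ^+ 2 * (k%:R + \sum_a y a ^+ 2) =
      \sum_(a < k) 2 * h ^+ 2 * (1 + y a ^+ 2).
    by rewrite -mulr_sumr big_split /= sumr_const card_ord.
  apply: ler_sum => a _.
  apply: (@le_trans _ _ ((h * (1 + `|y a|)) ^+ 2)).
    rewrite -[leLHS]real_normK ?num_real// ler_sqr ?nnegrE//.
    by rewrite mulr_ge0 ?(ltW h0)// addr_ge0.
  have -> : 2 * h ^+ 2 * (1 + y a ^+ 2) = h ^+ 2 * (2 * (1 + y a ^+ 2)) by ring.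
  rewrite exprMn ler_pM2l ?exprn_gt0//.
  rewrite -[y a ^+ 2]real_normK ?num_real//.
  have := sqr_ge0 (1 - `|y a|); nra.
have hh : (1 + h^-1) * (2 * h ^+ 2 * (k%:R + \sum_a y a ^+ 2)) =
    2 * h * (1 + h) * (k%:R + \sum_a y a ^+ 2) by field; rewrite gt_eqF.
have hi : 0 <= 1 + h^-1 by rewrite addr_ge0// invr_ge0 ltW.
set s := \sum_a v a * (x a - y a) in D.
have xE : \sum_a v a * x a = \sum_a v a * y a + s.
  by rewrite -big_split; apply: eq_bigr => a _ /=; ring.
split.
  rewrite xE; apply: le_trans (sq_perturb _ _ h0) _.
  by rewrite lerD2l -hh ler_wpM2l.
have -> : \sum_a v a * y a = \sum_a v a * x a + - s by rewrite xE; ring.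
apply: le_trans (sq_perturb _ _ h0) _.
by rewrite lerD2l -hh ler_wpM2l// sqrrN.
Qed.

End MeshQuadratic.

(** * Cells of product spaces *)

Section Boxes.
Context {R : realType}.

Definition box (m : nat) (A : 'I_m -> set R) : set (m.-tuple R) :=
  [set x | forall i, A i (tnth x i)].

Lemma measurable_box m (A : 'I_m -> set R) :
  (forall i, measurable (A i)) -> measurable (box A).
Proof.
move=> mA; rewrite (_ : box A =
  \bigcap_(i in [set: 'I_m]) ((@tnth m R)^~ i @^-1` A i)).
  apply: fin_bigcap_measurable => [|i _]; first exact: finite_finset.
  by rewrite -[X in measurable X]setTI; exact: measurable_tnth.
by apply/seteqP; split=> x /= h i => [_|]; exact: h.
Qed.

(** Boxes are stable under intersection and generate the product sigma-algebra. *)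
Lemma box_unique m (P Q : probability (m.-tuple R) R) :
  (forall A, (forall i, measurable (A i)) -> P (box A) = Q (box A)) ->
  forall B, measurable B -> P B = Q B.
Proof.
move=> PQ B mB.
pose G : set (set (m.-tuple R)) :=
  [set B | exists2 A, (forall i, measurable (A i)) & B = box A].
have mG : (@measurable _ (m.-tuple R)) = <<s G >>.
  apply/seteqP; split; last first.
    apply: smallest_sub; first exact: sigma_algebra_measurable.
    by move=> _ [A mA ->]; exact: measurable_box.
  apply: smallest_sub; first exact: smallest_sigma_algebra.
  clear P Q PQ B mB; case: m @G => [|m] G X; first by rewrite big_ord0.
  rewrite -bigcup_mkord_ord => -[i /= im [A mA <-]].
  apply: sub_sigma_algebra.
  exists (fun j => if j == inord i then A else setT).
    by move=> j; case: ifP.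
  apply/seteqP; split => x /=.
    by case=> _ Ax j; case: eqP => // ->.
  by move=> h; split => //; have := h (inord i); rewrite eqxx.
apply: (measure_unique G (fun=> setT)) => //.
- move=> _ _ [A mA ->] [A' mA' ->]; exists (fun i => A i `&` A' i).
    by move=> i; exact: measurableI.
  apply/seteqP; split => x /=; first by move=> [h1 h2] i; split.
  by move=> h; split => i; case: (h i).
- move=> _; exists (fun=> setT) => //.
  by apply/seteqP; split.
- by rewrite bigcup_const.
- by move=> _ [A mA ->]; exact: PQ.
- move=> _; apply: le_lt_trans (probability_le1 P measurableT) _.
  by rewrite ltry.
Qed.

End Boxes.

Section TupleCells.
Context {R : realType} (C : finType) (c : R -> C).
Hypothesis mc : forall e, measurable (c @^-1` [set e]).
Variable mu : probability R R.

Definition tuple_cell (m : nat) (x : m.-tuple R) : {ffun 'I_m -> C} :=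
  [ffun i => c (tnth x i)].

Lemma tuple_cell_box m (d : {ffun 'I_m -> C}) :
  @tuple_cell m @^-1` [set d] = box (fun i => c @^-1` [set d i]).
Proof.
apply/seteqP; split => x /=; first by move=> <- i /=; rewrite ffunE.
by move=> h; apply/ffunP => i; rewrite ffunE; exact: h.
Qed.

Lemma measurable_tuple_cell m (d : {ffun 'I_m -> C}) : measurable (@tuple_cell m @^-1` [set d]).
Proof. by rewrite tuple_cell_box; exact: measurable_box. Qed.

Let pi := cell_law c mu.

Lemma product_cell_box m (d : {ffun 'I_m -> C}) (A : 'I_m -> set R) :
  (forall i, measurable (A i)) ->
  fine (product_prob mu m (@tuple_cell m @^-1` [set d] `&` box A)) =
  \prod_i fine (mu (c @^-1` [set d i] `&` A i)).
Proof.
move=> mA; rewrite (_ : _ `&` _ = box (fun i => c @^-1` [set d i] `&` A i)).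
  have mi i : measurable (c @^-1` [set d i] `&` A i) by exact: measurableI.
  rewrite product_prob_box//.
  have -> : (\prod_(i < m) mu (c @^-1` [set d i] `&` A i) =
    (\prod_i fine (mu (c @^-1` [set d i] `&` A i)))%:E)%E; last by [].
  rewrite -prodEFin; apply: eq_bigr => i _.
  by apply/esym/fineK; exact: fin_num_measure.
rewrite tuple_cell_box; apply/seteqP; split => x /=.
  by move=> [h1 h2] i; split; [exact: h1|exact: h2].
by move=> h; split => i; case: (h i).
Qed.

Lemma cell_law_product m (d : {ffun 'I_m -> C}) :
  cell_law (@tuple_cell m) (product_prob mu m) d = prod_law pi d.
Proof.
have := @product_cell_box m d (fun=> setT) (fun=> measurableT).
have -> : box (fun=> setT) = [set: m.-tuple R] by apply/seteqP; split.
rewrite setIT /cell_law => ->; apply: eq_bigr => i _.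
by rewrite setIT.
Qed.

Lemma integral_product_box m (f : {ffun 'I_m -> C} -> R) (A : 'I_m -> set R) :
  (forall i, measurable (A i)) ->
  (\int[product_prob mu m]_(x in box A) (f (tuple_cell x))%:E =
   (\sum_d f d * \prod_i fine (mu (c @^-1` [set d i] `&` A i)))%:E)%E.
Proof.
move=> mA; rewrite (integral_cell_in (@measurable_tuple_cell m))//; last exact: measurable_box.
by congr EFin; apply: eq_bigr => d _; rewrite product_cell_box.
Qed.

(** Taking cells commutes with taking marginals. *)
Lemma cell_law_marginal k (U : {set 'I_k}) (nu : probability (k.-tuple R) R) e :
  cell_law (@tuple_cell #|U|) (marginal U nu) e = marg_law U (cell_law (@tuple_cell k) nu) e.
Proof.
rewrite /marg_law -(cell_law_image (@measurable_tuple_cell k)) /cell_law /marginal /distribution /pushforward.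
congr (fine (nu _)); rewrite -comp_preimage.
apply/seteqP; split => x /= <-; apply/ffunP => i;
  by rewrite !ffunE tnth_mktuple.
Qed.

Lemma rel_entropy_marginal_le k (U : {set 'I_k}) (nu : probability (k.-tuple R) R) a :
  (KL (marginal U nu) (product_prob mu #|U|) <= a%:E)%E ->
  rel_entropy (marg_law U (cell_law (@tuple_cell k) nu)) (prod_law pi) <= a.
Proof.
move=> /(data_processing (@measurable_tuple_cell #|U|)).
rewrite /rel_entropy; under eq_bigr do rewrite cell_law_marginal cell_law_product.
by [].
Qed.

Lemma cell_law_dominated k (nu : probability (k.-tuple R) R) d :
  marginal [set: 'I_k]%SET nu `<< product_prob mu #|[set: 'I_k]%SET| ->
  prod_law pi d = 0 -> cell_law (@tuple_cell k) nu d = 0.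
Proof.
move=> /(cell_law_null (e := restr [set: 'I_k]%SET d) (@measurable_tuple_cell _)).
rewrite cell_law_product cell_law_marginal prod_law_restr => h pd.
apply/eqP; rewrite eq_le cell_law_ge0 andbT -[leRHS]h; last first.
  by rewrite -[RHS]pd; apply: eq_bigl => i; rewrite inE.
by apply: le_image_law => d'; exact: cell_law_ge0.
Qed.

Section CellMeasure.
Variables (k : nat) (w : {ffun 'I_k -> C} -> R).
Hypotheses (w0 : forall d, 0 <= w d) (w1 : \sum_d w d = 1).
Hypothesis wpi : forall d, prod_law pi d = 0 -> w d = 0.

Let pi0 e : 0 <= pi e. Proof. exact: cell_law_ge0. Qed.
Let pi1 : \sum_e pi e = 1. Proof. exact: sum_cell_law. Qed.

(** The density, constant on cells, that gives the cells the weights [v]. *)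
Let fd (m : nat) (v : {ffun 'I_m -> C} -> R) d := v d / prod_law pi d.

Let fd_mul m (v : {ffun 'I_m -> C} -> R) d :
  (prod_law pi d = 0 -> v d = 0) -> fd v d * prod_law pi d = v d.
Proof.
move=> h; rewrite /fd; have [e|e] := eqVneq (prod_law pi d) 0.
  by rewrite h// e !mulr0.
by rewrite divfK.
Qed.

Let wUpi (U : {set 'I_k}) (e : {ffun 'I_#|U| -> C}) :
  prod_law pi e = 0 -> marg_law U w e = 0.
Proof.
move=> e0; apply: big1 => d /eqP de; apply: wpi; move: e0.
by rewrite -de prod_law_restr => eU; rewrite /prod_law (bigID (mem U)) /= eU mul0r.
Qed.

Let density_cells m (v : {ffun 'I_m -> C} -> R) :
  (forall d, 0 <= v d) -> \sum_d v d = 1 ->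
  (forall d, prod_law pi d = 0 -> v d = 0) ->
  exists nu : probability (m.-tuple R) R,
    has_density nu (product_prob mu m) (fd v \o @tuple_cell m).
Proof.
move=> v0 v1 vpi; apply: density_measure.
- exact: (measurable_fun_cell (@measurable_tuple_cell m)).
- by move=> x; rewrite divr_ge0// prod_law_ge0.
rewrite (integral_cell (@measurable_tuple_cell m)) -[RHS]/(1%:E) -v1; congr EFin.
by apply: eq_bigr => d _; rewrite cell_law_product fd_mul//; exact: vpi.
Qed.

(** A density that is constant on cells remains so for the marginals. The marginal and
the measure with the marginal density agree on boxes, where both are finite sums
over cells. *)
Let marginal_density nu (U : {set 'I_k}) :
  has_density nu (product_prob mu k) (fd w \o @tuple_cell k) ->
  has_density (marginal U nu) (product_prob mu #|U|)
    (fd (marg_law U w) \o @tuple_cell #|U|).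
Proof.
move=> [_ _ nE]; have [nu' nu'd] : exists nu' : probability (#|U|.-tuple R) R,
    has_density nu' (product_prob mu #|U|) (fd (marg_law U w) \o @tuple_cell #|U|).
  by apply: density_cells; [move=> e; exact: image_law_ge0|rewrite sum_image_law1|exact: wUpi].
suff eqn B : measurable B -> marginal U nu B = nu' B.
  case: nu'd => h1 h2 h3; split => // B mB.
  by rewrite eqn// h3.
apply: box_unique => A mA; case: nu'd => _ _ ->; last exact: measurable_box.
rewrite /= integral_product_box//.
(* The box [A], extended by the whole line outside [U]. *)
pose A' a := \bigcap_(j in [set j : 'I_#|U| | enum_val j = a]) A j.
have mA' a : measurable (A' a).
  by apply: fin_bigcap_measurable => //; exact: finite_finset.
have A'E j : A' (enum_val j) = A j.
  apply/seteqP; split => x; first exact.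
  by move=> Ax j' /= /enum_val_inj ->.
have A'T a : a \notin U -> A' a = setT.
  move=> aU; apply/seteqP; split => // x _ j /= ja.
  by move: aU; rewrite -ja enum_valP.
rewrite /marginal /distribution /pushforward.
have -> : Defs.proj U @^-1` box A = box A'.
  apply/seteqP; split => x /= h.
    by move=> a j /= <-; have := h j; rewrite tnth_mktuple.
  by move=> j; rewrite tnth_mktuple; apply: (h (enum_val j)).
rewrite nE ?integral_product_box//; last exact: measurable_box.
congr EFin.
pose al a e := fine (mu (c @^-1` [set e] `&` A' a)).
pose H (e : {ffun 'I_#|U| -> C}) := \prod_(j < #|U|) (al (enum_val j) (e j) / pi (e j)).
transitivity (\sum_(d : {ffun 'I_k -> C}) w d * H (restr U d)); last first.
  rewrite -(sum_image_law w (restr U) H).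
  apply: eq_bigr => e _; rewrite /H big_split /= prodfV mulrA mulrAC /fd.
  by congr (_ * _); apply: eq_bigr => j _; rewrite /al A'E.
apply: eq_bigr => d _; rewrite /fd /H.
have [->|wd] := eqVneq (w d) 0; first by rewrite !mul0r.
have pd a : pi (d a) != 0.
  apply: contra_neq wd => pda; apply: wpi; rewrite /prod_law (bigD1 a)//= pda.
  by rewrite mul0r.
rewrite -mulrA; congr (_ * _); rewrite -prodfV -big_split /=.
rewrite (bigID (mem U)) /= mulrC big1 ?mul1r.
  rewrite big_enum_val; apply: eq_bigr => j _.
  by rewrite ffunE mulrC.
by move=> a aU; rewrite A'T// setIT mulVf.
Qed.

(** The density is constant on cells, hence bounded. The last clause records this in
the form used to bound moments. *)
Lemma cell_measure : exists nu : probability (k.-tuple R) R,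
  [/\ forall d, cell_law (@tuple_cell k) nu d = w d,
      forall U : {set 'I_k}, KL (marginal U nu) (product_prob mu #|U|) =
        (rel_entropy (marg_law U w) (prod_law pi))%:E &
      exists2 K : R, 0 <= K & forall h : k.-tuple R -> R,
        (forall x, 0 <= h x) -> measurable_fun setT h ->
        (\int[nu]_x (h x)%:E <= K%:E * \int[product_prob mu k]_x (h x)%:E)%E].
Proof.
have [nu nud] := density_cells w0 w1 wpi; exists nu.
have nuw d : cell_law (@tuple_cell k) nu d = w d.
  case: (nud) => _ _ nE; rewrite /cell_law tuple_cell_box nE; last exact: measurable_box.
  rewrite integral_product_box//= (bigD1 d)//= [X in _ + X]big1 ?addr0 => [|d' d'd].
    rewrite -[RHS]fd_mul//; last exact: wpi.
    by congr (_ * _); apply: eq_bigr => i _; rewrite setIid.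
  have [i di] : exists i, d' i != d i.
    apply/existsP; apply: contra_neqT d'd => /existsPn h.
    by apply/ffunP => i; apply/eqP/negPn/h.
  rewrite (bigD1 i)//= (_ : _ `&` _ = set0) ?measure0 ?mul0r ?mulr0//.
  by apply/seteqP; split => // x /= [-> /eqP]; rewrite (negbTE di).
split => // [U|].
  rewrite (KL_cell (@measurable_tuple_cell _) (marginal_density U nud)); congr EFin.
  rewrite /rel_entropy; apply: eq_bigr => e _.
  by rewrite cell_law_product cell_law_marginal /marg_law (eq_image_law _ nuw (fun=> erefl)).
exists (\sum_d fd w d).
  by apply: sumr_ge0 => d _; rewrite divr_ge0// prod_law_ge0.
move=> h h0 mh; rewrite (density_change nud) => [|x|]; last 2 first.
  by rewrite lee_fin.
  exact/measurable_EFinP.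
rewrite -ge0_integralZl//=; last 3 first.
  exact/measurable_EFinP.
  by move=> x _; rewrite lee_fin.
  by rewrite lee_fin; apply: sumr_ge0 => d _; rewrite divr_ge0// prod_law_ge0.
have mf : measurable_fun setT (fd w \o @tuple_cell k) by case: nud.
have f0 d : 0 <= fd w d by rewrite divr_ge0// prod_law_ge0.
apply: ge0_le_integral => //=.
- by move=> x _; rewrite -EFinM lee_fin mulr_ge0.
- by apply: emeasurable_funM; exact/measurable_EFinP.
- by apply: emeasurable_funM; exact/measurable_EFinP.
move=> x _; rewrite -!EFinM lee_fin mulrC ler_wpM2r//.
by rewrite (bigD1 (tuple_cell x))//= lerDl sumr_ge0.
Qed.

End CellMeasure.

End TupleCells.

(** * The variational problem *)

Section Moments.
Context {R : realType}.
Implicit Types (mu : probability R R) (k m : nat).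

Lemma product_coord mu m (i : 'I_m) (h : R -> \bar R) :
  (forall x, (0 <= h x)%E) -> measurable_fun setT h ->
  (\int[product_prob mu m]_x h (tnth x i) = \int[mu]_x h x)%E.
Proof.
move=> h0 mh.
have mi : measurable_fun setT ((@tnth m R)^~ i) by exact: measurable_tnth.
rewrite -[LHS](ge0_integral_pushforward mi (product_prob mu m) measurableT)//.
  apply: eq_measure_integral => A mA _.
  transitivity (product_prob mu m ((@tnth m R)^~ i @^-1` A)); first by [].
  rewrite (_ : _ @^-1` A = box (fun j => if j == i then A else setT)).
    rewrite product_prob_box; last by move=> j; case: ifP.
    rewrite (bigD1 i)//= eqxx big1 ?mule1// => j /negbTE ->.
    exact: probability_setT.
  apply/seteqP; split => x /=; first by move=> Ax j; case: eqP => // ->.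
  by move=> /(_ i); rewrite eqxx.
Qed.

Lemma measurable_lin k (v : 'I_k -> R) :
  measurable_fun setT (fun x : k.-tuple R => \sum_a v a * tnth x a).
Proof.
apply: measurable_sum => a; apply: measurable_funM => //.
exact: measurable_tnth.
Qed.

Lemma measurable_sumsq k :
  measurable_fun setT (fun x : k.-tuple R => \sum_a tnth x a ^+ 2).
Proof.
apply: measurable_sum => a; apply: measurable_funX.
exact: measurable_tnth.
Qed.

Section SecondMoments.
Variables (k : nat) (nu : probability (k.-tuple R) R).
Hypothesis nu2 : P2 nu.

Lemma sumsq_integrable :
  nu.-integrable setT (fun x : k.-tuple R => (\sum_a tnth x a ^+ 2)%:E).
Proof.
apply/integrableP; split; first by apply/measurable_EFinP; exact: measurable_sumsq.
under eq_integral => x _ do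
  rewrite /= (ger0_norm (sumr_ge0 _ (fun a _ => sqr_ge0 (tnth x a)))).
exact: nu2.
Qed.

Lemma coord2_integrable i j :
  nu.-integrable setT (fun x : k.-tuple R => (tnth x i * tnth x j)%:E).
Proof.
apply: le_integrable sumsq_integrable => //.
  by apply/measurable_EFinP/measurable_funM; exact: measurable_tnth.
move=> x _ /=.
have s0 : 0 <= \sum_a tnth x a ^+ 2 by apply: sumr_ge0 => a _; exact: sqr_ge0.
rewrite lee_fin [leRHS]ger0_norm//.
have le1 a : tnth x a ^+ 2 <= \sum_a tnth x a ^+ 2.
  by rewrite (bigD1 a)//= lerDl sumr_ge0// => b _; exact: sqr_ge0.
rewrite normrM; have := le1 i; have := le1 j.
rewrite -[tnth x i ^+ 2]real_normK ?num_real//.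
rewrite -[tnth x j ^+ 2]real_normK ?num_real//.
have := sqr_ge0 (`|tnth x i| - `|tnth x j|); nra.
Qed.

Lemma integral_coord2 i j :
  (\int[nu]_x (tnth x i * tnth x j)%:E = (second_moment nu i j)%:E)%E.
Proof.
rewrite mxE /Rintegral fineK//.
exact: (integrable_fin_num measurableT (coord2_integrable i j)).
Qed.

Lemma integral_lin2 (v : 'I_k -> R) :
  (\int[nu]_x ((\sum_a v a * tnth x a) ^+ 2)%:E =
   (qform (second_moment nu) v)%:E)%E.
Proof.
transitivity (\int[nu]_x \sum_(ij : 'I_k * 'I_k)
    ((v ij.1 * v ij.2)%:E * (tnth x ij.1 * tnth x ij.2)%:E))%E.
  apply: eq_integral => x _; rewrite expr2 big_distrlr /= pair_big /=.
  rewrite -sumEFin; apply: eq_bigr => -[i j] _ /=.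
  by rewrite -EFinM; congr EFin; ring.
rewrite integral_sum//; last first.
  by move=> [i j]; apply: integrableZl => //; exact: coord2_integrable.
rewrite /qform pair_big /= -sumEFin; apply: eq_bigr => -[i j] _ /=.
rewrite integralZl//; last exact: coord2_integrable.
by rewrite integral_coord2 -EFinM; congr EFin; ring.
Qed.

Lemma integral_sumsq :
  (\int[nu]_x (\sum_a tnth x a ^+ 2)%:E = (\sum_a second_moment nu a a)%:E)%E.
Proof.
under eq_integral do rewrite -sumEFin.
rewrite integral_sum//; last first.
  by move=> a; under eq_fun do rewrite expr2; exact: coord2_integrable.
rewrite -sumEFin; apply: eq_bigr => a _.
by under eq_integral do rewrite expr2; rewrite integral_coord2.
Qed.

Lemma second_moment_sym : (second_moment nu)^T = second_moment nu.
Proof.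
by apply/matrixP => i j; rewrite !mxE; congr Rintegral; apply/funext => x; rewrite mulrC.
Qed.

End SecondMoments.

Section Variational.
Variables (k : nat) (beta : R) (mu : probability R R).
Hypotheses (k0 : (0 < k)%N) (beta0 : 0 < beta).
Hypothesis mu2 : (\int[mu]_x (x ^+ 2)%:E < +oo)%E.
Hypothesis muexp : exists2 t : R, 0 < t &
  (\int[mu]_x (expR (t * x ^+ 2))%:E < +oo)%E.

Local Notation M := (M_set k beta mu).
Local Notation L := (sup [set lambda_max Q | Q in Gamma_set k beta mu]).

(** The constraints on [w] are those of [M_set], because a density that is constant on
cells makes relative entropies equal to those of the cell laws. *)
Lemma M_set_cells (C : finType) (c : R -> C) (w : {ffun 'I_k -> C} -> R) :
  (forall e, measurable (c @^-1` [set e])) ->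
  (forall d, 0 <= w d) -> \sum_d w d = 1 ->
  (forall d, prod_law (cell_law c mu) d = 0 -> w d = 0) ->
  (forall U : {set 'I_k}, U != finset.set0 ->
     rel_entropy (marg_law U w) (prod_law (cell_law c mu)) <= #|U|%:R / beta) ->
  exists2 nu, M nu & forall d, cell_law (@tuple_cell R C c k) nu d = w d.
Proof.
move=> mc w0 w1 wpi wD; have [nu [nuw nuKL [K K0 nuK]]] := cell_measure mc w0 w1 wpi.
exists nu => //; split; last by move=> U U0; rewrite nuKL lee_fin wD.
rewrite /P2 /=; apply: le_lt_trans (nuK _ _ (@measurable_sumsq k)) _.
  by move=> x; apply: sumr_ge0 => a _; exact: sqr_ge0.
rewrite lte_mul_pinfty ?lee_fin//.
under eq_integral do rewrite -sumEFin.
rewrite ge0_integral_sum//; last 2 first.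
  move=> a; apply/measurable_EFinP/measurable_funX; exact: measurable_tnth.
  by move=> a x _; rewrite lee_fin sqr_ge0.
apply: lte_sum_pinfty => a _.
rewrite (product_coord mu a (h := fun x => (x ^+ 2)%:E))//.
  by move=> x; rewrite lee_fin sqr_ge0.
by apply/measurable_EFinP; exact: measurable_funX.
Qed.

(** With a single cell the construction gives the product measure itself. *)
Lemma M_set_nonempty : M !=set0.
Proof.
pose c (x : R) : unit := tt.
have mc e : measurable (c @^-1` [set e]).
  by rewrite (_ : _ @^-1` _ = setT)//; apply/seteqP; split => // x _; case: e.
have [||||nu Mnu _] := @M_set_cells unit c (prod_law (cell_law c mu)) mc.
- by move=> d; apply: prod_law_ge0 => e; exact: cell_law_ge0.
- by rewrite sum_prod_law1// sum_cell_law.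
- by [].
- move=> U _; rewrite /rel_entropy big1 ?divr_ge0 ?(ltW beta0)// => e _.
  rewrite marg_prod_law ?sum_cell_law//.
  have [->|te] := eqVneq (prod_law (cell_law c mu) e) 0; first by rewrite mul0r.
  by rewrite divff// ln1 mulr0.
by exists nu.
Qed.

(** Gibbs' inequality for the marginal on one coordinate, tested against [t * x ^+ 2],
whose exponential is integrable. *)
Lemma M_set_bounded : exists B : R, forall nu, M nu ->
  forall a, second_moment nu a a <= B.
Proof.
have [t t0 te] := muexp.
set E := (\int[mu]_x (expR (t * x ^+ 2))%:E)%E in te.
have E0 : (0 <= E)%E by apply: integral_ge0 => x _; rewrite lee_fin expR_ge0.
have Efin : E \is a fin_num by rewrite ge0_fin_numE.
exists ((beta^-1 + fine E) / t) => nu [nu2 nuM] a.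
have U0 : [set a]%SET != finset.set0 by apply/set0Pn; exists a; rewrite inE.
have := nuM _ U0.
rewrite (_ : _ / beta = beta^-1); last by rewrite cards1 div1r.
move=> KLa.
have j0 : 'I_#|[set a]%SET| by exact: (enum_rank_in (set11 a) a).
have ej : enum_val j0 = a by have := enum_valP j0; rewrite inE => /eqP.
pose g (x : #|[set a]%SET|.-tuple R) := t * tnth x j0 ^+ 2.
have mg : measurable_fun setT g.
  apply: measurable_funM => //; apply: measurable_funX; exact: measurable_tnth.
have gE : (\int[marginal [set a]%SET nu]_x (g x)%:E =
           (t * second_moment nu a a)%:E)%E.
  rewrite ge0_integral_distribution//; last 2 first.
    exact/measurable_EFinP.
    by move=> x; rewrite lee_fin mulr_ge0 ?sqr_ge0// ltW.
  rewrite EFinM -(integral_coord2 nu2) -integralZl//; last exact: coord2_integrable.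
  apply: eq_integral => x _ /=; rewrite -EFinM /g tnth_mktuple ej.
  by rewrite expr2.
have g0 x : 0 <= g x by rewrite mulr_ge0 ?sqr_ge0// ltW.
have ig : (marginal [set a]%SET nu).-integrable setT (EFin \o g).
  apply/integrableP; split; first exact/measurable_EFinP.
  under eq_integral do rewrite /= ger0_norm//.
  by rewrite gE ltry.
have := gibbs KLa ig mg; rewrite gE.
rewrite (product_coord mu j0 (h := fun x => (expR (t * x ^+ 2))%:E)) -/E.
- rewrite -(fineK Efin) -!EFinD lee_fin ler_pdivlMr// mulrC => h.
  by apply: le_trans h; rewrite lerDl.
- by move=> x; rewrite lee_fin expR_ge0.
- apply/measurable_EFinP; apply: measurableT_comp => //.
  by apply: measurable_funM => //; exact: measurable_funX.
Qed.

Lemma lambda_max_le_trace nu : M nu ->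
  lambda_max (second_moment nu) <= \sum_a second_moment nu a a.
Proof.
move=> [nu2 _]; have [_ [v v1 <-]] := lambda_maxP k0 (second_moment_sym nu).
rewrite -lee_fin -integral_lin2// -integral_sumsq//.
apply: ge0_le_integral => //.
- by move=> x _; rewrite lee_fin sqr_ge0.
- by apply/measurable_EFinP/measurable_funX; exact: measurable_lin.
- by apply/measurable_EFinP; exact: measurable_sumsq.
- by move=> x _; rewrite lee_fin; exact: unit_cauchy_schwarz.
Qed.

Lemma has_sup_lambda : has_sup [set lambda_max Q | Q in Gamma_set k beta mu].
Proof.
split.
  have [nu Mnu] := M_set_nonempty.
  by exists (lambda_max (second_moment nu)), (second_moment nu) => //; exists nu.
have [B hB] := M_set_bounded.
exists (\sum_(a < k) B) => _ [_ [nu Mnu <-] <-].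
apply: le_trans (lambda_max_le_trace Mnu) _.
by apply: ler_sum => a _; exact: hB.
Qed.

Lemma M_set_qform_le nu (v : 'I_k -> R) : M nu ->
  qform (second_moment nu) v <= L * \sum_a v a ^+ 2.
Proof.
move=> Mnu; have [+ _] := lambda_maxP k0 (second_moment_sym nu).
move=> /(_ v) /le_trans; apply; apply: ler_wpM2r.
  by apply: sumr_ge0 => a _; exact: sqr_ge0.
apply: sup_upper_bound; first exact: has_sup_lambda.
by exists (second_moment nu) => //; exists nu.
Qed.

Lemma M_set_diag_le nu a : M nu -> second_moment nu a a <= L.
Proof.
move=> Mnu; have := M_set_qform_le (fun b => (b == a)%:R) Mnu.
have e (f : 'I_k -> R) : \sum_b (b == a)%:R * f b = f a.
  rewrite (bigD1 a)//= eqxx mul1r big1 ?addr0// => b /negbTE ->.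
  by rewrite mul0r.
have -> : \sum_b (b == a)%:R ^+ 2 = 1 :> R.
  by rewrite (eq_bigr (fun b => (b == a)%:R * 1)) ?e// => b _; case: eqP => _; rewrite mulr1 ?expr1n ?expr0n.
rewrite mulr1; congr (_ <= _).
rewrite /qform (eq_bigr (fun i => (i == a)%:R * second_moment nu i a)) ?e// => i _.
under eq_bigr do rewrite -mulrA [X in _ * X]mulrC.
by rewrite -mulr_sumr e.
Qed.

(** Diagonal second moments are nonnegative. *)
Lemma sup_lambda_ge0 : 0 <= L.
Proof.
have [nu Mnu] := M_set_nonempty.
apply: le_trans (M_set_diag_le (Ordinal k0) Mnu).
rewrite -lee_fin; case: Mnu => nu2 _; rewrite -integral_coord2//.
by apply: integral_ge0 => x _; rewrite lee_fin -expr2 sqr_ge0.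
Qed.

Lemma M_set_near_sup (e : R) : 0 < e -> exists2 nu, M nu &
  exists2 v : 'I_k -> R, \sum_a v a ^+ 2 = 1 & L - e < qform (second_moment nu) v.
Proof.
move=> e0; have [_ [_ [nu Mnu <-] <-] h] := sup_adherent e0 has_sup_lambda.
exists nu => //; have [_ [v v1 vE]] := lambda_maxP k0 (second_moment_sym nu).
by exists v => //; rewrite vE.
Qed.

End Variational.
End Moments.

(** * Upper bound on the typical event *)

Section UnionBound.
Context {R : realType}.

Lemma sum_exists_le (Z S : finType) (w : Z -> R) (B : S -> pred Z) :
  (forall z, 0 <= w z) ->
  \sum_(z | [exists s, B s z]) w z <= \sum_s \sum_(z | B s z) w z.
Proof.
move=> w0; under [leRHS]eq_bigr do rewrite big_mkcond.
rewrite exchange_big /= big_mkcond; apply: ler_sum => z _.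
case: existsP => [[s Bs]|_]; last by apply: sumr_ge0 => s _; case: ifP.
by rewrite (bigD1 s)//= Bs lerDl; apply: sumr_ge0 => s' _; case: ifP.
Qed.

Lemma sum_or_le (Z : finType) (w : Z -> R) (B1 B2 : pred Z) :
  (forall z, 0 <= w z) ->
  \sum_(z | B1 z || B2 z) w z <= \sum_(z | B1 z) w z + \sum_(z | B2 z) w z.
Proof.
move=> w0; rewrite !(big_mkcond _ w) /= -big_split; apply: ler_sum => z _ /=.
by case: (B1 z); case: (B2 z); rewrite ?addr0 ?add0r// lerDl.
Qed.

End UnionBound.

Section UpperBad.
Context {R : realType}.
Variables (p n k : nat) (C : finType) (pi : C -> R) (out : pred C) (dl : R).
Hypotheses (pi0 : forall e, 0 <= pi e) (pi1 : \sum_e pi e = 1).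
Hypothesis n0 : (0 < n)%N.

Definition select_cols m (t : {ffun 'I_m -> 'I_n}) (row : {ffun 'I_n -> C}) :
  {ffun 'I_m -> C} := [ffun u => row (t u)].

(** The logarithm of the number of [m]-tuples of columns, increased by a margin
proportional to the number of rows. *)
Definition cost (m : nat) : R := m%:R * ln n%:R + p%:R * dl.

(** The likelihood form of the event that the empirical law of the columns [t] has
relative entropy more than [cost m / p]. *)
Definition too_likely m (t : {ffun 'I_m -> 'I_n})
    (z : {ffun 'I_p -> {ffun 'I_n -> C}}) : bool :=
  expR (cost m) * prod_law (prod_law pi) (pointwise (select_cols t) z)
    < prod_law (emp_law (pointwise (select_cols t) z)) (pointwise (select_cols t) z).

Definition atypical_matrix (z : {ffun 'I_p -> {ffun 'I_n -> C}}) : bool :=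
  [exists ij : 'I_p * 'I_n, out (z ij.1 ij.2)] ||
  [exists U : {set 'I_k}, [exists t : {ffun 'I_#|U| -> 'I_n},
     injectiveb t && too_likely t z]].

Let W0 (z : {ffun 'I_p -> {ffun 'I_n -> C}}) : 0 <= prod_law (prod_law pi) z.
Proof. by apply: prod_law_ge0 => r; exact: prod_law_ge0. Qed.

Lemma sum_too_likely m (t : {ffun 'I_m -> 'I_n}) : injective t ->
  \sum_(z | too_likely t z) prod_law (prod_law pi) z <=
  (p.+1 ^ (#|C| ^ m))%:R * expR (- cost m).
Proof.
move=> tI.
have -> : \sum_(z | too_likely t z) prod_law (prod_law pi) z =
    \sum_(y : {ffun 'I_p -> {ffun 'I_m -> C}} |
       expR (cost m) * prod_law (prod_law pi) y < prod_law (emp_law y) y) prod_law (prod_law pi) y.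
  rewrite big_mkcond [RHS]big_mkcond /=.
  pose h (y : {ffun 'I_p -> {ffun 'I_m -> C}}) : R :=
    (expR (cost m) * prod_law (prod_law pi) y < prod_law (emp_law y) y)%R%:R.
  transitivity (\sum_(z : {ffun 'I_p -> {ffun 'I_n -> C}})
      prod_law (prod_law pi) z * h (pointwise (select_cols t) z)).
    apply: eq_bigr => z _; rewrite /h /too_likely.
    by case: ifP => _; rewrite ?mulr1 ?mulr0.
  rewrite -(sum_image_law (prod_law (prod_law pi)) (pointwise (select_cols t)) h).
  apply: eq_bigr => y _; rewrite image_prod_law.
  have -> : prod_law (image_law (prod_law pi) (select_cols t)) y = prod_law (prod_law pi) y.
    by apply: eq_bigr => i _; exact: image_prod_law_inj.
  by rewrite /h; case: ifP => _; rewrite ?mulr1 ?mulr0.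
have := @types_bound R 'I_p {ffun 'I_m -> C} (prod_law pi) (cost m).
rewrite card_ord card_ffun card_ord; apply=> d.
exact: prod_law_ge0.
Qed.

(** The [n ^ m] choices of columns cancel the first part of the cost; the margin
remains. *)
Lemma atypical_matrix_prob : (0 < #|C|)%N ->
  \sum_(z | atypical_matrix z) prod_law (prod_law pi) z <=
  (p * n)%:R * (\sum_(e | out e) pi e) +
  (2 ^ k)%:R * ((p.+1 ^ (#|C| ^ k))%:R * expR (- (p%:R * dl))).
Proof.
move=> C0; apply: le_trans (sum_or_le _ _ W0) _; apply: lerD.
  apply: le_trans (sum_exists_le _ W0) _.
  rewrite (eq_bigr (fun=> \sum_(e | out e) pi e)).
    by rewrite sumr_const card_prod !card_ord -[leLHS]mulr_natl.
  move=> -[i j] _ /=.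
  pose G (z : {ffun 'I_p -> {ffun 'I_n -> C}}) := z i j.
  transitivity (\sum_z prod_law (prod_law pi) z * (out (z i j))%:R).
    by rewrite big_mkcond; apply: eq_bigr => z _; case: ifP; rewrite ?mulr1 ?mulr0.
  pose g1 (u : 'I_1) := i; pose g2 (u : 'I_1) := j.
  have e1 : image_law (prod_law (prod_law pi)) (fun z : {ffun 'I_p -> {ffun 'I_n -> C}} =>
      [ffun u => z (g1 u)]) =1 prod_law (prod_law pi).
    move=> d; apply: image_prod_law_inj; first exact: sum_prod_law1.
    by move=> u u' _; rewrite !ord1.
  have e2 : image_law (prod_law pi) (fun r : {ffun 'I_n -> C} => [ffun u => r (g2 u)]) =1 prod_law pi.
    move=> d; apply: image_prod_law_inj => //.
    by move=> u u' _; rewrite !ord1.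
  transitivity (\sum_z prod_law (prod_law pi) z *
     (fun y : {ffun 'I_1 -> {ffun 'I_n -> C}} => (out (y ord0 j))%:R : R)
       [ffun u => z (g1 u)]).
    by apply: eq_bigr => z _; rewrite ffunE.
  rewrite -(sum_image_law _ _ (fun y : {ffun 'I_1 -> {ffun 'I_n -> C}} => (out (y ord0 j))%:R)).
  transitivity (\sum_(r : {ffun 'I_n -> C}) prod_law pi r *
     (fun y : {ffun 'I_1 -> C} => (out (y ord0))%:R : R) [ffun u => r (g2 u)]).
    rewrite (reindex (fun r : {ffun 'I_n -> C} => [ffun _ : 'I_1 => r])) /=.
      by apply: eq_bigr => r _; rewrite e1 /prod_law big_ord1 !ffunE.
    exists (fun y => y ord0) => [r|y] _; first by rewrite ffunE.
    by apply/ffunP => u; rewrite ffunE (ord1 u).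
  rewrite -(sum_image_law _ _ (fun y : {ffun 'I_1 -> C} => (out (y ord0))%:R)).
  rewrite (reindex (fun e : C => [ffun _ : 'I_1 => e])) /=.
    rewrite [RHS]big_mkcond; apply: eq_bigr => e _.
    by rewrite e2 /prod_law big_ord1 !ffunE; case: ifP; rewrite ?mulr1 ?mulr0.
  exists (fun y => y ord0) => [r|y] _; first by rewrite ffunE.
  by apply/ffunP => u; rewrite ffunE (ord1 u).
apply: le_trans (sum_exists_le _ W0) _.
have -> : (2 ^ k)%:R * ((p.+1 ^ (#|C| ^ k))%:R * expR (- (p%:R * dl))) =
   \sum_(U : {set 'I_k}) ((p.+1 ^ (#|C| ^ k))%:R * expR (- (p%:R * dl))).
  have := card_powerset [set: 'I_k]%SET; rewrite powersetT cardsT cardsE card_ord => e.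
  by rewrite sumr_const e -[RHS]mulr_natl.
apply: ler_sum => U _; apply: le_trans (sum_exists_le _ W0) _.
have Uk : (#|U| <= k)%N by rewrite -[leqRHS]card_ord max_card.
apply: (@le_trans _ _ (\sum_(t : {ffun 'I_#|U| -> 'I_n})
    ((p.+1 ^ (#|C| ^ #|U|))%:R * expR (- cost #|U|)))).
  apply: ler_sum => t _; case: injectiveP => [tI|_] /=.
    exact: sum_too_likely.
  by rewrite big_pred0// mulr_ge0// expR_ge0.
rewrite sumr_const card_ffun !card_ord -[leLHS]mulr_natl.
rewrite mulrCA; apply: ler_pM => //.
- rewrite ler_nat; apply: leq_pexp2l => //; exact: leq_pexp2l.
have e : expR (#|U|%:R * ln n%:R) = (n ^ #|U|)%:R :> R.
  by rewrite expRM_natl lnK ?posrE ?ltr0n// natrX.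
rewrite /cost opprD expRD mulrA [expR (- (_ * ln _))]expRN e divff ?mul1r//.
by rewrite pnatr_eq0 -lt0n expn_gt0 n0.
Qed.

End UpperBad.

Section UpperGood.
Context {R : realType}.
Variables (k : nat) (beta : R) (mu : probability R R).
Hypotheses (k0 : (0 < k)%N) (beta0 : 0 < beta).
Hypothesis mu2 : (\int[mu]_x (x ^+ 2)%:E < +oo)%E.
Hypothesis muexp : exists2 t : R, 0 < t &
  (\int[mu]_x (expR (t * x ^+ 2))%:E < +oo)%E.
Variables (p n : nat) (h : R) (J : nat) (dl th : R).
Hypotheses (h0 : 0 < h) (th0 : 0 < th) (th1 : th < 1).
Hypotheses (p0 : (0 < p)%N) (kn : (k <= n)%N).
(** The union bound affords [cost m] for [m] columns; after mixing with weight [th] this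
must fit the constraint of [M_set]. *)
Hypothesis rate : forall m, (0 < m)%N ->
  (1 - th) * (cost p n dl m / p%:R) <= m%:R / beta.

Local Notation c := (geom_cell (1 + h) J).
Local Notation C := ('I_J.+1 * bool)%type.
Local Notation pi := (cell_law c mu).
Local Notation L := (sup [set lambda_max Q | Q in Gamma_set k beta mu]).

Let r1 : 1 < 1 + h. Proof. by rewrite ltrDl. Qed.
Let mc e : measurable (c @^-1` [set e]). Proof. exact: measurable_geom_cell. Qed.
Let pi0 e : 0 <= pi e. Proof. exact: cell_law_ge0. Qed.
Let pi1 : \sum_e pi e = 1. Proof. by rewrite sum_cell_law. Qed.

(** For any [k] columns, the empirical law of the cells, mixed with the product law,
is the cell law of some [nu] in [M_set]. On each cell the rows are comparable with
the points of that cell, so the quadratic form of the columns is bounded by the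
integral under [nu] of [H]. *)
Lemma typical_T_nk_le (X : 'M[R]_(p, n)) :
  ~~ atypical_matrix (p := p) (n := n) k pi (@outer J) dl
       [ffun i => [ffun j => c (X i j)]] ->
  T_nk k X <= p%:R * (((1 + h) * L + 2 * h * (1 + h) * (k%:R + k%:R * L)) / (1 - th)).
Proof.
set z := finfun _; rewrite negb_or => /andP[/existsPn noout /existsPn unlikely].
have pp : 0 < p%:R :> R by rewrite ltr0n.
have zE i j : z i j = c (X i j) by rewrite !ffunE.
have inn i j : ~~ outer (c (X i j)) by have := noout (i, j); rewrite /= zE.
apply: T_nk_le => // s v sI v1.
pose y : {ffun 'I_p -> {ffun 'I_k -> C}} := [ffun i => [ffun a => z i (s a)]].
pose tau := @emp_law R _ _ y.
have cI : (0 < #|'I_p|)%N by rewrite card_ord.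
have margtau (U : {set 'I_k}) : marg_law U tau =1 @emp_law R _ _ (pointwise (restr U) y).
  move=> e; rewrite /marg_law /tau /emp_law image_law_comp; apply: eq_image_law => // i /=.
  by rewrite [RHS]ffunE.
have Dtau (U : {set 'I_k}) : rel_entropy (marg_law U tau) (prod_law pi) <= cost p n dl #|U| / p%:R /\
    forall e, prod_law pi e = 0 -> marg_law U tau e = 0.
  have := unlikely U => /existsPn/(_ [ffun u => s (enum_val u)]).
  rewrite negb_and => /orP[/injectiveP[]|].
    by move=> u u'; rewrite !ffunE => /sI/enum_val_inj.
  rewrite /too_likely -leNgt.
  rewrite (_ : pointwise _ _ = pointwise (restr U) y); last first.
    by apply/ffunP => i; apply/ffunP => u; rewrite !ffunE.
  move=> /(rel_entropy_emp_le (fun d => prod_law_ge0 d pi0) cI)[].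
  rewrite card_ord /rel_entropy => D1 D2; split.
    by apply: le_trans D1; under eq_bigr do rewrite margtau.
  by move=> e /D2; rewrite margtau.
have tau0 d : 0 <= tau d by exact: emp_law_ge0.
have tau1 : \sum_d tau d = 1 by exact: sum_emp_law.
have taupi d : prod_law pi d = 0 -> tau d = 0.
  move=> td; have [_ /(_ (restr [set: 'I_k]%SET d))] := Dtau [set: 'I_k]%SET.
  rewrite prod_law_restr => h1; apply/eqP; rewrite eq_le tau0 andbT -[leRHS]h1.
    exact: le_image_law.
  by rewrite -[RHS]td; apply: eq_bigl => a; rewrite inE.
have t0 d : 0 <= prod_law pi d by move=> *; exact: prod_law_ge0.
(* Mixing turns the cost, slightly above [#|U| / beta], into an admissible bound. *)
pose w (d : {ffun 'I_k -> C}) : R := (1 - th) * tau d + th * prod_law pi d.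
have [||||nu Mnu nuw] := @M_set_cells R k beta mu mu2 C c w mc.
- by move=> d; rewrite addr_ge0// mulr_ge0// ?subr_ge0 ltW.
- by rewrite big_split /= -!mulr_sumr tau1 sum_prod_law1// !mulr1 subrK.
- by move=> d td; rewrite /w taupi// td !mulr0 addr0.
- move=> U U0; have [D1 D2] := Dtau U.
  have U0' : (0 < #|U|)%N by rewrite card_gt0.
  apply: le_trans (rate U0').
  apply: (@le_trans _ _ ((1 - th) * rel_entropy (marg_law U tau) (prod_law pi))); last first.
    by rewrite ler_wpM2l// subr_ge0 ltW.
  apply: le_trans (rel_entropy_mix _ _ D2 th0 th1); last 2 first.
  + by move=> e; exact: image_law_ge0.
  + by move=> e; exact: prod_law_ge0.
  rewrite le_eqVlt; apply/orP; left; apply/eqP; apply: eq_bigr => e _.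
  have -> // : marg_law U w e = (1 - th) * marg_law U tau e + th * prod_law pi e.
  rewrite -[X in th * X](marg_prod_law pi1) /marg_law /image_law big_split /=.
  by rewrite -!mulr_sumr.
pose q i := (\sum_a v a * X i (s a)) ^+ 2.
(* [g] depends on the cell only, dominates the rows of that cell, and is dominated
   by [H] at every point of the cell. *)
pose g (d : {ffun 'I_k -> C}) : R := \big[Order.max/0]_(i | y i == d) q i.
have g0 d : 0 <= g d by apply: bigmax_ge_id.
have [nu2 _] := Mnu.
pose H (x : k.-tuple R) : R := (1 + h) * (\sum_a v a * tnth x a) ^+ 2 +
  2 * h * (1 + h) * (k%:R + \sum_a tnth x a ^+ 2).
have gH x : g (tuple_cell c x) <= H x.
  have S0 : 0 <= \sum_a tnth x a ^+ 2 by apply: sumr_ge0 => a _; exact: sqr_ge0.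
  apply/bigmax_leP; split => [|i /eqP yi].
    have h1 : 0 <= 1 + h by rewrite addr_ge0 ?(ltW h0).
    rewrite /H; apply: addr_ge0; first by rewrite mulr_ge0 ?sqr_ge0.
    by apply: mulr_ge0; [rewrite !mulr_ge0 ?(ltW h0)|rewrite addr_ge0].
  have := @mesh_quadratic R k v (fun a => X i (s a)) (tnth x) h h0 v1.
  case=> // a; have /ffunP/(_ a) := yi; rewrite !ffunE => e.
  have := geom_cell_mesh r1 e (inn _ _).
  by rewrite (_ : 1 + h - 1 = h)//; ring.
have intH : (\int[nu]_x (H x)%:E = ((1 + h) * qform (second_moment nu) v +
   2 * h * (1 + h) * (k%:R + \sum_a second_moment nu a a))%:E)%E.
  have mq : measurable_fun setT (fun x : k.-tuple R => (\sum_a v a * tnth x a) ^+ 2).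
    by apply: measurable_funX; exact: measurable_lin.
  have il : nu.-integrable setT
     (fun x : k.-tuple R => ((\sum_a v a * tnth x a) ^+ 2)%:E).
    apply/integrableP; split; first exact/measurable_EFinP.
    under eq_integral => x _ do rewrite /= (ger0_norm (sqr_ge0 _)).
    by rewrite integral_lin2// ltry.
  have isq := sumsq_integrable nu2.
  have ik : nu.-integrable setT (EFin \o cst k%:R : _ -> \bar R).
    exact: finite_measure_integrable_cst.
  transitivity (\int[nu]_x ((1 + h)%:E * ((\sum_a v a * tnth x a) ^+ 2)%:E +
     (2 * h * (1 + h))%:E * (k%:R%:E + (\sum_a tnth x a ^+ 2)%:E)))%E.
    by apply: eq_integral => x _.
  rewrite integralD//; last 2 first.
    exact: integrableZl.
    by apply: integrableZl => //; exact: integrableD.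
  rewrite !integralZl//; last exact: integrableD.
  rewrite integral_lin2// integralD// integral_sumsq//.
  by rewrite integral_const -!EFinM.
have le1 : \sum_d g d * w d <= (1 + h) * L + 2 * h * (1 + h) * (k%:R + k%:R * L).
  rewrite -lee_fin; under eq_bigr do rewrite -nuw.
  rewrite -(integral_cell (@measurable_tuple_cell _ _ _ mc k)).
  apply: (@le_trans _ _ (\int[nu]_x (H x)%:E)%E).
    apply: ge0_le_integral => //.
    - by move=> x _; rewrite lee_fin.
    - apply/measurable_EFinP.
      exact: (measurable_fun_cell (@measurable_tuple_cell _ _ _ mc k) g).
    - apply/measurable_EFinP; apply: measurable_funD.
        apply: measurable_funM => //; apply: measurable_funX; exact: measurable_lin.
      apply: measurable_funM => //; apply: measurable_funD => //.
      exact: measurable_sumsq.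
    - by move=> x _; rewrite lee_fin.
  rewrite intH lee_fin; apply: lerD.
    rewrite ler_pM2l ?(lt_trans ltr01)// -[L]mulr1 -v1.
    exact: M_set_qform_le.
  rewrite ler_wpM2l ?mulr_ge0 ?addr_ge0 ?(ltW h0)// lerD2l.
  have -> : k%:R * L = \sum_(a < k) L by rewrite sumr_const card_ord mulr_natl.
  apply: ler_sum => a _.
  exact: M_set_diag_le.
rewrite mulrA ler_pdivlMr ?subr_gt0// mulrC -ler_pdivrMl// mulrCA.
apply: le_trans le1; rewrite mulr_sumr mulr_sumr.
apply: (@le_trans _ _ ((1 - th) * \sum_d tau d * g d)); last first.
  rewrite mulr_sumr; apply: ler_sum => d _; rewrite mulrA mulrC ler_wpM2l//.
  by rewrite lerDl mulr_ge0 ?(ltW th0).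
rewrite /tau sum_image_law mulr_sumr; apply: ler_sum => i _.
rewrite card_ord ler_wpM2l ?subr_ge0 ?(ltW th1)// ler_wpM2l ?invr_ge0//.
exact: (le_bigmax_cond _ (fun i => q i) (eqxx (y i))).
Qed.

End UpperGood.

(** * Lower bound by discretisation of a near-optimal law *)

Section InnerMoments.
Context {R : realType}.

Lemma bernoulli_ineq (h : R) J : 0 < h -> 1 + J%:R * h <= (1 + h) ^+ J.
Proof.
move=> h0; elim: J => [|J IH]; first by rewrite mul0r addr0 expr0.
rewrite exprS; apply: (@le_trans _ _ ((1 + h) * (1 + J%:R * h))); last first.
  by rewrite ler_wpM2l// addr_ge0// ltW.
rewrite -natr1; have : 0 <= J%:R * h * h by rewrite !mulr_ge0// ltW.
nra.
Qed.

Definition inner_tuple (h : R) (k J : nat) (y : k.-tuple R) : bool :=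
  [forall a, ~~ outer (geom_cell (1 + h) J (tnth y a))].

Variables (k : nat) (nu : probability (k.-tuple R) R) (h : R).
Hypotheses (nu2 : P2 nu) (h0 : 0 < h).

Let r1 : 1 < 1 + h. Proof. by rewrite ltrDl. Qed.

Lemma inner_tuple_near (y : k.-tuple R) : \forall J \near \oo, inner_tuple h J y.
Proof.
near=> J; apply/forallP => a; rewrite (outer_geom_cell _ r1) -ltNge.
apply: lt_le_trans (bernoulli_ineq J h0); rewrite ltrD2l.
rewrite -ltr_pdivrMr//; apply: (@le_lt_trans _ _ ((\sum_b `|tnth y b|) / h)).
  by rewrite ler_pM2r ?invr_gt0// (bigD1 a)//= lerDl sumr_ge0.
near: J; exact: nbhs_infty_gtr.
Unshelve. all: by end_near. Qed.

Lemma measurable_inner J : measurable [set y : k.-tuple R | inner_tuple h J y].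
Proof.
pose c := geom_cell (1 + h) J.
rewrite (_ : mkset _ = @tuple_cell R _ c k @^-1` [set d | [forall a, ~~ outer (d a)]]).
  exact: (measurable_cell (@measurable_tuple_cell _ _ _ (@measurable_geom_cell _ _ _) k)).
apply/seteqP; split => y /forallP H; apply/forallP => a; have := H a;
  by rewrite ?ffunE.
Qed.

(** Inner cells exhaust the space; dominated convergence. *)
Lemma inner_moment_near (e : R) : 0 < e -> exists J : nat,
  \sum_a second_moment nu a a - e <=
  fine (\int[nu]_y (if inner_tuple h J y then \sum_a tnth y a ^+ 2 else 0)%:E).
Proof.
move=> e0.
pose F (J : nat) (y : k.-tuple R) : \bar R :=
  (if inner_tuple h J y then \sum_a tnth y a ^+ 2 else 0)%:E.
have S0 (y : k.-tuple R) : 0 <= \sum_a tnth y a ^+ 2.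
  by apply: sumr_ge0 => a _; exact: sqr_ge0.
have mF J : measurable_fun setT (F J).
  apply/measurable_EFinP; apply: measurable_fun_ifT => //.
    apply: (measurable_fun_bool true) => /=.
    by rewrite setTI; exact: measurable_inner.
  exact: measurable_sumsq.
have mS : measurable_fun setT (fun y : k.-tuple R => (\sum_a tnth y a ^+ 2)%:E).
  by apply/measurable_EFinP; exact: measurable_sumsq.
have [||_ _] := @dominated_convergence _ _ _ nu setT measurableT F _ _ mF mS _
  (sumsq_integrable nu2).
- apply: aeW => y _; apply: cvg_near_cst.
  by near=> J; rewrite /F ifT//; near: J; exact: inner_tuple_near.
- apply: aeW => y J _; rewrite /F; case: ifP => _ /=.
    by rewrite ger0_norm.
  by rewrite normr0 lee_fin.
rewrite integral_sumsq// => /fine_cvgP[_ /cvgrPdist_le /(_ e e0)].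
move=> [J _ /(_ J (leqnn J)) /=] /ler_normlP[_ h1].
by exists J; rewrite lerBlDr -lerBlDl; exact: h1.
Unshelve. all: by end_near. Qed.

End InnerMoments.

Section LowerCells.
Context {R : realType}.
Variables (k : nat) (nu : probability (k.-tuple R) R) (h : R) (J : nat).
Variable v : 'I_k -> R.
Hypotheses (nu2 : P2 nu) (h0 : 0 < h) (v1 : \sum_a v a ^+ 2 = 1).

Local Notation c := (geom_cell (1 + h) J).
Local Notation C := ('I_J.+1 * bool)%type.
Local Notation lin2 x := ((\sum_a v a * tnth x a) ^+ 2).
Local Notation sumsq x := (\sum_a tnth x a ^+ 2).

Let r1 : 1 < 1 + h. Proof. by rewrite ltrDl. Qed.
Let mc e : measurable (c @^-1` [set e]). Proof. exact: measurable_geom_cell. Qed.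

(** A lower bound for the quadratic form that depends on the cell only. Outer cells,
which are unbounded, receive the trivial bound [0]. *)
Definition cell_inf (d : {ffun 'I_k -> C}) : R :=
  if [forall a, ~~ outer (d a)]
  then inf [set lin2 x | x in @tuple_cell R C c k @^-1` [set d]] else 0.

Lemma cell_inf_ge0 d : 0 <= cell_inf d.
Proof.
rewrite /cell_inf; case: ifP => // _.
have [[x dx]|no] := pselect (exists x, tuple_cell c x = d).
  apply: lb_le_inf; first by exists (lin2 x), x.
  by move=> _ [y _ <-]; exact: sqr_ge0.
rewrite (_ : image _ _ = set0) ?inf0//.
by apply/seteqP; split => // _ [y /= yd _]; apply: no; exists y.
Qed.

Lemma cell_inf_le (x : k.-tuple R) : cell_inf (tuple_cell c x) <= lin2 x.
Proof.
rewrite /cell_inf; case: ifP => _; last exact: sqr_ge0.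
apply: ge_inf; last by exists x.
by exists 0 => _ [y _ <-]; exact: sqr_ge0.
Qed.

Lemma cell_inf_ge (y : k.-tuple R) : inner_tuple h J y ->
  lin2 y <= (1 + h) * cell_inf (tuple_cell c y) + 2 * h * (1 + h) * (k%:R + sumsq y).
Proof.
move=> yin; have h1 : 0 < 1 + h by rewrite addr_gt0.
rewrite /cell_inf ifT; last by apply/forallP => a; rewrite ffunE; exact: (forallP yin).
rewrite -lerBlDr -ler_pdivrMl//; apply: lb_le_inf; first by exists (lin2 y), y.
move=> _ [x /= /ffunP xy <-]; rewrite ler_pdivrMl// lerBlDr.
have [|_] := @mesh_quadratic R k v (tnth x) (tnth y) h h0 v1; last exact.
move=> a; have e : c (tnth x a) = c (tnth y a) by have := xy a; rewrite !ffunE.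
have := geom_cell_mesh r1 e; rewrite e (forallP yin a) => /(_ isT).
by rewrite (_ : 1 + h - 1 = h)//; ring.
Qed.

(** The loss in passing to cells is the mesh error on inner cells and, on outer cells,
at most the second moment carried by them. *)
Lemma cell_inf_mean :
  qform (second_moment nu) v <=
  (1 + h) * (\sum_d cell_law (@tuple_cell R C c k) nu d * cell_inf d) +
  2 * h * (1 + h) * (k%:R + \sum_a second_moment nu a a) +
  (\sum_a second_moment nu a a -
   fine (\int[nu]_y (if inner_tuple h J y then sumsq y else 0)%:E)).
Proof.
have S0 (y : k.-tuple R) : 0 <= sumsq y.
  by apply: sumr_ge0 => a _; exact: sqr_ge0.
have h1 : 0 <= 1 + h by rewrite addr_ge0// ltW.
have h2 : 0 <= 2 * h * (1 + h) by rewrite !mulr_ge0// ltW.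
have iS := sumsq_integrable nu2.
pose F (y : k.-tuple R) := if inner_tuple h J y then sumsq y else 0.
have mF : measurable_fun setT F.
  apply: measurable_fun_ifT => //; last exact: measurable_sumsq.
  apply: (measurable_fun_bool true) => /=.
  by rewrite setTI; exact: measurable_inner.
have iF : nu.-integrable setT (EFin \o F).
  apply: le_integrable iS => //; first exact/measurable_EFinP.
  move=> y _; rewrite /= lee_fin /F; case: ifP => // _.
  by rewrite normr0.
have iFE : (\int[nu]_y (F y)%:E = (fine (\int[nu]_y (F y)%:E))%:E)%E.
  by rewrite fineK//; exact: (integrable_fin_num measurableT iF).
have ig := integrable_cell (@measurable_tuple_cell _ _ _ mc k) nu cell_inf.
have ik : nu.-integrable setT (EFin \o cst k%:R : _ -> \bar R).
  exact: finite_measure_integrable_cst.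
rewrite -lee_fin -integral_lin2//.
pose B (y : k.-tuple R) : \bar R := (((1 + h)%:E * (cell_inf (tuple_cell c y))%:E +
   (2 * h * (1 + h))%:E * (k%:R%:E + (sumsq y)%:E)) +
   ((sumsq y)%:E - (F y)%:E))%E.
have i1 : nu.-integrable setT (fun y => (1 + h)%:E * (cell_inf (tuple_cell c y))%:E)%E.
  exact: integrableZl.
have i2 : nu.-integrable setT (fun y => (2 * h * (1 + h))%:E * (k%:R%:E + (sumsq y)%:E))%E.
  by apply: integrableZl => //; exact: integrableD.
have i3 : nu.-integrable setT (fun y => (sumsq y)%:E - (F y)%:E)%E.
  exact: integrableB.
have iB : nu.-integrable setT B.
  by apply: integrableD => //; exact: integrableD.
apply: (@le_trans _ _ (\int[nu]_y B y)%E).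
  apply: ge0_le_integral => //.
  - by move=> y _; rewrite lee_fin sqr_ge0.
  - by apply/measurable_EFinP; apply: measurable_funX; exact: measurable_lin.
  - exact: measurable_int iB.
  move=> y _; rewrite /B -!(EFinD, EFinM, EFinB) lee_fin /F.
  case: ifPn => yin; first by rewrite subrr addr0; exact: cell_inf_ge.
  rewrite subr0; apply: le_trans (unit_cauchy_schwarz _ v1) _.
  by rewrite lerDr addr_ge0// mulr_ge0 ?cell_inf_ge0// addr_ge0.
rewrite /B integralD//; last exact: integrableD.
rewrite (integralD _ i1 i2)// integralB// integralZl//.
rewrite integralZl//; last exact: integrableD.
rewrite integralD// integral_const integral_sumsq// -/(F _).
rewrite (integral_cell (@measurable_tuple_cell _ _ _ mc k)) iFE.
rewrite -!(EFinD, EFinM, EFinB) lee_fin.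
by under eq_bigr do rewrite mulrC.
Qed.

End LowerCells.

Section LowerProbability.
Context {R : realType}.
Variables (k n p : nat) (C : finType) (pi : C -> R).
Variables (w : {ffun 'I_k -> C} -> R) (g : {ffun 'I_k -> C} -> R) (e : R).
Hypotheses (pi0 : forall c, 0 <= pi c) (pi1 : \sum_c pi c = 1).
Hypotheses (w0 : forall d, 0 <= w d) (w1 : \sum_d w d = 1).
Hypothesis wpi : forall d, prod_law pi d = 0 -> w d = 0.
Hypotheses (e0 : 0 < e) (p0 : (0 < p)%N) (n0 : (0 < n)%N).
Hypothesis rate : forall U : {set 'I_k}, U != finset.set0 ->
  p%:R * (rel_entropy (marg_law U w) (prod_law pi) + 4 * e) <= #|U|%:R * ln n%:R.

(** Combines the second moment method with the lower bound on the weight of typical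
sequences; the hypothesis [rate] makes every term of the sum at most
[expR (- (p%:R * e))]. *)
Lemma no_typical_tuple_prob :
  (\sum_(z : {ffun 'I_p -> {ffun 'I_k * 'I_n -> C}} |
      [forall s : {ffun 'I_k -> 'I_n}, ~~ typical w (typ_stat pi w g) e (pointwise (pick_cols s) z)])
    prod_law (prod_law pi) z) *
  (1 - variance_sum w (typ_stat pi w g) / (p%:R * e ^+ 2)) <=
  (2 ^ k)%:R * expR (- (p%:R * e)).
Proof.
set P0 := \sum_(z | _) _.
have P00 : 0 <= P0.
  by apply: sumr_ge0 => z _; apply: prod_law_ge0 => r; exact: prod_law_ge0.
have I0 : (0 < #|'I_p|)%N by rewrite card_ord.
have := second_moment_method 'I_p pi0 pi1 w0 wpi g e n0; rewrite -/P0.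
have := typical_weight (typ_stat pi w g) w0 w1 e0 I0; rewrite card_ord.
move=> /(ler_wpM2l P00) h1 /(le_trans h1) /le_trans; apply.
have -> : (2 ^ k)%:R * expR (- (p%:R * e)) =
   \sum_(U : {set 'I_k}) expR (- (p%:R * e)).
  have := card_powerset [set: 'I_k]%SET; rewrite powersetT cardsT cardsE card_ord => ec.
  by rewrite sumr_const ec -[RHS]mulr_natl.
rewrite big_mkcond; apply: ler_sum => U _; case: ifPn => [U0|_]; last exact: expR_ge0.
rewrite ler_pdivrMr ?ltr0n ?expn_gt0 ?n0//.
have <- : expR (#|U|%:R * ln n%:R) = (n ^ #|U|)%:R :> R.
  by rewrite expRM_natl lnK ?posrE ?ltr0n// natrX.
rewrite -expRD ler_expR; have := rate U0; set Dv := rel_entropy _ _.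
rewrite !mulrDr; lra.
Qed.

End LowerProbability.

(** * From random matrices to laws of cells *)

Section Transfer.
Context {R : realType} d (T : measurableType d) (P : probability T R).
Variables (p n : nat) (X : 'I_p -> 'I_n -> {RV P >-> R}) (mu : probability R R).
Hypothesis Xiid : iid_with_law (fun ij : 'I_p * 'I_n => X ij.1 ij.2) mu.
Variables (C : finType) (c : R -> C).
Hypothesis mc : forall e, measurable (c @^-1` [set e]).
Variables (K : finType) (kap : K -> 'I_n).
Hypothesis kapI : injective kap.

Definition cellmx (om : T) : {ffun 'I_p -> {ffun K -> C}} :=
  [ffun i => [ffun a => c (X i (kap a) om)]].

(** The condition imposed on a matrix entry by [z]; it is void outside the columns selected by [kap]. *)
Let entry (z : {ffun 'I_p -> {ffun K -> C}}) (ij : 'I_p * 'I_n) : set R :=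
  \bigcap_(a in [set a | kap a = ij.2]) (c @^-1` [set z ij.1 a]).

Let mentry z ij : measurable (entry z ij).
Proof. by apply: fin_bigcap_measurable => //; exact: finite_finset. Qed.

Let entry_kap z i a : entry z (i, kap a) = c @^-1` [set z i a].
Proof.
apply/seteqP; split => x; first by move=> /(_ a erefl).
by move=> xa b /= /kapI ->.
Qed.

Let index_set := [set (ia.1, kap ia.2) | ia in [set: 'I_p * K]]%SET.

Lemma cellmx_preimage z : cellmx @^-1` [set z] =
  \bigcap_(ij in [set` index_set]) (X ij.1 ij.2 @^-1` entry z ij).
Proof.
apply/seteqP; split => om /=.
  by move=> <- _ /= /imsetP[[i a] _ ->] /=; rewrite entry_kap /= !ffunE.
move=> H; apply/ffunP => i; apply/ffunP => a; rewrite !ffunE.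
have := H (i, kap a); rewrite /= entry_kap; apply.
by apply/imsetP; exists (i, a); rewrite ?inE.
Qed.

Lemma measurable_cellmx z : measurable (cellmx @^-1` [set z]).
Proof.
rewrite cellmx_preimage; apply: fin_bigcap_measurable => [|ij _].
  exact: finite_finset.
by rewrite -[X in measurable X]setTI; exact: measurable_funP.
Qed.

(** Independence and identical distribution turn the law of the cells into a product law. *)
Lemma cellmx_law z : cell_law cellmx P z = prod_law (prod_law (cell_law c mu)) z.
Proof.
have [ind law] := Xiid.
rewrite /cell_law cellmx_preimage ind => [|ij _]; last exact: mentry.
rewrite big_imset /=; last by move=> [i a] [j b] _ _ [-> /kapI ->].
rewrite (eq_bigl xpredT) => [|ia]; last by rewrite inE.
rewrite -(pair_bigA _ (fun i a => P (X i (kap a) @^-1` entry z (i, kap a)))) /=.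
rewrite /prod_law.
have e i a : P (X i (kap a) @^-1` entry z (i, kap a)) = (cell_law c mu (z i a))%:E.
  rewrite entry_kap; apply: etrans (cell_lawE mc mu (z i a)).
  exact: (law (i, kap a) _ (mc (z i a))).
rewrite (eq_bigr (fun i => (\prod_a cell_law c mu (z i a))%:E)) => [|i _].
  by rewrite prodEFin.
by rewrite -prodEFin; apply: eq_bigr => a _; exact: e.
Qed.

Lemma cellmx_prob (b : pred {ffun 'I_p -> {ffun K -> C}}) :
  measurable [set om | b (cellmx om)] /\
  P [set om | b (cellmx om)] =
    (\sum_(z | b z) prod_law (prod_law (cell_law c mu)) z)%:E.
Proof.
have mb : measurable [set om | b (cellmx om)].
  exact: (measurable_cell measurable_cellmx [set z | b z]).
split => //; rewrite -[LHS]fineK ?fin_num_measure//; congr EFin.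
have e : [set om | b (cellmx om)] = ((b : _ -> bool) \o cellmx) @^-1` [set true].
  by apply/seteqP; split => om /=.
rewrite e (cell_law_image measurable_cellmx P (b : _ -> bool) true) /image_law.
by apply: eq_big => [z|z _]; [case: (b z)|rewrite cellmx_law].
Qed.

End Transfer.

Section MeasurableT.
Context {R : realType} d (T : measurableType d) (P : probability T R).
Variables (p n k : nat) (X : 'I_p -> 'I_n -> {RV P >-> R}).
Hypotheses (k0 : (0 < k)%N) (kn : (k <= n)%N).

Let mat om : 'M[R]_(p, n) := \matrix_(i < p, j < n) X i j om.

(** The bound amounts to a family of quadratic inequalities, for which integer vectors
suffice: a countable intersection. *)
Lemma measurable_T_nk_le (a : R) : measurable [set om | T_nk k (mat om) <= a].
Proof.
pose Q (s : {ffun 'I_k -> 'I_n}) (z : {ffun 'I_k -> int}) : set T :=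
  [set om | \sum_i (\sum_b (z b)%:~R * X i (s b) om) ^+ 2 <=
            a * \sum_b (z b)%:~R ^+ 2].
rewrite (_ : mkset _ =
  \bigcap_(s in [set s : {ffun 'I_k -> 'I_n} | injective s]) \bigcap_z Q s z).
  apply: fin_bigcap_measurable => [|s _]; first exact: finite_finset.
  rewrite -[X in measurable X]setCK setC_bigcap; apply: measurableC.
  apply: countable_bigcupT_measurable => // z; apply: measurableC.
  have m : measurable_fun setT (fun om =>
      \sum_i (\sum_b (z b)%:~R * X i (s b) om) ^+ 2 <=
      a * \sum_b (z b)%:~R ^+ 2).
    apply: measurable_fun_ler => //; apply: measurable_sum => i.
    apply: measurable_funX; apply: measurable_sum => b.
    by apply: measurable_funM => //; exact: measurable_funP.
  by have := m measurableT [set true] I; rewrite setTI.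
apply/seteqP; split => om /=.
  move=> Ta s sI z _; rewrite /Q /=.
  apply: le_trans (ler_wpM2r _ Ta); last first.
    by apply: sumr_ge0 => b _; exact: sqr_ge0.
  apply: le_trans (le_T_nk (mat om) k0 _ sI).
  rewrite le_eqVlt; apply/orP; left; apply/eqP; apply: eq_bigr => i _.
  by congr (_ ^+ 2); apply: eq_bigr => b _; rewrite mxE.
move=> H; apply: T_nk_le => // s v sI v1.
have sI' : injective [ffun b => s b] by move=> b b'; rewrite !ffunE => /sI.
have := @int_quadratic_dense R p k (fun i b => X i (s b) om) a _ v.
rewrite v1 mulr1 => h; apply: le_trans (h _).
  rewrite le_eqVlt; apply/orP; left; apply/eqP; apply: eq_bigr => i _.
  by congr (_ ^+ 2); apply: eq_bigr => b _; rewrite mxE.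
move=> z; have := H _ sI' z I; rewrite /Q /=.
by congr (_ <= _); apply: eq_bigr => i _; congr (_ ^+ 2); apply: eq_bigr => b _;
  rewrite ffunE.
Qed.

(** Strict inequalities are countable unions of non-strict ones. *)
Lemma measurable_deviation (l e : R) : (0 < p)%N ->
  measurable [set om | e < `|T_nk k (mat om) / p%:R - l|].
Proof.
move=> p0; have pp : 0 < p%:R :> R by rewrite ltr0n.
rewrite (_ : mkset _ = ~` [set om | T_nk k (mat om) <= (l + e) * p%:R] `|`
  \bigcup_m [set om | T_nk k (mat om) <= (l - e) * p%:R - m.+1%:R^-1]).
  apply: measurableU; first exact/measurableC/measurable_T_nk_le.
  by apply: bigcup_measurable => m _; exact: measurable_T_nk_le.
apply/seteqP; split => om /=.
  rewrite ltNge ler_norml negb_and -!ltNge => /orP[h|h]; [right|left].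
    have : T_nk k (mat om) < (l - e) * p%:R by rewrite -ltr_pdivrMr//; lra.
    rewrite -subr_gt0 => /ltr_add_invr[m]; rewrite add0r => hm.
    by exists m => //=; rewrite lerBrDl -lerBrDr ltW.
  by apply/negP; rewrite -ltNge -ltr_pdivlMr//; lra.
rewrite ltNge ler_norml negb_and -!ltNge => -[h|[m _ /= h]]; apply/orP; [right|left].
  by move: h => /negP; rewrite -ltNge -ltr_pdivlMr//; lra.
have : T_nk k (mat om) / p%:R < l - e; last by lra.
rewrite ltr_pdivrMr//; apply: le_lt_trans h _.
by rewrite ltrBlDr ltrDl invr_gt0.
Qed.

End MeasurableT.

(** * Asymptotic estimates *)

Section Asymptotics.
Context {R : realType}.

Lemma expr_le_expR (x : R) m : 0 <= x -> x ^+ m.+1 <= m.+1%:R ^+ m.+1 * expR x.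
Proof.
move=> x0; have m0 : 0 < m.+1%:R :> R by rewrite ltr0n.
have -> : expR x = expR (x / m.+1%:R) ^+ m.+1.
  by rewrite -expRM_natl mulrC divfK// gt_eqF.
rewrite -exprMn lerXn2r ?nnegrE ?mulr_ge0 ?expR_ge0//.
rewrite mulrC -ler_pdivrMr//; apply: le_trans (expR_ge1Dx _).
by rewrite lerDr.
Qed.

Lemma expRN_le (y : R) : 0 < y -> expR (- y) <= y^-1.
Proof.
move=> y0; rewrite expRN lef_pV2 ?posrE ?expR_gt0//.
by apply: le_trans (expR_ge1Dx _); rewrite lerDr.
Qed.

(** In terms of [y = 1 + ln (1 + x)], the exponential [1 + x] dominates [y ^+ m.+1]. *)
Lemma polylog_small (m : nat) (cst : R) : 0 < cst ->
  exists M : R, forall x : R, M <= x -> (1 + ln (1 + x)) ^+ m <= cst * x.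
Proof.
move=> c0; pose D : R := 2 * m.+1%:R ^+ m.+1 * expR 1.
have D0 : 0 < D by rewrite !mulr_gt0 ?expR_gt0 ?exprn_gt0.
exists (1 + expR (D / cst)) => x Mx.
have x1 : 1 <= x by apply: le_trans Mx; rewrite lerDl expR_ge0.
have x0 : 0 < x by apply: lt_le_trans x1.
set y := 1 + ln (1 + x).
have l0 : D / cst <= ln (1 + x).
  rewrite -[leLHS]expRK ler_ln ?posrE ?expR_gt0 ?addr_gt0//.
  by move: Mx; set q := expR _; lra.
have Dc0 : 0 < D / cst by rewrite divr_gt0.
have y0 : 0 < y by rewrite /y; lra.
have yD : D / cst <= y by rewrite /y; lra.
have : y ^+ m.+1 <= D * x.
  apply: le_trans (expr_le_expR m (ltW y0)) _.
  rewrite /y expRD lnK ?posrE ?addr_gt0// /D.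
  have -> : 2 * m.+1%:R ^+ m.+1 * expR 1 * x = m.+1%:R ^+ m.+1 * (expR 1 * (2 * x)) by ring.
  rewrite ler_wpM2l ?exprn_ge0// ler_wpM2l ?expR_ge0//; lra.
rewrite exprSr => h.
rewrite -(ler_pM2r y0); apply: le_trans h _.
rewrite [leRHS]mulrAC ler_pM2r//; move: yD; rewrite ler_pdivrMr//.
by rewrite mulrC.
Qed.

(** Enough cells for the outer ones to start beyond [x]. The logarithmic growth keeps
the number of types subexponential. *)
Definition ncells (r x : R) : nat := (Num.truncn (ln (1 + x) / ln r)).+1.

Lemma ncells_reach (r x : R) : 1 < r -> 0 <= x -> 1 + x <= r ^+ ncells r x.
Proof.
move=> r1 x0; have lr : 0 < ln r by rewrite ln_gt0.
have r0 : 0 < r by apply: lt_trans r1.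
rewrite -ler_ln ?posrE ?exprn_gt0 ?ltr_pwDl// lnXn// -mulr_natl.
rewrite -ler_pdivrMr//; apply: ltW; exact: truncnS_gt.
Qed.

Lemma ncells_le (r x : R) : 1 < r -> 0 <= x ->
  (2 * (ncells r x).+1)%:R <= (2 / ln r + 4) * (1 + ln (1 + x)).
Proof.
move=> r1 x0; have lr : 0 < ln r by rewrite ln_gt0.
have l0 : 0 <= ln (1 + x) by rewrite ln_ge0 ?lerDl.
have : (Num.truncn (ln (1 + x) / ln r))%:R <= ln (1 + x) / ln r.
  by rewrite truncn_le divr_ge0// ltW.
have e (j : nat) : (2 * j.+2)%:R = 2 * (j%:R + 2) :> R.
  by rewrite natrM -[j.+2]addn2 [(j + 2)%:R]natrD.
rewrite /ncells e.
move: l0; set u := ln (1 + x); set q := (Num.truncn _)%:R => u0 qu.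
have -> : (2 / ln r + 4) * (1 + u) = 2 * (u / ln r) + 2 / ln r + 4 + 4 * u.
  by field; rewrite gt_eqF.
have : 0 < 2 / ln r by rewrite divr_gt0.
lra.
Qed.

(** The first term is small because [n] is at most exponential in [p] while the tail
is Gaussian; the second because the number of types is at most the exponential of
a power of [ln p]. *)
Lemma upper_asymptotics (k : nat) (r dl t E b tau : R) :
  1 < r -> 0 < dl -> 0 < t -> 0 <= E -> 0 < tau ->
  exists M : R, forall p n : nat, M <= p%:R -> (0 < n)%N -> ln n%:R <= p%:R * b ->
    (p * n)%:R * (E * expR (- (t * p%:R ^+ 2))) +
    (2 ^ k)%:R * ((p.+1 ^ (((ncells r p%:R).+1 * 2) ^ k))%:R *
                  expR (- (p%:R * dl))) <= tau.
Proof.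
move=> r1 dl0 t0 E0 tau0.
pose A : R := 2 / ln r + 4.
have lr : 0 < ln r by rewrite ln_gt0.
have A0 : 0 < A by rewrite addr_gt0// divr_gt0.
have [M1 hM1] := @polylog_small k.+1 (dl / 2 / A ^+ k) (divr_gt0 (divr_gt0 dl0 (@ltr0Sn R 1)) (exprn_gt0 _ A0)).
pose M := 1 + `|M1| + `|2 + b| / t + 2 * E / tau + (2 ^ k)%:R * 4 / (dl * tau).
have T1 : 0 <= `|2 + b| / t by rewrite divr_ge0// ltW.
have T2 : 0 <= 2 * E / tau by rewrite divr_ge0 ?mulr_ge0// ltW.
have T3 : 0 <= (2 ^ k)%:R * 4 / (dl * tau) by rewrite divr_ge0 ?mulr_ge0// ltW.
have T4 := normr_ge0 M1.
exists M => p n Mp n0 lnp; rewrite /M in Mp.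
set x : R := p%:R in Mp lnp *.
have x1 : 1 <= x by lra.
have x0 : 0 < x by lra.
have n00 : 0 < n%:R :> R by rewrite ltr0n.
have -> : tau = tau / 2 + tau / 2 by field.
apply: lerD.
  have pe : x <= expR x by apply: le_trans (expR_ge1Dx _); rewrite lerDr.
  have ne : n%:R <= expR (x * b) by rewrite -[leLHS]lnK ?posrE// ler_expR.
  have t2x : `|2 + b| / t <= x by lra.
  rewrite ler_pdivrMr// in t2x.
  apply: (@le_trans _ _ (E * expR (- x))).
    rewrite natrM -/x mulrCA ler_wpM2l//.
    apply: (@le_trans _ _ (expR x * expR (x * b) * expR (- (t * x ^+ 2)))).
      rewrite ler_wpM2r ?expR_ge0// ler_pM//; exact: ltW.
    rewrite -!expRD ler_expR.
    have := ler_norm (2 + b); nra.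
  have := expRN_le x0 => h.
  apply: (@le_trans _ _ (E * x^-1)); first by rewrite ler_wpM2l.
  have : 2 * E / tau <= x by lra.
  by rewrite ler_pdivrMr// -ler_pdivlMl// => h2; rewrite ler_pdivrMr//; lra.
have N0 := ncells_le r1 (ltW x0).
set N := ncells r x in N0 *.
have cnt : (((N.+1 * 2) ^ k)%:R : R) * ln (1 + x) <= x * (dl / 2).
  have l0 : 0 <= ln (1 + x) by rewrite ln_ge0// lerDl ltW.
  apply: (@le_trans _ _ (A ^+ k * (1 + ln (1 + x)) ^+ k.+1)).
    rewrite exprSr mulrA ler_pM//; last by lra.
    rewrite natrX -exprMn lerXn2r ?nnegrE ?mulr_ge0 ?(ltW A0)//; first by lra.
    by rewrite mulnC.
  have M1x : M1 <= x by have := ler_norm M1; lra.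
  have := hM1 _ M1x; rewrite -(ler_pM2l (exprn_gt0 k A0)) => /le_trans; apply.
  rewrite le_eqVlt; apply/orP; left; apply/eqP.
  by field; rewrite gt_eqF// exprn_gt0.
have -> : (p.+1 ^ ((N.+1 * 2) ^ k))%:R = expR (((N.+1 * 2) ^ k)%:R * ln (1 + x)) :> R.
  by rewrite expRM_natl lnK ?posrE ?addr_gt0// /x nat1r natrX.
rewrite -expRD.
apply: (@le_trans _ _ ((2 ^ k)%:R * expR (- (x * (dl / 2))))).
  rewrite ler_wpM2l// ler_expR; lra.
have d2 : 0 < x * (dl / 2) by rewrite !mulr_gt0// invr_gt0.
apply: (@le_trans _ _ ((2 ^ k)%:R * (x * (dl / 2))^-1)).
  by rewrite ler_wpM2l// expRN_le.
have h3 : (2 ^ k)%:R * 4 / (dl * tau) <= x by lra.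
rewrite ler_pdivrMr ?mulr_gt0// in h3.
rewrite ler_pdivrMr//; nra.
Qed.

(** The left-hand side is [L + O(h)]. *)
Lemma upper_constant (k : nat) (L e : R) : 0 <= L -> 0 < e ->
  exists h, [/\ 0 < h, h < 1 &
    ((1 + h) * L + 2 * h * (1 + h) * (k%:R + k%:R * L)) / (1 - h) <= L + e].
Proof.
move=> L0 e0; pose A := L + 4 * (k%:R * (1 + L)).
have k0 : 0 <= k%:R :> R by [].
have kL : 0 <= k%:R * (1 + L) by rewrite mulr_ge0// addr_ge0.
have A0 : 0 <= A by rewrite /A; lra.
have S0 : 0 < 2 * (L + A + 1) by lra.
pose h := Num.min (1 / 2) (e / (2 * (L + A + 1))).
have h0 : 0 < h by rewrite lt_min divr_gt0//= divr_gt0.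
have h1 : h <= 1 / 2 by rewrite ge_min lexx.
have h2 : h * (2 * (L + A + 1)) <= e by rewrite -ler_pdivlMr// ge_min lexx orbT.
exists h; split => //; first by lra.
rewrite ler_pdivrMr; last by lra.
have -> : k%:R + k%:R * L = k%:R * (1 + L) by ring.
move: h2; rewrite /A; set K := k%:R * (1 + L) in kL *; move=> h2.
have e1 : e * h <= e * (1 / 2) by rewrite ler_pM2l.
have hK0 : 0 <= h * K by rewrite mulr_ge0// ltW.
have hK : h * K * h <= h * K * (1 / 2) by rewrite ler_wpM2l.
have e2 : h * (2 * (L + (L + 4 * K) + 1)) = 4 * (h * L) + 8 * (h * K) + 2 * h by ring.
rewrite e2 in h2.
have -> : (1 + h) * L + 2 * h * (1 + h) * K =
  L + h * L + 2 * (h * K) + 2 * (h * K * h) by ring.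
have -> : (L + e) * (1 - h) = L - h * L + e - e * h by ring.
lra.
Qed.

(** Either [G] is already large, or it is at most [2 * L] and the errors are [O(h)]. *)
Lemma lower_constant (k : nat) (L e : R) : 0 <= L -> 0 < e ->
  exists h, [/\ 0 < h, h < 1 & forall q G : R, 0 <= G -> L - e / 4 <= q ->
    q <= (1 + h) * G + 2 * h * (1 + h) * (k%:R + k%:R * L) + e / 4 ->
    L - 3 / 4 * e <= (1 - h) * G].
Proof.
move=> L0 e0.
have kL : 0 <= k%:R * (1 + L) by rewrite mulr_ge0// addr_ge0.
set K := k%:R * (1 + L) in kL.
have S0 : 0 < 4 * (3 * K + 4 * L + 1) by lra.
pose h := Num.min (1 / 2) (e / (4 * (3 * K + 4 * L + 1))).
have h0 : 0 < h by rewrite lt_min divr_gt0//= divr_gt0.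
have h1 : h <= 1 / 2 by rewrite ge_min lexx.
have h2 : h * (4 * (3 * K + 4 * L + 1)) <= e by rewrite -ler_pdivlMr// ge_min lexx orbT.
exists h; split => //; first by lra.
move=> q G G0 hq; have -> : k%:R + k%:R * L = K by rewrite /K; ring.
move=> hG; have [big|small] := leP L ((1 - h) * G); first by lra.
have G2 : G <= 2 * L by nra.
have hK : 2 * h * (1 + h) * K <= 3 * (h * K).
  have : 0 <= h * K by rewrite mulr_ge0// ltW.
  nra.
have hGL : h * G <= h * (2 * L) by rewrite ler_pM2l.
nra.
Qed.

End Asymptotics.

(** * Convergence in probability *)

Section Halves.
Context {R : realType}.
Variables (k : nat) (beta : R) (mu : probability R R).
Hypotheses (k0 : (0 < k)%N) (beta0 : 0 < beta).
Hypothesis mu2 : (\int[mu]_x (x ^+ 2)%:E < +oo)%E.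
Hypothesis muexp : exists2 t : R, 0 < t &
  (\int[mu]_x (expR (t * x ^+ 2))%:E < +oo)%E.
Variable p : nat -> nat.
Hypothesis hp : (fun n => (p n)%:R / ln n%:R : R) @ \oo --> beta.

Local Notation L := (sup [set lambda_max Q | Q in Gamma_set k beta mu]).

Lemma nrows_near (M : R) : \forall n \near \oo, M <= (p n)%:R.
Proof.
have b2 : 0 < beta / 2 by rewrite divr_gt0.
near=> n.
have n1 : 1 < n%:R :> R by near: n; exact: nbhs_infty_gtr.
have ln0 : 0 < ln n%:R :> R by rewrite ln_gt0.
have : M / (beta / 2) <= ln n%:R.
  rewrite -[leLHS]expRK ler_ln ?posrE ?expR_gt0 ?(lt_trans ltr01)//.
  by near: n; exact: nbhs_infty_ger.
rewrite ler_pdivrMr// => /le_trans; apply.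
rewrite mulrC -ler_pdivlMr//.
have : `|beta - (p n)%:R / ln n%:R| <= beta / 2.
  by near: n; move/cvgrPdist_le : hp => /(_ _ b2).
rewrite ler_norml => /andP[_]; lra.
Unshelve. all: by end_near. Qed.

Lemma rate_near (e : R) : 0 < e -> \forall n \near \oo,
  (p n)%:R * (beta^-1 - e) <= ln n%:R <= (p n)%:R * (beta^-1 + e).
Proof.
move=> e0.
have /cvgrPdist_le /(_ _ e0) H :
    (fun n => ((p n)%:R / ln n%:R)^-1 : R) @ \oo --> beta^-1.
  by apply: cvgV => //; rewrite gt_eqF.
near=> n.
have p1 : 1 <= (p n)%:R :> R by near: n; exact: nrows_near.
have p0 : 0 < (p n)%:R :> R by lra.
have : `|beta^-1 - ((p n)%:R / ln n%:R)^-1| <= e by near: n.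
rewrite invf_div ler_norml => /andP[h1 h2].
apply/andP; split.
  by rewrite mulrC -ler_pdivlMr//; lra.
by rewrite mulrC -ler_pdivrMr//; lra.
Unshelve. all: by end_near. Qed.

(** Exponential Markov inequality for the square. *)
Lemma outer_prob (r t : R) (J : nat) (y : R) : 1 < r -> 0 < t -> 0 <= y ->
  1 + y <= r ^+ J -> (\int[mu]_x (expR (t * x ^+ 2))%:E < +oo)%E ->
  \sum_(e | outer e) cell_law (geom_cell r J) mu e <=
  fine (\int[mu]_x (expR (t * x ^+ 2))%:E) * expR (- (t * y ^+ 2)).
Proof.
move=> r1 t0 y0 yJ Efin.
have mE : measurable_fun setT (fun x : R => (expR (t * x ^+ 2))%:E).
  apply/measurable_EFinP; apply: measurableT_comp => //.
  by apply: measurable_funM => //; exact: measurable_funX.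
have EF : (\int[mu]_x (expR (t * x ^+ 2))%:E)%E \is a fin_num.
  by rewrite ge0_fin_numE//; apply: integral_ge0 => x _; rewrite lee_fin expR_ge0.
have mc e : measurable (geom_cell r J @^-1` [set e]) by exact: measurable_geom_cell.
have -> : \sum_(e | outer e) cell_law (geom_cell r J) mu e =
    \sum_e (outer e)%:R * cell_law (geom_cell r J) mu e.
  rewrite big_mkcond; apply: eq_bigr => e _.
  by case: (outer e); rewrite ?mul1r ?mul0r.
rewrite -lee_fin -(integral_cell mc mu (fun e => (outer e)%:R)) EFinM fineK// muleC.
rewrite -ge0_integralZl//.
apply: ge0_le_integral => //.
- apply/measurable_EFinP.
  exact: (measurable_fun_cell mc (fun e => (outer e)%:R : R)).
- by apply: emeasurable_funM => //; exact/measurable_EFinP.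
move=> x _; rewrite -EFinM lee_fin -expRD; case: (boolP (outer _)) => [|_].
  rewrite (outer_geom_cell _ r1) => ox.
  have yx : y <= `|x| by lra.
  rewrite -[leLHS]expR0 ler_expR addrC -mulrBr mulr_ge0 ?(ltW t0)// subr_ge0.
  by rewrite -[x ^+ 2]real_normK ?num_real// lerXn2r ?nnegrE.
exact: expR_ge0.
Qed.

Variables (d : nat -> measure_display) (T : forall n, measurableType (d n)).
Variable P : forall n, probability (T n) R.
Variable X : forall n, 'I_(p n) -> 'I_n -> {RV (P n) >-> R}.
Arguments X : clear implicits.
Hypothesis X_iid : forall n,
  iid_with_law (fun ij : 'I_(p n) * 'I_n => X n ij.1 ij.2) mu.

Let mat n (om : T n) : 'M[R]_(p n, n) := \matrix_(i < p n, j < n) X n i j om.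

(** The cells reach beyond [p n], a distance that grows with [n] although the mesh is fixed. *)
Lemma upper_half (eps tau : R) : 0 < eps -> 0 < tau ->
  \forall n \near \oo, exists2 B : set (T n),
    measurable B /\ (P n B <= tau%:E)%E &
    forall om, ~ B om -> T_nk k (mat om) <= (p n)%:R * (L + eps).
Proof.
move=> eps0 tau0; have [t t0 tE] := muexp.
set E := (\int[mu]_x (expR (t * x ^+ 2))%:E)%E in tE.
have fE0 : 0 <= fine E.
  by apply/fine_ge0/integral_ge0 => x _; rewrite lee_fin expR_ge0.
have L0 : 0 <= L := sup_lambda_ge0 k0 beta0 mu2 muexp.
have [h [h0 h1 hle]] := upper_constant k L0 eps0.
(* A quarter of the gain from mixing: one share goes to the deviation of
   [ln n / p n], one to the margin in the union bound. *)
pose dl := h / (4 * beta).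
have dl0 : 0 < dl by rewrite divr_gt0// mulr_gt0.
have r1 : 1 < 1 + h by rewrite ltrDl.
have [M hM] := upper_asymptotics k (beta^-1 + 1) r1 dl0 t0 fE0 tau0.
near=> n.
have pM : M <= (p n)%:R by near: n; exact: nrows_near.
have p1 : 1 <= (p n)%:R :> R by near: n; exact: nrows_near.
have kn : (k <= n)%N by near: n; exact: nbhs_infty_ge.
have /andP[_ rate1] : (p n)%:R * (beta^-1 - 1) <= ln n%:R <= (p n)%:R * (beta^-1 + 1).
  by near: n; exact: rate_near.
have /andP[_ rated] : (p n)%:R * (beta^-1 - dl) <= ln n%:R <= (p n)%:R * (beta^-1 + dl).
  by near: n; exact: rate_near.
have p0 : (0 < p n)%N by rewrite -(ltr0n R); lra.
have n0 : (0 < n)%N by exact: leq_trans kn.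
pose J := ncells (1 + h) (p n)%:R.
pose c := geom_cell (1 + h) J.
have mc e : measurable (c @^-1` [set e]) by exact: measurable_geom_cell.
pose badn := atypical_matrix (p := p n) (n := n) k (cell_law c mu) (@outer J) dl.
have pi0 e : 0 <= cell_law c mu e by exact: cell_law_ge0.
have pi1 : \sum_e cell_law c mu e = 1 by rewrite sum_cell_law.
have [mB PB] := cellmx_prob (X_iid n) mc (@inj_id 'I_n) badn.
exists [set om | badn (cellmx (X n) c id om)].
  split => //; rewrite PB lee_fin.
  apply: le_trans (@atypical_matrix_prob R (p n) n k _ _ (@outer J) dl pi0 pi1 n0 _) _.
    by apply/card_gt0P; exists (ord0, true).
  apply: le_trans (hM _ _ pM n0 rate1).
  rewrite card_prod card_ord card_bool lerD2r ler_wpM2l//.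
  by apply: outer_prob => //; exact: ncells_reach.
move=> om /negP nb; apply: le_trans (ler_wpM2l (ler0n R (p n)) hle).
apply: (@typical_T_nk_le R k beta mu k0 beta0 mu2 muexp (p n) n h J dl h) => //.
- move=> m m0.
  have pp : 0 < (p n)%:R :> R by lra.
  have m1 : 1 <= m%:R :> R by rewrite ler1n.
  have -> : cost (p n) n dl m / (p n)%:R = m%:R * (ln n%:R / (p n)%:R) + dl.
    by rewrite /cost; field; rewrite gt_eqF.
  have ratio : ln n%:R / (p n)%:R <= beta^-1 + dl by rewrite ler_pdivrMr// mulrC.
  have b0 : 0 < beta^-1 by rewrite invr_gt0.
  have dlE : dl = h * beta^-1 / 4 by rewrite /dl; field; rewrite gt_eqF.
  have s1 : m%:R * (ln n%:R / (p n)%:R) + dl <= m%:R * (beta^-1 * (1 + h / 2)).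
    apply: (@le_trans _ _ (m%:R * (beta^-1 + dl) + m%:R * dl)).
      apply: lerD; first by rewrite ler_wpM2l.
      by rewrite ler_peMl// ltW.
    by rewrite dlE le_eqVlt; apply/orP; left; apply/eqP; field; rewrite gt_eqF.
  apply: le_trans (ler_wpM2l _ s1) _; first by lra.
  have mb : 0 < m%:R * beta^-1 by rewrite mulr_gt0// ltr0n.
  have -> : (1 - h) * (m%:R * (beta^-1 * (1 + h / 2))) =
    (m%:R * beta^-1) * ((1 - h) * (1 + h / 2)) by ring.
  rewrite ler_piMr ?(ltW mb)//; nra.
- move: nb; congr (~~ badn _).
  by apply/ffunP => i; apply/ffunP => j; rewrite !ffunE mxE.
Unshelve. all: by end_near. Qed.

(** The cells are fixed along with [nu]. The constraints being strict after mixing, there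
is room for the deviations allowed by typicality and for the loss of a factor about
[k] in the number of columns of a block. *)
Lemma lower_half (eps tau : R) : 0 < eps -> 0 < tau ->
  \forall n \near \oo, exists2 B : set (T n),
    measurable B /\ (P n B <= tau%:E)%E &
    forall om, ~ B om -> (p n)%:R * (L - eps) <= T_nk k (mat om).
Proof.
move=> eps0 tau0.
have L0 : 0 <= L := sup_lambda_ge0 k0 beta0 mu2 muexp.
have [h [h0 h1 hlow]] := lower_constant k L0 eps0.
have e40 : 0 < eps / 4 by lra.
have [nu Mnu [v v1 qnu]] := M_set_near_sup k0 beta0 mu2 muexp e40.
have [nu2 nuKL] := Mnu.
have [J hJ] := inner_moment_near nu2 h0 e40.
pose c := geom_cell (1 + h) J; pose pi := cell_law c mu.
have mc e : measurable (c @^-1` [set e]) by exact: measurable_geom_cell.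
have pi0 e : 0 <= pi e by exact: cell_law_ge0.
have pi1 : \sum_e pi e = 1 by rewrite sum_cell_law.
pose ct := cell_law (@tuple_cell R _ c k) nu.
have ct0 d0 : 0 <= ct d0 by exact: cell_law_ge0.
have ct1 : \sum_d0 ct d0 = 1 by apply: sum_cell_law; exact: measurable_tuple_cell.
have ctpi d0 : prod_law pi d0 = 0 -> ct d0 = 0.
  apply: (cell_law_dominated mc (mu := mu)); apply: KL_le_dominates.
  by apply: nuKL; apply/set0Pn; exists (Ordinal k0); rewrite inE.
have t0 d0 : 0 <= prod_law pi d0 by move=> *; exact: prod_law_ge0.
pose w (d0 : {ffun 'I_k -> 'I_J.+1 * bool}) : R := (1 - h) * ct d0 + h * prod_law pi d0.
have w0 d0 : 0 <= w d0 by rewrite addr_ge0// mulr_ge0// ?subr_ge0 ltW.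
have w1 : \sum_d0 w d0 = 1.
  by rewrite big_split /= -!mulr_sumr ct1 sum_prod_law1// !mulr1 subrK.
have wpi d0 : prod_law pi d0 = 0 -> w d0 = 0.
  by move=> td; rewrite /w ctpi// td !mulr0 addr0.
have Dw (U : {set 'I_k}) : U != finset.set0 ->
    rel_entropy (marg_law U w) (prod_law pi) <= (1 - h) * (#|U|%:R / beta).
  move=> U0; apply: (@le_trans _ _ ((1 - h) * rel_entropy (marg_law U ct) (prod_law pi))); last first.
    rewrite ler_wpM2l ?subr_ge0 ?(ltW h1)//.
    by apply: (rel_entropy_marginal_le mc); exact: nuKL.
  apply: le_trans (rel_entropy_mix _ _ _ h0 h1).
  - rewrite le_eqVlt; apply/orP; left; apply/eqP; apply: eq_bigr => e _.
    have -> // : marg_law U w e = (1 - h) * marg_law U ct e + h * prod_law pi e.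
    rewrite -[X in h * X](marg_prod_law pi1) /marg_law /image_law big_split /=.
    by rewrite -!mulr_sumr.
  - by move=> e; exact: image_law_ge0.
  - by move=> e; exact: prod_law_ge0.
  - move=> e te; apply: big1 => d0 /eqP de; apply: ctpi; move: te.
    by rewrite -de prod_law_restr => eU; rewrite /prod_law (bigID (mem U)) /= eU mul0r.
pose g := @cell_inf R k h J v.
(* [4 * e] takes half of the gain [h / beta] due to mixing, and what remains pays for
   the block size [n %/ k]. *)
pose e := Num.min (eps / 4) (h / (8 * beta)).
have e0 : 0 < e by rewrite lt_min e40 divr_gt0// mulr_gt0.
have e1 : e <= eps / 4 by rewrite ge_min lexx.
have e2 : e <= h / (8 * beta) by rewrite ge_min lexx orbT.
pose V := variance_sum w (typ_stat pi w g).
have meang : L - 3 / 4 * eps <= mean w g.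
  have G0 : 0 <= \sum_d0 ct d0 * g d0.
    by apply: sumr_ge0 => d0 _; rewrite mulr_ge0// cell_inf_ge0.
  apply: (@le_trans _ _ ((1 - h) * \sum_d0 ct d0 * g d0)).
    apply: (hlow (qform (second_moment nu) v)) => //; first exact: ltW.
    have := cell_inf_mean J nu2 h0 v1 => /le_trans; apply.
    apply: lerD; last by lra.
    rewrite lerD2l ler_wpM2l ?mulr_ge0 ?addr_ge0 ?(ltW h0)// lerD2l.
    have -> : k%:R * L = \sum_(a < k) L by rewrite sumr_const card_ord mulr_natl.
    by apply: ler_sum => a _; exact: M_set_diag_le.
  rewrite /mean mulr_sumr; apply: ler_sum => d0 _.
  by rewrite mulrA ler_wpM2r ?cell_inf_ge0// lerDl mulr_ge0// ltW.
near=> n.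
have p1 : 1 <= (p n)%:R :> R by near: n; exact: nrows_near.
have pV : 2 * V / e ^+ 2 <= (p n)%:R by near: n; exact: nrows_near.
have ptau : (2 * (2 ^ k)%:R) / (e * tau) <= (p n)%:R by near: n; exact: nrows_near.
have pln : ln (2 * k%:R) / (h / (4 * beta)) <= (p n)%:R by near: n; exact: nrows_near.
have kn : (k <= n)%N by near: n; exact: nbhs_infty_ge.
have /andP[rate _] : (p n)%:R * (beta^-1 - h / (4 * beta)) <= ln n%:R
    <= (p n)%:R * (beta^-1 + h / (4 * beta)).
  by near: n; apply: rate_near; rewrite divr_gt0// mulr_gt0.
have p0 : (0 < p n)%N by rewrite -(ltr0n R); lra.
have pp : 0 < (p n)%:R :> R by lra.
(* [k] disjoint blocks of [m] columns. *)
pose m := (n %/ k)%N.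
have m0 : (0 < m)%N by rewrite divn_gt0.
have kmn : (#|{: 'I_k * 'I_m}| <= n)%N.
  by rewrite card_prod !card_ord mulnC leq_trunc_div.
pose kap (am : 'I_k * 'I_m) : 'I_n := widen_ord kmn (enum_rank am).
have kapI : injective kap.
  by move=> a b /(congr1 val) /= /val_inj/enum_rank_inj.
(* As [m >= 1], one has [n < k * (m + 1) <= 2 * k * m]. *)
have lnm : ln n%:R - ln (2 * k%:R) <= ln m%:R :> R.
  have kk : 0 < 2 * k%:R :> R by rewrite mulr_gt0// ltr0n.
  rewrite lerBlDr -lnM ?posrE ?ltr0n// ler_ln ?posrE ?mulr_gt0 ?ltr0n//.
    rewrite -[2 * _]natrM -natrM ler_nat.
    apply: leq_trans (ltnW (ltn_ceil n k0)) _; rewrite -/m.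
    by rewrite mulnA leq_mul2r muln2 -addnn -addn1 leq_add2l m0 orbT.
  exact: leq_trans kn.
have ratem (U : {set 'I_k}) : U != finset.set0 ->
    (p n)%:R * (rel_entropy (marg_law U w) (prod_law pi) + 4 * e) <= #|U|%:R * ln m%:R.
  move=> U0; have U1 : 1 <= #|U|%:R :> R by rewrite ler1n card_gt0.
  have hb : h / (4 * beta) = h * beta^-1 / 4 by field; rewrite gt_eqF.
  have hb8 : h / (8 * beta) = h * beta^-1 / 8 by field; rewrite gt_eqF.
  have b0 : 0 < beta^-1 by rewrite invr_gt0.
  have hb0 : 0 < h * beta^-1 by rewrite mulr_gt0.
  apply: (@le_trans _ _ ((p n)%:R * (#|U|%:R * (beta^-1 - h * beta^-1 / 2)))).
    rewrite ler_wpM2l//; have := Dw _ U0; rewrite hb8 in e2.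
    have : 4 * e <= #|U|%:R * (h * beta^-1 / 2).
      apply: (@le_trans _ _ (h * beta^-1 / 2)); first by lra.
      by rewrite ler_peMl//; lra.
    have -> : (1 - h) * (#|U|%:R / beta) =
      #|U|%:R * beta^-1 - #|U|%:R * (h * beta^-1) by ring.
    lra.
  rewrite mulrCA ler_wpM2l//; apply: le_trans lnm.
  move: pln rate; rewrite hb ler_pdivrMr; last by lra.
  lra.
pose b (z : {ffun 'I_(p n) -> {ffun 'I_k * 'I_m -> 'I_J.+1 * bool}}) :=
  [forall s : {ffun 'I_k -> 'I_m}, ~~ typical w (typ_stat pi w g) e (pointwise (pick_cols s) z)].
have [mB PB] := cellmx_prob (X_iid n) mc kapI b.
exists [set om | b (cellmx (X n) c kap om)].
  split => //; rewrite PB lee_fin.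
  have := no_typical_tuple_prob (p := p n) (n := m) g pi0 pi1 w0 w1 wpi e0 p0 m0 ratem.
  set P0 := \sum_(z | _) _ => hP.
  have P00 : 0 <= P0.
    by apply: sumr_ge0 => z _; apply: prod_law_ge0 => r; exact: prod_law_ge0.
  have V2 : V / ((p n)%:R * e ^+ 2) <= 1 / 2.
    rewrite ler_pdivrMr ?mulr_gt0 ?exprn_gt0//.
    move: pV; rewrite ler_pdivrMr ?exprn_gt0//; lra.
  have P02 : P0 * (1 / 2) <= P0 * (1 - V / ((p n)%:R * e ^+ 2)).
    by rewrite ler_wpM2l//; lra.
  have pe0 : 0 < (p n)%:R * e by rewrite mulr_gt0.
  have hexp := expRN_le pe0.
  have k2 : 0 <= (2 ^ k)%:R :> R by [].
  have h3 : P0 * (1 / 2) <= (2 ^ k)%:R * ((p n)%:R * e)^-1.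
    apply: le_trans P02 _; apply: le_trans hP _.
    by rewrite ler_wpM2l.
  have h4 : (2 ^ k)%:R * ((p n)%:R * e)^-1 <= tau / 2.
    rewrite ler_pdivrMr//; move: ptau; rewrite ler_pdivrMr ?mulr_gt0//; lra.
  rewrite -/P0; lra.
move=> om /negP /forallPn[s]; rewrite negbK => ty.
have sI : injective (fun a => kap (a, s a)) by move=> a a' /kapI [].
apply: le_trans (_ : _ <= T_nk k (mat om) * \sum_a v a ^+ 2) _; last first.
  by rewrite v1 mulr1.
apply: le_trans (le_T_nk (mat om) k0 v sI).
have := typicalP None ty => /andP[+ _]; rewrite card_ord /= => h5.
apply: (@le_trans _ _ ((p n)%:R * (mean w g - e))).
  by rewrite ler_wpM2l//; lra.
apply: le_trans h5 _; apply: ler_sum => i _.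
have -> : pointwise (pick_cols s) (cellmx (X n) c kap om) i =
    tuple_cell c [tuple X n i (kap (a, s a)) om | a < k].
  by apply/ffunP => a; rewrite !ffunE tnth_mktuple.
apply: le_trans (cell_inf_le h J v _) _.
rewrite le_eqVlt; apply/orP; left; apply/eqP; congr (_ ^+ 2).
by apply: eq_bigr => a _; rewrite tnth_mktuple mxE.
Unshelve. all: by end_near. Qed.

Lemma T_nk_ratio_in_probability :
  converges_in_probability P (fun n om => T_nk k (mat om) / (p n)%:R) L.
Proof.
move=> eps eps0; apply/fine_cvgP; split.
  near=> n; have p1 : 1 <= (p n)%:R :> R by near: n; exact: nrows_near.
  have kn : (k <= n)%N by near: n; exact: nbhs_infty_ge.
  have p0 : (0 < p n)%N by rewrite -(ltr0n R); lra.
  by apply: fin_num_measure; exact: measurable_deviation.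
apply/cvgrPdist_le => tau tau0.
have tau2 : 0 < tau / 2 by lra.
near=> n.
have p1 : 1 <= (p n)%:R :> R by near: n; exact: nrows_near.
have kn : (k <= n)%N by near: n; exact: nbhs_infty_ge.
have p0 : (0 < p n)%N by rewrite -(ltr0n R); lra.
have pp : 0 < (p n)%:R :> R by lra.
have [BU [mU PU] hU] : exists2 B : set (T n),
    measurable B /\ (P n B <= (tau / 2)%:E)%E &
    forall om, ~ B om -> T_nk k (mat om) <= (p n)%:R * (L + eps).
  by near: n; exact: upper_half.
have [BL [mL PL] hL] : exists2 B : set (T n),
    measurable B /\ (P n B <= (tau / 2)%:E)%E &
    forall om, ~ B om -> (p n)%:R * (L - eps) <= T_nk k (mat om).
  by near: n; exact: lower_half.
rewrite /=; set A := mkset _.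
have mA : measurable A by exact: measurable_deviation.
have AB : A `<=` BU `|` BL.
  move=> om; rewrite /A /= => dev; apply: contrapT => /not_orP[nU nL].
  move: dev; rewrite ltNge => /negP; apply; rewrite ler_norml.
  have := hU _ nU; have := hL _ nL; rewrite mulrC -ler_pdivlMr// => l1.
  rewrite mulrC -ler_pdivrMr// => l2.
  by apply/andP; split; lra.
have : (P n A <= tau%:E)%E.
  apply: (@le_trans _ _ (P n (BU `|` BL))).
    by apply: le_measure => //; rewrite inE//; exact: measurableU.
  apply: le_trans (measureU2 _ mU mL) _.
  by apply: le_trans (leeD PU PL) _; rewrite -EFinD lee_fin; lra.
move=> PA; rewrite sub0r normrN ger0_norm ?fine_ge0//.
by rewrite -lee_fin fineK// fin_num_measure.
Unshelve. all: by end_near. Qed.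

End Halves.

Theorem mainTheorem7 (R : realType) (k : nat) (hk : (1 <= k)%N)
  (d0 : measure_display) (T0 : measurableType d0) (P0 : probability T0 R)
  (xi : {RV P0 >-> R})
  (xi_mean : ('E_P0[xi] = 0)%E)
  (xi_var : ('E_P0[fun w => ((xi w : R) ^+ 2)%R] = 1)%E)
  (xi_exp : exists2 t0 : R, 0 < t0 &
    ('E_P0[fun w => expR (t0 * (xi w : R) ^+ 2)%R] < +oo)%E)
  (p : nat -> nat) (beta : R) (hbeta : 0 < beta)
  (hp : (fun n => (p n)%:R / ln n%:R : R) @ \oo --> beta)
  (d : nat -> measure_display) (T : forall n, measurableType (d n))
  (P : forall n, probability (T n) R)
  (X : forall n, 'I_(p n) -> 'I_n -> {RV (P n) >-> R})
  (X_iid : forall n,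
    iid_with_law (fun ij : 'I_(p n) * 'I_n => X n ij.1 ij.2)
                 (distribution P0 xi)) :
  converges_in_probability P
    (fun n w => T_nk k (\matrix_(i < p n, j < n) X n i j w) / (p n)%:R)
    (sup [set lambda_max Q | Q in Gamma_set k beta (distribution P0 xi)]).
Proof.
apply: T_nk_ratio_in_probability => //.
- rewrite ge0_integral_distribution.
  + by move: xi_var; rewrite unlock => ->; rewrite ltry.
  + by apply/measurable_EFinP; exact: measurable_funX.
  + by move=> x; rewrite lee_fin sqr_ge0.
- have [t t0 tE] := xi_exp; exists t => //; rewrite ge0_integral_distribution.
  + by move: tE; rewrite unlock.
  + apply/measurable_EFinP; apply: measurableT_comp => //.
    by apply: measurable_funM => //; exact: measurable_funX.
  + by move=> x; rewrite lee_fin expR_ge0.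
Qed.
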